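(* Let $l>\max\{p,1\}$, let $0<T<\infty$, suppose $\inf_{\partial\Omega\times Q_T}k(x,y,t)>0$, and suppose that the solution $u(x,t)$ of the problem $$u_t=\Delta u-c(x,t)u^p \ (x\in\Omega,\ t>0),\qquad \frac{\partial u}{\partial\nu}(x,t)=\int_\Omega k(x,y,t)u^l(y,t)\,dy\ (x\in\partial\Omega,\ t\ge 0),\qquad u(x,0)=u_0(x)\ (x\in\Omega)$$ with admissible initial datum $u_0$ blows up at $t=T$. Then blow-up can occur only on the boundary.
   Context: Setting: $p>0$, $l>0$; $\Omega\subset\mathbb R^n$ ($n\ge1$) is a bounded domain with smooth boundary $\partial\Omega$ and unit outward normal $\nu$. The coefficients satisfy $c\in C^{\alpha}_{loc}(\overline\Omega\times[0,+\infty))$ for some $0<\alpha<1$, $c\ge0$; $k\in C(\partial\Omega\times\overline\Omega\times[0,+\infty))$, $k\ge0$. An initial datum $u_0$ is admissible if $u_0\in C^1(\overline\Omega)$, $u_0\ge0$ in $\Omega$, and $\frac{\partial u_0}{\partial\nu}(x)=\int_\Omega k(x,y,0)u_0^l(y)\,dy$ on $\partial\Omega$. For $T>0$ let $Q_T=\Omega\times(0,T)$, $S_T=\partial\Omega\times(0,T)$, $\Gamma_T=S_T\cup(\overline\Omega\times\{0\})$; the infimum of $k$ over $\partial\Omega\times Q_T$ is over $x\in\partial\Omega$, $(y,t)\in Q_T$. A solution in $Q_T$ is a nonnegative function $u\in C^{2,1}(Q_T)\cap C^{1,0}(Q_T\cup\Gamma_T)$ satisfying the equation in $Q_T$, the boundary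 condition for $x\in\partial\Omega$, $0\le t<T$, and the initial condition ($C^{2,1}$: continuous derivatives up to order 2 in $x$ and 1 in $t$; $C^{1,0}$: $u$ and its first-order $x$-derivatives are continuous). A solution blows up at $t=T$ if it is a solution in $Q_T$ and $\limsup_{t\to T^-}\sup_{x\in\Omega}u(x,t)=\infty$. ''Blow-up can occur only on the boundary'' means: for every subdomain $\Omega'$ compactly contained in $\Omega$, $u$ is bounded on $\Omega'\times[0,T)$. *)

(* Defs.v *)
From mathcomp Require Import all_boot all_order all_algebra.
From mathcomp Require Import all_classical all_reals all_analysis.

Set Implicit Arguments.
Unset Strict Implicit.
Unset Printing Implicit Defensive.

Import Order.TTheory GRing.Theory Num.Theory.
Import numFieldNormedType.Exports.

Local Open Scope classical_set_scope.
Local Open Scope ring_scope.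

(* The library norm of 'rV[R]_n is the sup norm: it gives the usual topology,
   bounded sets and Hoelder classes, but unit vectors need the Euclidean norm. *)
Definition enorm (R : realType) (n : nat) (v : 'rV[R]_n) : R :=
  Num.sqrt (\sum_(i < n) v 0 i ^+ 2).

Definition partial (R : realType) (n : nat) (i : 'I_n) (f : 'rV[R]_n -> R)
    (x : 'rV[R]_n) : R :=
  'D_(delta_mx 0 i) f x.

Definition has_partial (R : realType) (n : nat) (i : 'I_n) (f : 'rV[R]_n -> R)
    (x : 'rV[R]_n) : Prop :=
  derivable f x (delta_mx 0 i).

Definition grad (R : realType) (n : nat) (f : 'rV[R]_n -> R) (x : 'rV[R]_n) :
    'rV[R]_n :=
  \row_(i < n) partial i f x.

Definition laplacian (R : realType) (n : nat) (f : 'rV[R]_n -> R)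
    (x : 'rV[R]_n) : R :=
  \sum_(i < n) partial i (partial i f) x.

(* Lebesgue measure on R^n, on the Borel sigma-algebra of n-tuples: the image
   of the product of Lebesgue measure on R^(n-1) and on R under the bijection
   R^(n-1) * R -> R^n that puts the real coordinate in front. *)
Definition tuple_join (R : realType) (n : nat)
    (z : n.-tuple (measurableTypeR R) * measurableTypeR R) :
    n.+1.-tuple (measurableTypeR R) :=
  [the n.+1.-tuple (measurableTypeR R) of z.2 :: z.1].

Lemma measurable_tuple_join (R : realType) (n : nat) :
  measurable_fun [set: n.-tuple (measurableTypeR R) * measurableTypeR R]
    (@tuple_join R n).
Proof. exact: (measurable_cons measurable_snd measurable_fst). Qed.

Definition lebesgue_tuple_step (R : realType) (n : nat)
    (m : {measure set (n.-tuple (measurableTypeR R)) -> \bar R}) :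
    {measure set (n.+1.-tuple (measurableTypeR R)) -> \bar R} :=
  measure_function_pushforward__canonical__measure_function_Measure
    (m \x lebesgue_measure)%E (@measurable_tuple_join R n).

Fixpoint lebesgue_tuple (R : realType) (n : nat) :
    {measure set (n.-tuple (measurableTypeR R)) -> \bar R} :=
  if n is n'.+1 then lebesgue_tuple_step (lebesgue_tuple R n')
  else dirac ([tuple] : 0.-tuple (measurableTypeR R)).

Definition row_of_tuple (R : realType) (n : nat)
    (t : n.-tuple (measurableTypeR R)) : 'rV[R]_n :=
  \row_(i < n) tnth t i.

Definition space_integral (R : realType) (n : nat) (D : set 'rV[R]_n)
    (f : 'rV[R]_n -> R) : R :=
  Rintegral (lebesgue_tuple R n) (@row_of_tuple R n @^-1` D)
    (fun t => f (row_of_tuple t)).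

Definition boundary (T : topologicalType) (A : set T) : set T :=
  closure A `\` A°.

Definition domain (R : realType) (n : nat) (D : set 'rV[R]_n) : Prop :=
  [/\ D !=set0, open D & connected D].

Definition iter_partial (R : realType) (n : nat) (s : seq 'I_n)
    (f : 'rV[R]_n -> R) : 'rV[R]_n -> R :=
  foldr (fun i g => partial i g) f s.

Definition smooth_on (R : realType) (n : nat) (U : set 'rV[R]_n)
    (f : 'rV[R]_n -> R) : Prop :=
  forall (s : seq 'I_n) (x : 'rV[R]_n), U x ->
    {for x, continuous (iter_partial s f)} /\
    forall i : 'I_n, has_partial i (iter_partial s f) x.

Definition defining_function (R : realType) (n : nat) (D : set 'rV[R]_n)
    (x : 'rV[R]_n) (phi : 'rV[R]_n -> R) : Prop :=
  exists U : set 'rV[R]_n, [/\ open U, U x, smooth_on U phi,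
    forall y, U y -> grad phi y <> 0 &
    forall y, U y -> (D y <-> phi y < 0) /\ (boundary D y <-> phi y = 0)].

Definition smooth_boundary (R : realType) (n : nat) (D : set 'rV[R]_n) : Prop :=
  forall x, boundary D x -> exists phi, defining_function D x phi.

Definition outward_unit_normal (R : realType) (n : nat) (D : set 'rV[R]_n)
    (nu : 'rV[R]_n -> 'rV[R]_n) : Prop :=
  forall x, boundary D x -> exists phi, defining_function D x phi /\
    nu x = (enorm (grad phi x))^-1 *: grad phi x.

(* Outward derivative at a boundary point of a function given on the closure of
   the domain, hence the one-sided difference quotient from inside. *)
Definition is_normal_derivative (R : realType) (n : nat)
    (nu : 'rV[R]_n -> 'rV[R]_n) (f : 'rV[R]_n -> R) (x : 'rV[R]_n) (d : R) :
    Prop :=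
  (f x - f (x - h *: nu x)) / h @[h --> 0^'+] --> d.

(* C^1 up to the boundary: the first derivatives, which make sense in the open
   set D, extend continuously to the closure of D. *)
Definition C1_closure (R : realType) (n : nat) (D : set 'rV[R]_n)
    (f : 'rV[R]_n -> R) : Prop :=
  {within closure D, continuous f} /\
  forall i : 'I_n, exists g : 'rV[R]_n -> R,
    {within closure D, continuous g} /\
    forall x, D x -> has_partial i f x /\ partial i f x = g x.

(* C^{1,0} on closure(D) x [0,T[, which is Q_T together with Gamma_T. *)
Definition C10_closure (R : realType) (n : nat) (D : set 'rV[R]_n) (T : R)
    (u : 'rV[R]_n -> R -> R) : Prop :=
  {within closure D `*` [set` `[0, T[], continuous (fun z => u z.1 z.2)} /\
  forall i : 'I_n, exists g : 'rV[R]_n * R -> R,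
    {within closure D `*` [set` `[0, T[], continuous g} /\
    forall x t, D x -> 0 <= t < T ->
      has_partial i (u^~ t) x /\ partial i (u^~ t) x = g (x, t).

Definition C21 (R : realType) (n : nat) (D : set 'rV[R]_n) (T : R)
    (u : 'rV[R]_n -> R -> R) : Prop :=
  let Q : set ('rV[R]_n * R) := D `*` [set` `]0, T[] in
  [/\ {within Q, continuous (fun z => u z.1 z.2)},
      (forall x t, Q (x, t) -> derivable (u x) t 1) /\
        {within Q, continuous (fun z => derive1 (u z.1) z.2)},
      forall i : 'I_n,
        (forall x t, Q (x, t) -> has_partial i (u^~ t) x) /\
        {within Q, continuous (fun z => partial i (u^~ z.2) z.1)} &
      forall i j : 'I_n,
        (forall x t, Q (x, t) -> has_partial j (partial i (u^~ t)) x) /\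
        {within Q, continuous (fun z => partial j (partial i (u^~ z.2)) z.1)}].

Definition locally_holder (R : realType) (n : nat) (alpha : R)
    (A : set ('rV[R]_n * R)) (f : 'rV[R]_n -> R -> R) : Prop :=
  forall K : set ('rV[R]_n * R), compact K -> K `<=` A ->
    exists C : R, forall z w, K z -> K w ->
      `|f z.1 z.2 - f w.1 w.2| <= C * `|z - w| `^ alpha.

Definition admissible (R : realType) (n : nat) (D : set 'rV[R]_n)
    (nu : 'rV[R]_n -> 'rV[R]_n) (l : R) (k : 'rV[R]_n -> 'rV[R]_n -> R -> R)
    (u0 : 'rV[R]_n -> R) : Prop :=
  [/\ C1_closure D u0,
      forall x, D x -> 0 <= u0 x &
      forall x, boundary D x -> is_normal_derivative nu u0 x
        (space_integral D (fun y => k x y 0 * u0 y `^ l))].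

Definition solution (R : realType) (n : nat) (D : set 'rV[R]_n)
    (nu : 'rV[R]_n -> 'rV[R]_n) (p l : R) (c : 'rV[R]_n -> R -> R)
    (k : 'rV[R]_n -> 'rV[R]_n -> R -> R) (u0 : 'rV[R]_n -> R) (T : R)
    (u : 'rV[R]_n -> R -> R) : Prop :=
  [/\ C21 D T u /\ C10_closure D T u,
      forall x t, closure D x -> 0 <= t < T -> 0 <= u x t,
      forall x t, D x -> 0 < t < T ->
        derive1 (u x) t = laplacian (u^~ t) x - c x t * u x t `^ p,
      forall x t, boundary D x -> 0 <= t < T ->
        is_normal_derivative nu (u^~ t) x
          (space_integral D (fun y => k x y t * u y t `^ l)) &
      forall x, D x -> u x 0 = u0 x].

Definition blows_up_at (R : realType) (n : nat) (D : set 'rV[R]_n) (T : R)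
    (u : 'rV[R]_n -> R -> R) : Prop :=
  limf_esup (fun t : R => ereal_sup [set (u x t)%:E | x in D]) T^'- = +oo%E.

Definition blow_up_only_on_boundary (R : realType) (n : nat)
    (D : set 'rV[R]_n) (T : R) (u : 'rV[R]_n -> R -> R) : Prop :=
  forall D' : set 'rV[R]_n, domain D' -> compact (closure D') ->
    closure D' `<=` D ->
    exists M : R, forall x t, D' x -> 0 <= t < T -> `|u x t| <= M.

(* Main.v *)
Require Import Defs.
From mathcomp Require Import all_boot all_order all_algebra.
From mathcomp Require Import all_classical all_reals all_analysis.
From mathcomp Require Import measurable_realfun ring lra.

Set Implicit Arguments.
Unset Strict Implicit.
Unset Printing Implicit Defensive.

Import Order.TTheory GRing.Theory Num.Theory.
Import numFieldNormedType.Exports.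

Local Open Scope classical_set_scope.
Local Open Scope ring_scope.

(** Why the theorem holds. Write F(t) for the integral of u(.,t)^l over the
    domain. The boundary condition feeds heat through the whole boundary at a
    rate of at least k0 F(t), where k0 is the infimum of the kernel, and this
    inflow is nonlocal: however singular u is at the boundary, one number F(t)
    controls what comes in.

    Fix one boundary point z and test the equation against a weight: a fixed bump
    near z times a cutoff of the defining function rho, which is 0 along the
    boundary, 1 further inside, and varies in a thin layer only. After two
    integrations by parts (layer_identity) the layer contributes the flux of u, at
    least a multiple of F(t) by continuity of the gradient up to the boundary
    (layer_flux), and errors. The bump is centred inside the domain, on the inner
    normal at z, and decreases towards the boundary; this makes the one error that
    is singular in the thickness of the layer nonnegative, and the mass of u
    controls the others (boundary_test). As l > max(p, 1), the mass of u and the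
    absorption are at most small multiples of F plus constants, so that the
    weighted mass m(t) of u satisfies m' >= c F - C and m^l <= C F
    (boundary_functional). The layer depends on the time interval, the constants
    do not.

    This has two consequences. First, m' >= c m^l - C, so m(t) is at most a
    multiple of (T - t)^(-1/(l-1)) (superlinear_bound). Second, the mass of u is
    dominated by F + C, hence by the derivative of a function of the size of m;
    its time integral therefore has that same rate. Since absorption has the good
    sign, u is subcaloric inside the domain, and a mean value inequality
    (mean_value) bounds u at an interior point by its value at an earlier time and
    by the time integral of its local mass. This gives a first interior bound
    u <= C (T - t)^(-q). Inserting the bound into the mean value inequality again,
    on a smaller ball, integrates the power in time and lowers q by one
    (interior_growth_step); after finitely many steps q is negative, and u is
    bounded on compact subsets of the domain up to time T. *)

Implicit Types (R : realType) (n : nat).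

(** * Lebesgue measure on row vectors *)

Lemma rat_row_dense R n (x : 'rV[R]_n) (e : R) :
  0 < e -> exists q : 'rV[rat]_n, ball x e (map_mx (ratr : rat -> R) q).
Proof.
move=> e0.
have /choice[f fP] : forall i, exists q : rat, (ratr q : R) \in `](x 0 i - e), (x 0 i + e)[.
  by move=> i; apply: rat_in_itvoo; rewrite ltrD2l gtrN.
exists (\row_i f i); split => // i j; rewrite !mxE ord1.
have := fP j; rewrite in_itv/= => /andP[h1 h2].
by rewrite /ball/= ltr_distlC h1 h2.
Qed.

Lemma measurable_row_ball R n (x : 'rV[R]_n) (e : R) :
  measurable (@row_of_tuple R n @^-1` ball x e).
Proof.
have [e0|e0] := ltP 0 e; last first.
  rewrite (_ : _ @^-1` _ = set0); first exact: measurable0.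
  by apply/seteqP; split => // t /= [/lt_le_trans/(_ e0)]; rewrite ltxx.
rewrite (_ : _ @^-1` _ = \bigcap_(i in [set: 'I_n])
    ((fun t : n.-tuple (measurableTypeR R) => tnth t i) @^-1` (ball (x 0 i) e : set (measurableTypeR R)))).
  apply: fin_bigcap_measurable => [|i _].
    exact: finite_finset.
  rewrite -[X in measurable X]setTI.
  by apply: (measurable_tnth i) => //; exact: measurable_ball.
apply/seteqP; split => t /=.
  by move=> [_ h] i _; have := h 0 i; rewrite mxE.
by move=> h; split => // i j; rewrite mxE ord1; exact: h.
Qed.

(** Every open set is a countable union of balls with rational centres and
    inverse-integer radii, and balls of the sup norm are finite intersections of
    coordinate preimages: this is how the product sigma-algebra on tuples meets
    the topology of row vectors. *)
Lemma open_row_measurable R n (A : set 'rV[R]_n) :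
  open A -> measurable (@row_of_tuple R n @^-1` A).
Proof.
move=> oA.
pose F (k : 'rV[rat]_n * nat) : set 'rV[R]_n :=
  if `[< ball (map_mx ratr k.1 : 'rV[R]_n) (k.2.+1%:R^-1) `<=` A >]
  then ball (map_mx ratr k.1 : 'rV[R]_n) (k.2.+1%:R^-1) else set0.
have -> : A = \bigcup_k F k.
  apply/seteqP; split => [x Ax|x [[q m] _]]; last first.
    by rewrite /F/=; case: asboolP => // h; exact: h.
  move: oA; rewrite openE => /(_ x Ax) /nbhs_ballP[e /= e0 xeA].
  have e20 : 0 < e / 2 by rewrite divr_gt0.
  have [m _ hm] := near_infty_natSinv_lt (PosNum e20).
  have {hm}/= hm := hm m (leqnn m).
  have [|q qx] := @rat_row_dense R n x (m.+1%:R^-1); first by rewrite invr_gt0.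
  exists (q, m) => //; rewrite /F/=; case: asboolP => [_|]; first exact: ball_sym.
  case=> y qy; apply: xeA.
  have := ball_triangle (le_ball (ltW hm) qx) (le_ball (ltW hm) qy).
  by rewrite -splitr.
rewrite preimage_bigcup.
apply: countable_bigcupT_measurable => [|k]; first exact: countableP.
rewrite /F; case: asboolP => _; first exact: measurable_row_ball.
by rewrite preimage_set0; exact: measurable0.
Qed.

Lemma closed_row_measurable R n (A : set 'rV[R]_n) :
  closed A -> measurable (@row_of_tuple R n @^-1` A).
Proof.
move=> cA; rewrite -[A]setCK preimage_setC; apply: measurableC.
by exact: (open_row_measurable (closed_openC cA)).
Qed.

Lemma lebesgue_measure_shift R (a : R) (A : set R) :
  measurable A -> lebesgue_measure ((fun x : R => x + a) @^-1` A) = lebesgue_measure A :> \bar R.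
Proof.
move=> mA.
have mS : measurable_fun [set: measurableTypeR R] ((fun x : R => x + a) : measurableTypeR R -> measurableTypeR R).
  by apply: measurable_funD => //.
pose m := measure_function_pushforward__canonical__measure_function_Measure (@lebesgue_measure R) mS.
rewrite -[LHS]/(m A); apply/esym/lebesgue_measure_unique => // X [[x y] /= _ <-].
rewrite /m/= /pushforward.
rewrite (_ : _ @^-1` _ = `]x - a, y - a]%classic); last first.
  by apply/seteqP; split => z /=; rewrite !in_itv/= ltrBlDr lerBrDr.
by rewrite !lebesgue_measure_itv/= !lte_fin ltrD2r -!EFinB; case: ifP => // _; congr (_%:E); lra.
Qed.

Definition tuple_shift R n (v : 'rV[R]_n)
    (t : n.-tuple (measurableTypeR R)) : n.-tuple (measurableTypeR R) :=
  [tuple tnth t i + v 0 i | i < n].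

Lemma row_of_tuple_shift R n (v : 'rV[R]_n) t :
  row_of_tuple (tuple_shift v t) = row_of_tuple t + v.
Proof. by apply/rowP => i; rewrite !mxE tnth_mktuple. Qed.

Lemma measurable_tuple_shift R n (v : 'rV[R]_n) :
  measurable_fun [set: n.-tuple (measurableTypeR R)] (tuple_shift v).
Proof.
apply/measurable_fun_tnthP => i.
rewrite (_ : _ \o _ = fun t : n.-tuple (measurableTypeR R) => tnth t i + v 0 i); last first.
  by apply/funext => t /=; rewrite tnth_mktuple.
apply: (@measurable_funD _ _ _ setT (fun t : n.-tuple (measurableTypeR R) => tnth t i : R) (cst (v 0 i))) => //.
exact: measurable_tnth.
Qed.

(** By induction on the dimension: in the product that defines the measure, a
    section of a translated set is the translate of a section. *)
Lemma lebesgue_tuple_shift R n (v : 'rV[R]_n)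
    (A : set (n.-tuple (measurableTypeR R))) :
  measurable A -> lebesgue_tuple R n (tuple_shift v @^-1` A) = lebesgue_tuple R n A.
Proof.
elim: n v A => [|n IH] v A mA.
  rewrite (_ : _ @^-1` _ = A)//; apply/seteqP; split => t; rewrite /preimage/=; by rewrite (tuple0 (tuple_shift v t)) (tuple0 t).
have mB : measurable (@tuple_join R n @^-1` A).
  by rewrite -[X in measurable X]setTI; exact: measurable_tuple_join.
rewrite /= /pushforward /product_measure1 /=.
pose w : 'rV[R]_n := \row_i v 0 (lift ord0 i).
set m := lebesgue_tuple R n.
pose g := (fun t : n.-tuple (measurableTypeR R) =>
   (@lebesgue_measure R) (xsection (@tuple_join R n @^-1` A) t) : \bar R).
transitivity (\int[m]_t (g (tuple_shift w t)))%E.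
  apply: eq_integral => t _; rewrite /g/=.
  rewrite -[RHS](@lebesgue_measure_shift R (v 0 ord0)); last exact: measurable_xsection.
  congr (lebesgue_measure _); apply/seteqP.
  suff h a : tuple_shift v (tuple_join (t, a)) = tuple_join (tuple_shift w t, a + v 0 ord0).
    by split => a; rewrite /xsection/= !inE/= h.
  apply: eq_from_tnth => i; rewrite tnth_mktuple.
  have [j ->|->] := unliftP ord0 i; rewrite /tuple_join/= ?tnth0// !tnthS.
  by rewrite tnth_mktuple mxE.
transitivity (\int[pushforward m (tuple_shift w)]_t g t)%E.
  rewrite (ge0_integral_pushforward (measurable_tuple_shift w))//.
  exact: measurable_fun_xsection.
apply: (@eq_measure_integral _ _ _ _ m (measure_function_pushforward__canonical__measure_function_Measure m (measurable_tuple_shift w))).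
by move=> B mB' _; exact: IH.
Qed.

Lemma closed_cube R n (x : 'rV[R]_n) (r : R) :
  closed [set y : 'rV[R]_n | forall i, `|y 0 i - x 0 i| <= r].
Proof.
rewrite (_ : mkset _ = \bigcap_(i in [set: 'I_n])
    ((fun y : 'rV[R]_n => y 0 i) @^-1` (closed_ball_ Num.norm (x 0 i) r))).
  apply: closed_bigI => i _; apply: closed_comp.
    by move=> y _; exact: coord_continuous.
  exact: closed_closed_ball_.
apply/seteqP; split => y /= h i; last by rewrite distrC; exact: h.
by move=> _; rewrite /closed_ball_/= distrC; exact: h.
Qed.

Lemma lebesgue_tuple_cube R n (x : 'rV[R]_n) (r : R) :
  0 <= r ->
  lebesgue_tuple R n (@row_of_tuple R n @^-1` [set y | forall i, `|y 0 i - x 0 i| <= r])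
  = ((2 * r) ^+ n)%:E.
Proof.
move=> r0; elim: n x => [|n IH] x.
  rewrite expr0 /= diracE mem_set//=; by case.
pose w : 'rV[R]_n := \row_i x 0 (lift ord0 i).
rewrite /= /pushforward.
rewrite (_ : _ @^-1` _ = (@row_of_tuple R n @^-1` [set y | forall i, `|y 0 i - w 0 i| <= r])
  `*` (`[x 0 ord0 - r, x 0 ord0 + r]%classic : set (measurableTypeR R))); last first.
  apply/seteqP; split => -[t a] /=.
    move=> h; split => [i|].
      by have := h (lift ord0 i); rewrite !mxE /tuple_join/= tnthS.
    by have := h ord0; rewrite !mxE /tuple_join/= tnth0 in_itv/= ler_distl.
  move=> [h1 h2] i; rewrite mxE.
  have [j ->|->] := unliftP ord0 i; rewrite /tuple_join/= ?tnth0 ?tnthS//.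
    by have := h1 j; rewrite !mxE.
  by move: h2; rewrite in_itv/= ler_distl.
rewrite product_measure1E//; last first.
  exact: (closed_row_measurable (@closed_cube R n w r)).
rewrite IH -[X in (_ * X)%E]/(lebesgue_measure `[x 0 ord0 - r, x 0 ord0 + r]%classic) lebesgue_measure_itv/= lte_fin.
have [->|rn0] := eqVneq r 0.
  rewrite subr0 addr0 ltxx mule0 mulr0 exprS mul0r//.
rewrite ifT; last by have := lt0r r; rewrite rn0 r0; lra.
by rewrite -EFinB -EFinM exprS mulrC; congr (_ * _)%:E; lra.
Qed.

(** * Integration of bounded measurable functions with bounded support *)

Definition lint R n (f : 'rV[R]_n -> R) : R :=
  Rintegral (lebesgue_tuple R n) setT (f \o @row_of_tuple R n).

(** Bounded measurable functions with bounded support are integrable and closed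
    under sums and products: a single predicate then discharges every
    integrability side condition, including those of truncations by indicators of
    sets. *)
Definition bms R n (f : 'rV[R]_n -> R) : Prop :=
  measurable_fun setT (f \o @row_of_tuple R n) /\
  exists M r : R, forall x : 'rV[R]_n, `|f x| <= M /\ (r < `|x| -> f x = 0).

Lemma rV_norm_le R n (x : 'rV[R]_n) (r : R) :
  0 <= r -> (`|x| <= r) <-> (forall i, `|x 0 i| <= r).
Proof.
move=> r0; split => [xr i|h].
  apply: le_trans xr; rewrite [leRHS]/Num.norm/= mx_normrE.
  by apply/bigmax_geP; right => /=; exists (0, i).
rewrite [leLHS]/Num.norm/= mx_normrE; apply/bigmax_leP; split => // -[i j] _ /=.
by rewrite ord1.
Qed.

Lemma measurable_row_cube R n (x : 'rV[R]_n) (r : R) :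
  measurable (@row_of_tuple R n @^-1` [set y | `|y - x| <= r]).
Proof.
apply: closed_row_measurable.
rewrite (_ : mkset _ = closed_ball_ Num.norm x r); last first.
  by apply/seteqP; split => y /=; rewrite /closed_ball_/= distrC.
exact: closed_closed_ball_.
Qed.

Lemma lebesgue_tuple_norm_cube R n (x : 'rV[R]_n) (r : R) :
  0 <= r ->
  lebesgue_tuple R n (@row_of_tuple R n @^-1` [set y | `|y - x| <= r])
  = ((2 * r) ^+ n)%:E.
Proof.
move=> r0; rewrite -(lebesgue_tuple_cube x r0); congr (lebesgue_tuple R n _).
apply/seteqP; split => t /=.
  by move/(rV_norm_le _ r0) => h i; have := h i; rewrite !mxE.
by move=> h; apply/(rV_norm_le _ r0) => i; have := h i; rewrite !mxE.
Qed.

Lemma bms_integrable R n (f : 'rV[R]_n -> R) :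
  bms f -> (lebesgue_tuple R n).-integrable setT (EFin \o (f \o @row_of_tuple R n)).
Proof.
move=> [mf [M [r fMr]]].
pose s := Num.max r 0; pose B := @row_of_tuple R n @^-1` [set y | `|y - 0| <= s].
have mB : measurable B by exact: measurable_row_cube.
have s0 : 0 <= s by rewrite le_max lexx orbT.
apply: (@le_integrable _ _ _ _ _ _ _ (EFin \o (fun t => M * \1_B t))) => //.
- exact/measurable_EFinP.
- move=> t _ /=; rewrite lee_fin indicE.
  have [h1 h2] := fMr (row_of_tuple t).
  have M0 : 0 <= M := le_trans (normr_ge0 _) h1.
  case: (boolP (t \in B)) => [_|]; first by rewrite mulr1 (ger0_norm M0).
  rewrite notin_setE /B/= subr0 mulr0 normr0 => /negP; rewrite -ltNge => h3.
  by rewrite h2 ?normr0//; apply: le_lt_trans h3; rewrite le_max lexx.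
- rewrite (_ : EFin \o _ = (fun t => M%:E * (EFin \o \1_B) t)%E); last first.
    by apply/funext => t /=; rewrite EFinM.
  apply: integrableZl => //; apply/integrableP; split.
    exact/measurable_EFinP/measurable_indic.
  under eq_integral do rewrite /= ger0_norm//.
  by rewrite integral_indic// setIT /B lebesgue_tuple_norm_cube// ltry.
Qed.
Lemma eq_lint R n (f g : 'rV[R]_n -> R) :
  f =1 g -> lint f = lint g.
Proof. by move=> /funext ->. Qed.

Lemma bms0 R n : bms (fun _ : 'rV[R]_n => 0).
Proof. by split; [exact: measurable_cst|exists 0, 0 => x; rewrite normr0]. Qed.

Lemma bmsD R n (f g : 'rV[R]_n -> R) :
  bms f -> bms g -> bms (fun x => f x + g x).
Proof.
move=> [mf [M [r fM]]] [mg [M' [r' gM]]]; split.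
  exact: (measurable_funD mf mg).
exists (M + M'), (Num.max r r') => x; have [h1 h2] := fM x; have [h3 h4] := gM x.
split; first by rewrite (le_trans (ler_normD _ _))// lerD.
by rewrite gt_max => /andP[/h2 -> /h4 ->]; rewrite addr0.
Qed.

(** The product inherits bounded support from its second factor alone. *)
Lemma bmsMl R n (f g : 'rV[R]_n -> R) (M : R) :
  measurable_fun setT (f \o @row_of_tuple R n) -> (forall x, `|f x| <= M) ->
  bms g -> bms (fun x => f x * g x).
Proof.
move=> mf fM [mg [M' [r gM]]]; split; first exact: (measurable_funM mf mg).
exists (M * M'), r => x; have [h1 h2] := gM x; split.
  by rewrite normrM ler_pM.
by move=> /h2 ->; rewrite mulr0.
Qed.

Lemma bmsM R n (f g : 'rV[R]_n -> R) :
  bms f -> bms g -> bms (fun x => f x * g x).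
Proof. by move=> [mf [M [r fM]]]; apply: (bmsMl mf (M := M)) => x; case: (fM x). Qed.

Lemma bmsZ R n (k : R) (f : 'rV[R]_n -> R) :
  bms f -> bms (fun x => k * f x).
Proof. by move=> bf; apply: (bmsMl (M := `|k|)) bf => //; exact: measurable_cst. Qed.

Lemma bmsN R n (f : 'rV[R]_n -> R) :
  bms f -> bms (fun x => - f x).
Proof.
by move=> /(bmsZ (-1)); under eq_fun do rewrite mulN1r.
Qed.

Lemma bmsB R n (f g : 'rV[R]_n -> R) :
  bms f -> bms g -> bms (fun x => f x - g x).
Proof. by move=> bf /bmsN; exact: bmsD. Qed.

Lemma bms_sum R n m (f : 'I_m -> 'rV[R]_n -> R) :
  (forall i, bms (f i)) -> bms (fun x => \sum_(i < m) f i x).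
Proof.
move=> bf; elim: m f bf => [|m IH] f bf.
  by under eq_fun do rewrite big_ord0; exact: bms0.
under eq_fun do rewrite big_ord_recl.
by apply: bmsD => //; exact: (IH (fun i => f (lift ord0 i))).
Qed.

Lemma lintD R n (f g : 'rV[R]_n -> R) :
  bms f -> bms g -> lint (fun x => f x + g x) = lint f + lint g.
Proof. by move=> bf bg; apply: RintegralD => //; exact: bms_integrable. Qed.

Lemma lintB R n (f g : 'rV[R]_n -> R) :
  bms f -> bms g -> lint (fun x => f x - g x) = lint f - lint g.
Proof. by move=> bf bg; apply: RintegralB => //; exact: bms_integrable. Qed.

Lemma lintZ R n (k : R) (f : 'rV[R]_n -> R) :
  bms f -> lint (fun x => k * f x) = k * lint f.
Proof. by move=> bf; apply: RintegralZl => //; exact: bms_integrable. Qed.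

Lemma lint0 R n : lint (fun _ : 'rV[R]_n => 0) = 0.
Proof. apply: etrans (etrans (lintZ 0 (@bms0 R n)) (mul0r _)); by apply: eq_lint => x; rewrite mul0r. Qed.

Lemma lint_sum R n m (f : 'I_m -> 'rV[R]_n -> R) :
  (forall i, bms (f i)) ->
  lint (fun x => \sum_(i < m) f i x) = \sum_(i < m) lint (f i).
Proof.
move=> bf; elim: m f bf => [|m IH] f bf.
  by rewrite big_ord0 -[RHS](lint0 R n); apply: eq_lint => x; rewrite big_ord0.
rewrite big_ord_recl -(IH (fun i => f (lift ord0 i)))// -lintD//.
  by apply: eq_lint => x; rewrite big_ord_recl.
exact: (bms_sum (f := fun i => f (lift ord0 i))).
Qed.

Lemma le_lint R n (f g : 'rV[R]_n -> R) :
  bms f -> bms g -> (forall x, f x <= g x) -> lint f <= lint g.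
Proof.
by move=> bf bg fg; apply: le_Rintegral => //; exact: bms_integrable.
Qed.

Lemma lint_ge0 R n (f : 'rV[R]_n -> R) :
  (forall x, 0 <= f x) -> 0 <= lint f.
Proof. by move=> f0; apply: Rintegral_ge0 => t _; exact: f0. Qed.

Definition cube_indic R n (z : 'rV[R]_n) (r : R) (x : 'rV[R]_n) : R :=
  \1_[set y | `|y - z| <= r] x.

Lemma bms_indic R n (A : set 'rV[R]_n) :
  measurable (@row_of_tuple R n @^-1` A) -> bounded_set A -> bms (\1_A : 'rV[R]_n -> R).
Proof.
move=> mA [r [_ Ar]]; split.
  have := @measurable_indic _ _ R setT _ mA; congr (measurable_fun _ _).
exists 1, (r + 1) => x; rewrite indicE; split.
  by case: (x \in A); rewrite ?normr1// normr0.
move=> rx; case: (boolP (x \in A)) => // /set_mem xA.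
by have := Ar (r + 1); rewrite ltrDl => /(_ ltr01 x xA)/=; rewrite leNgt rx.
Qed.

Lemma bms_cube_indic R n (z : 'rV[R]_n) (r : R) :
  bms (cube_indic z r).
Proof.
apply: bms_indic; first exact: measurable_row_cube.
exists (`|z| + r); split; first exact: num_real.
move=> M hM x /= xz; apply: le_trans (ltW hM).
by rewrite -[x](subrK z) addrC (le_trans (ler_normD _ _))// lerD2l.
Qed.

Lemma lint_cube_indic R n (z : 'rV[R]_n) (r : R) :
  0 <= r -> lint (cube_indic z r) = (2 * r) ^+ n.
Proof.
move=> r0; rewrite /lint /Rintegral.
rewrite (_ : (fun x => _) = (fun t => (\1_(@row_of_tuple R n @^-1` [set y | `|y - z| <= r]) t)%:E)).
  rewrite integral_indic//; last exact: measurable_row_cube.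
  by rewrite setIT lebesgue_tuple_norm_cube.
by apply/funext => t.
Qed.

Lemma bms_shift R n (f : 'rV[R]_n -> R) (v : 'rV[R]_n) :
  bms f -> bms (fun x => f (x + v)).
Proof.
move=> [mf [M [r fM]]]; split.
  have := measurableT_comp mf (@measurable_tuple_shift R n v).
  by congr (measurable_fun _ _); apply/funext => t /=; rewrite row_of_tuple_shift.
exists M, (r + `|v|) => x; have [h1 h2] := fM (x + v); split => // h.
apply: h2; rewrite -ltrBrDr in h; apply: lt_le_trans h _.
by rewrite lerBlDr -{1}[x](addrK v) (le_trans (ler_normB _ _)).
Qed.

Lemma lint_shift R n (f : 'rV[R]_n -> R) (v : 'rV[R]_n) :
  bms f -> lint (fun x => f (x + v)) = lint f.
Proof.
move=> bf; rewrite /lint /Rintegral; congr fine.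
have mS := @measurable_tuple_shift R n v.
pose m := measure_function_pushforward__canonical__measure_function_Measure (lebesgue_tuple R n) mS.
have h (A : set (n.-tuple (measurableTypeR R))) : measurable A ->
    A `<=` setT -> m A = lebesgue_tuple R n A.
  by move=> mA _; exact: lebesgue_tuple_shift.
rewrite -[RHS](eq_measure_integral (lebesgue_tuple R n) h) {h}.
have e : (fun t : n.-tuple (measurableTypeR R) => (f (row_of_tuple t + v))%:E) =
    (EFin \o (f \o @row_of_tuple R n)) \o tuple_shift v.
  by apply/funext => t /=; rewrite row_of_tuple_shift.
rewrite [RHS](integral_pushforward mS)//; first by rewrite preimage_setT -e.
  by apply/measurable_EFinP; case: bf.
by rewrite preimage_setT -e; exact: (bms_integrable (bms_shift v bf)).
Qed.

(** A superlevel set meets [A] in a relatively open set; what it contains off [A],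
    all or nothing, depends on the sign of the level only. *)
Lemma measurable_within R n (A : set 'rV[R]_n) (f : 'rV[R]_n -> R) :
  measurable (@row_of_tuple R n @^-1` A) ->
  {within A, continuous f} -> (forall x, ~ A x -> f x = 0) ->
  measurable_fun setT (f \o @row_of_tuple R n).
Proof.
move=> mA cf f0.
apply: (measurability _ (RGenOInfty.measurableE R)).
move=> _ [_ [a ->] <-]; rewrite setTI.
have oU := rray_open a.
move/continuousP : cf => /(_ _ oU) /open_subspaceP[B oB hB].
have mB := open_row_measurable oB.
have h : measurable (@row_of_tuple R n @^-1` ((f @^-1` `]a, +oo[%classic) `&` A)).
  by rewrite -hB preimage_setI; exact: measurableI.
have [a0|a0] := leP 0 a.
  rewrite (_ : _ @^-1` _ = @row_of_tuple R n @^-1` ((f @^-1` `]a, +oo[%classic) `&` A))//.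
  apply/seteqP; split => t /=; last by case.
  move=> h1; split => //; apply: contrapT => /f0 h2.
  by move: h1; rewrite h2 in_itv/= andbT ltNge a0.
rewrite (_ : _ @^-1` _ = @row_of_tuple R n @^-1` ((f @^-1` `]a, +oo[%classic) `&` A) `|`
  ~` (@row_of_tuple R n @^-1` A)).
  by apply: measurableU => //; exact: measurableC.
apply/seteqP; split => t /=.
  by move=> h1; have [At|nAt] := pselect (A (row_of_tuple t)); [left|right].
by case=> [[]//|/f0 ->]; rewrite in_itv/= a0.
Qed.

Lemma bms_within R n (A : set 'rV[R]_n) (f : 'rV[R]_n -> R) (M : R) :
  measurable (@row_of_tuple R n @^-1` A) -> bounded_set A ->
  {within A, continuous f} -> (forall x, ~ A x -> f x = 0) ->
  (forall x, A x -> `|f x| <= M) -> bms f.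
Proof.
move=> mA [r [_ Ar]] cf f0 fM; split; first exact: (measurable_within mA).
exists (Num.max M 0), (r + 1) => x; split.
  have [Ax|/f0 ->] := pselect (A x); first by rewrite le_max fM.
  by rewrite normr0 le_max lexx orbT.
move=> rx; apply: f0 => Ax.
by have := Ar (r + 1); rewrite ltrDl => /(_ ltr01 x Ax)/=; rewrite leNgt rx.
Qed.

Lemma compact_within_bounded R (T : topologicalType) (A : set T) (f : T -> R) :
  compact A -> {within A, continuous f} -> exists2 M : R, 0 <= M & forall x, A x -> `|f x| <= M.
Proof.
move=> cA cf.
have [M [_ hM]] := compact_bounded (continuous_compact cf cA).
exists (Num.max 0 (M + 1)); first by rewrite le_max lexx.
move=> x Ax; rewrite le_max; apply/orP; right.
by apply: (hM (M + 1)) ; [rewrite ltrDl|exists x].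
Qed.

Lemma bms_compact R n (K : set 'rV[R]_n) (f : 'rV[R]_n -> R) :
  compact K -> {within K, continuous f} -> (forall x, ~ K x -> f x = 0) -> bms f.
Proof.
move=> cK cf f0; have [M _ fM] := compact_within_bounded cK cf.
apply: (bms_within _ _ cf f0 fM); last exact: compact_bounded.
apply: closed_row_measurable; apply: compact_closed => //; exact: norm_hausdorff.
Qed.

(** * Differentiation under the integral sign and integration by parts *)

Lemma is_derive_lint R n (f : R -> 'rV[R]_n -> R) (a u v M r : R) :
  u < a < v ->
  (forall t, u < t < v -> bms (f t)) ->
  (forall t x, u < t < v -> derivable (f ^~ x) t 1) ->
  (forall t x, u < t < v -> `|derive1 (f ^~ x) t| <= M /\ (r < `|x| -> derive1 (f ^~ x) t = 0)) ->
  is_derive a 1 (fun t => lint (f t)) (lint (fun x => derive1 (f ^~ x) a)).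
Proof.
move=> auv bf df hM.
pose F t := f t \o @row_of_tuple R n.
pose s := Num.max r 0.
pose G := fun t : n.-tuple (measurableTypeR R) => M * cube_indic 0 s (row_of_tuple t).
have s0 : 0 <= s by rewrite le_max lexx orbT.
have M0 : 0 <= M by have [h _] := hM a 0 auv; exact: le_trans h.
have G0 y : 0 <= G y by rewrite mulr_ge0// /cube_indic indicE.
have iG : (lebesgue_tuple R n).-integrable setT (EFin \o G).
  exact: (bms_integrable (bmsZ M (bms_cube_indic 0 s))).
have hI t : `]u, v[%classic t -> u < t < v by rewrite /= in_itv.
have iF t : `]u, v[%classic t -> (lebesgue_tuple R n).-integrable setT (EFin \o F t).
  by move=> /hI /bf /bms_integrable.
have dF t y : `]u, v[%classic t -> setT y -> derivable (F^~ y) t 1.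
  by move=> /hI tuv _; exact: df.
have GF t y : `]u, v[%classic t -> setT y -> `|partial1of2 F t y| <= G y.
  move=> /hI tuv _; have [h1 h2] := hM t (row_of_tuple y) tuv.
  rewrite /partial1of2 /F/= /G /cube_indic indicE/=.
  case: (boolP (_ \in _)) => [_|]; first by rewrite mulr1.
  rewrite notin_setE /= subr0 => /negP; rewrite -ltNge => h3.
  by rewrite mulr0 h2 ?normr0//; apply: le_lt_trans h3; rewrite le_max lexx.
have Ia : `]u, v[%classic a by rewrite /= in_itv.
apply: DeriveDef; first exact: (derivable_under_integral measurableT Ia iF dF G0 iG GF).
rewrite -derive1E.
exact: (differentiation_under_integral measurableT Ia iF dF G0 iG GF).
Qed.

(** Directional derivatives are derivatives along lines: this reduces them to
    functions of one variable. *)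
Lemma is_derive_line R (V : normedModType R) (f : V -> R) (x v : V) (s d : R) :
  is_derive (x + s *: v) v f d <-> is_derive s 1 (fun t => f (x + t *: v)) d.
Proof.
have e : (fun h => h^-1 *: ((f \o shift (x + s *: v)) (h *: v) - f (x + s *: v))) =
  (fun h => h^-1 *: (((fun t => f (x + t *: v)) \o shift s) (h *: 1) - f (x + s *: v))).
  apply/funext => h /=; congr (_ *: (f _ - _)).
  by rewrite addrCA -scalerDl scaler1.
by split=> -[h1 h2]; apply: DeriveDef; move: h1 h2; rewrite /derivable /derive e.
Qed.

Lemma is_partial_line R n (f : 'rV[R]_n -> R) (i : 'I_n) (x : 'rV[R]_n) (s : R) :
  has_partial i f (x + s *: delta_mx 0 i) ->
  is_derive s (1 : R) (fun t => f (x + t *: delta_mx 0 i)) (partial i f (x + s *: delta_mx 0 i)).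
Proof. by move=> h; exact: (iffLR (is_derive_line f x (delta_mx 0 i) s _) (derivableP h)). Qed.

Lemma near0_partial R n (f : 'rV[R]_n -> R) (i : 'I_n) (x : 'rV[R]_n) :
  (\forall y \near x, f y = 0) -> is_derive x (delta_mx 0 i : 'rV[R]_n) f 0.
Proof.
move=> f0; apply: (@near_eq_is_derive _ _ _ (cst 0)).
by apply: filterS f0 => y ->.
Qed.

Lemma near_eq_continuous (T U : topologicalType) (f g : T -> U) (x : T) :
  (\forall y \near x, f y = g y) -> {for x, continuous f} -> {for x, continuous g}.
Proof.
move=> fg; rewrite /prop_for /continuous_at -(nbhs_singleton fg) => cf.
by apply: cvg_trans cf; apply: near_eq_cvg; apply: filterS fg => y ->.
Qed.

Lemma bms_open R n (W K : set 'rV[R]_n) (f : 'rV[R]_n -> R) :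
  compact K -> K `<=` W -> (forall x, W x -> {for x, continuous f}) ->
  (forall x, ~ K x -> f x = 0) -> bms f.
Proof.
move=> cK KW cf; apply: (bms_compact cK).
by apply: continuous_in_subspaceT => x /set_mem /KW /cf.
Qed.

Lemma near_off_compact R n (K : set 'rV[R]_n) (f : 'rV[R]_n -> R) (x : 'rV[R]_n) :
  compact K -> (forall x, ~ K x -> f x = 0) -> ~ K x -> \forall y \near x, f y = 0.
Proof.
move=> cK f0 nKx.
have : open (~` K) by apply: closed_openC; apply: compact_closed => //; exact: norm_hausdorff.
rewrite openE => /(_ x nKx); apply: filterS => y; exact: f0.
Qed.

(** The integral of a translate does not depend on the translation, so its
    derivative at zero, the integral of a partial derivative, vanishes. *)
Lemma lint_partial_eq0 R n (W K : set 'rV[R]_n) (h : 'rV[R]_n -> R) (i : 'I_n) :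
  compact K -> K `<=` W ->
  (forall x, W x -> [/\ {for x, continuous h}, has_partial i h x &
     {for x, continuous (partial i h)}]) ->
  (forall x, ~ K x -> h x = 0) -> lint (partial i h) = 0.
Proof.
move=> cK KW hW h0.
pose e : 'rV[R]_n := delta_mx 0 i.
have hp0 x : ~ K x -> is_derive x e h 0.
  by move=> nKx; apply: near0_partial; exact: near_off_compact nKx.
have p0 x : ~ K x -> partial i h x = 0 by move=> /hp0 [_].
have dh x : has_partial i h x.
  have [Kx|/hp0[]//] := pselect (K x); by have [] := hW x (KW _ Kx).
have bh : bms h by apply: (bms_open cK KW) => // x /hW[].
have bp : bms (partial i h) by apply: (bms_open cK KW) => // x /hW[].
have [_ [M [r hM]]] := bp.
pose F (t : R) (x : 'rV[R]_n) := h (x + t *: e).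
have dF (t : R) (x : 'rV[R]_n) : is_derive t (1 : R) (F ^~ x) (partial i h (x + t *: e)).
  exact: is_partial_line.
have F1 t x : derive1 (F ^~ x) t = partial i h (x + t *: e).
  by rewrite derive1E; have [_ ->] := dF t x.
have e1 : `|e| <= 1.
  apply/rV_norm_le => // j; rewrite !mxE; case: (_ && _); by rewrite ?normr1 ?normr0.
have D : is_derive (0 : R) (1 : R) (fun t => lint (F t)) (lint (fun x => derive1 (F ^~ x) 0)).
  apply: (@is_derive_lint _ _ _ _ (-1) 1 M (r + 1)).
  - by rewrite ltrN10 ltr01.
  - by move=> t _; exact: bms_shift.
  - by move=> t x _; have [] := dF t x.
  move=> t x /andP[t1 t2]; rewrite F1; have [h1 h2] := hM (x + t *: e); split => // rx.
  apply: h2; rewrite -ltrBrDr in rx; apply: lt_le_trans rx _.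
  rewrite lerBlDr -{1}[x](addrK (t *: e)) (le_trans (ler_normB _ _))// lerD2l.
  rewrite normrZ -[leRHS]mulr1 ler_pM// ltW// ltr_norml t2 andbT//.
have : is_derive (0 : R) (1 : R) (fun t => lint (F t)) 0.
  rewrite (_ : (fun t => _) = cst (lint h)); first exact: is_derive_cst.
  by apply/funext => t; rewrite /F lint_shift.
move=> [_ <-]; case: D => _ ->; apply: eq_lint => x.
by rewrite F1 scale0r addr0.
Qed.

(** The partial derivative of the product has integral zero, and the product
    vanishes off [K] as soon as one factor does. *)
Lemma lint_by_parts R n (W K : set 'rV[R]_n) (f g : 'rV[R]_n -> R) (i : 'I_n) :
  open W -> compact K -> K `<=` W ->
  (forall x, W x -> [/\ {for x, continuous f}, has_partial i f x &
     {for x, continuous (partial i f)}]) ->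
  (forall x, W x -> [/\ {for x, continuous g}, has_partial i g x &
     {for x, continuous (partial i g)}]) ->
  (forall x, ~ K x -> f x = 0) ->
  [/\ bms (fun x => f x * partial i g x), bms (fun x => partial i f x * g x) &
   lint (fun x => f x * partial i g x) = - lint (fun x => partial i f x * g x)].
Proof.
move=> oW cK KW fW gW f0.
pose e : 'rV[R]_n := delta_mx 0 i.
have p0 x : ~ K x -> partial i f x = 0.
  by move=> nKx; have [_] := near0_partial i (near_off_compact cK f0 nKx).
pose h x := f x * g x.
have dh x : W x -> is_derive x e h (f x * partial i g x + partial i f x * g x).
  move=> Wx; have [_ f1 _] := fW x Wx; have [_ g1 _] := gW x Wx.
  have F := derivableP f1; have G := derivableP g1.
  have := is_deriveM F G.
  move=> [h1 h2]; apply: DeriveDef; first exact: h1.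
  apply: etrans h2 _; rewrite /partial /GRing.scale/=; congr (_ + _); exact: mulrC.
have ph x : W x -> partial i h x = f x * partial i g x + partial i f x * g x.
  by move=> /dh[].
have c1 x : W x -> {for x, continuous (fun x => f x * partial i g x)}.
  move=> Wx; have [f1 _ _] := fW x Wx; have [_ _ g1] := gW x Wx.
  exact: (continuousM f1 g1).
have c2 x : W x -> {for x, continuous (fun x => partial i f x * g x)}.
  move=> Wx; have [_ _ f1] := fW x Wx; have [g1 _ _] := gW x Wx.
  exact: (continuousM f1 g1).
have b1 : bms (fun x => f x * partial i g x).
  by apply: (bms_open cK KW) => // x /f0 ->; rewrite mul0r.
have b2 : bms (fun x => partial i f x * g x).
  by apply: (bms_open cK KW) => // x /p0 ->; rewrite mul0r.
split => //; apply/eqP; rewrite -addr_eq0 -lintD//; apply/eqP.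
have h0 x : ~ K x -> h x = 0 by move=> /f0 fx; rewrite /h fx mul0r.
rewrite -[RHS](@lint_partial_eq0 _ _ W K h i)//.
  apply: eq_lint => x; have [Kx|nKx] := pselect (K x); first by rewrite ph//; exact: KW.
  rewrite f0// p0// !mul0r addr0.
  by have [_] := near0_partial i (near_off_compact cK h0 nKx).
move=> x Wx; split.
- have [f1 _ _] := fW x Wx; have [g1 _ _] := gW x Wx; exact: (continuousM f1 g1).
- by have [] := dh x Wx.
- have c := continuousD (c1 x Wx) (c2 x Wx).
  apply: near_eq_continuous c; move: oW; rewrite openE => /(_ x Wx).
  by apply: filterS => y Wy; rewrite ph.
Qed.

(** Joint continuity of the derivative on a compact set supplies the domination. *)
Lemma is_derive_lint_compact R n (K : set 'rV[R]_n)
    (f g : R -> 'rV[R]_n -> R) (a u v : R) :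
  compact K -> u < a < v ->
  (forall t, u < t < v -> {within K, continuous (f t)}) ->
  (forall t x, u < t < v -> ~ K x -> f t x = 0) ->
  (forall t x, u < t < v -> K x -> is_derive t (1 : R) (f ^~ x) (g t x)) ->
  (forall t x, ~ K x -> g t x = 0) ->
  {within K `*` [set` `]u, v[], continuous (fun z : 'rV[R]_n * R => g z.2 z.1)} ->
  is_derive a (1 : R) (fun t => lint (f t)) (lint (g a)).
Proof.
move=> cK /andP[ua av] cf f0 df g0 cg.
pose u' := (u + a) / 2; pose v' := (a + v) / 2.
have uu' : u < u' by rewrite /u'; lra.
have u'a : u' < a by rewrite /u'; lra.
have av' : a < v' by rewrite /v'; lra.
have v'v : v' < v by rewrite /v'; lra.
have sub t : u' < t < v' -> u < t < v.
  by move=> /andP[h1 h2]; rewrite (lt_trans uu' h1) (lt_trans h2 v'v).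
have cKI : compact (K `*` [set` `[u', v']]) by apply: compact_setX => //; exact: segment_compact.
have cg' : {within K `*` [set` `[u', v']], continuous (fun z : 'rV[R]_n * R => g z.2 z.1)}.
  apply: continuous_subspaceW cg => -[x t] /= [Kx]; rewrite !in_itv/= => /andP[h1 h2].
  by split => //; rewrite (lt_le_trans uu' h1) (le_lt_trans h2 v'v).
have [M M0 hM] := compact_within_bounded cKI cg'.
have [r [_ Kr]] := compact_bounded cK.
have dg t x : u' < t < v' -> is_derive t (1 : R) (f ^~ x) (g t x).
  move=> tuv; have [Kx|nKx] := pselect (K x); first exact: df (sub _ tuv) _.
  rewrite g0//; apply: (@near_eq_is_derive _ _ _ (cst 0)).
  have := @near_in_itvoo _ u' v' t; rewrite in_itv/= => /(_ tuv).
  by apply: filterS => s; rewrite in_itv/= => /sub h; rewrite f0.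
have dE t x : u' < t < v' -> derive1 (f ^~ x) t = g t x.
  by move=> tuv; rewrite derive1E; have [_ ->] := dg t x tuv.
rewrite [X in is_derive _ _ _ X](_ : _ = lint (fun x => derive1 (f ^~ x) a)); last first.
  by apply: eq_lint => x; rewrite dE// u'a av'.
apply: (@is_derive_lint _ _ _ a u' v' M (r + 1)).
- by rewrite u'a av'.
- move=> t /sub tuv; apply: (bms_compact cK (cf t tuv)) => x; exact: f0.
- by move=> t x /(dg t x)[].
move=> t x tuv; rewrite dE//; split => [|rx].
  have [Kx|/g0 ->] := pselect (K x); last by rewrite normr0.
  apply: (hM (x, t)); split => //=; rewrite in_itv/=.
  by move: tuv => /andP[h1 h2]; rewrite !ltW.
apply: g0 => Kx; have := Kr (r + 1); rewrite ltrDl => /(_ ltr01 x Kx)/=.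
by rewrite leNgt rx.
Qed.

(** * Calculus of cutoffs and radial functions *)

Lemma is_derive_cong R (V : normedModType R) (f g : V -> R) (x v : V) (d d' : R) :
  is_derive x v f d -> f =1 g -> d = d' -> is_derive x v g d'.
Proof. by move=> h /funext <- <-. Qed.

(** Powers of the positive part, the bricks of smooth cutoffs. *)
Definition pospow R (k : nat) (x : R) : R := (Num.max x 0) ^+ k.

Lemma contM R (T : topologicalType) (f g : T -> R) (x : T) :
  {for x, continuous f} -> {for x, continuous g} -> {for x, continuous (fun y => f y * g y)}.
Proof. by move=> cf cg; exact: (continuousM cf cg). Qed.

Lemma contD R (T : topologicalType) (f g : T -> R) (x : T) :
  {for x, continuous f} -> {for x, continuous g} -> {for x, continuous (fun y => f y + g y)}.
Proof. by move=> cf cg; exact: (continuousD cf cg). Qed.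

Lemma contN R (T : topologicalType) (f : T -> R) (x : T) :
  {for x, continuous f} -> {for x, continuous (fun y => - f y)}.
Proof. by move=> cf; exact: (continuousN cf). Qed.

Lemma contC R (T : topologicalType) (c : R) (x : T) :
  {for x, continuous (fun _ : T => c)}.
Proof. exact: cst_continuous. Qed.

Lemma cont_sum R (T : topologicalType) (n : nat) (f : 'I_n -> T -> R) (x : T) :
  (forall i, {for x, continuous (f i)}) -> {for x, continuous (fun y => \sum_(i < n) f i y)}.
Proof.
by move=> cf; apply: (cvg_big (@add_continuous _) (nbhs_filter x)) => i _; exact: cf.
Qed.

Lemma cont_comp (T U V : topologicalType) (f : T -> U) (g : U -> V) (x : T) :
  {for x, continuous f} -> {for f x, continuous g} -> {for x, continuous (fun y => g (f y))}.
Proof. by move=> cf cg; exact: (continuous_comp cf cg). Qed.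

Lemma contX R (T : topologicalType) (f : T -> R) (k : nat) (x : T) :
  {for x, continuous f} -> {for x, continuous (fun y => f y ^+ k)}.
Proof. by move=> cf; apply: (@cont_comp _ _ _ f (fun y => y ^+ k) x cf); exact: exprn_continuous. Qed.

Lemma is_derive_chain R (f g : R -> R) (x d e : R) :
  is_derive x (1 : R) g d -> is_derive (g x) (1 : R) f e ->
  is_derive x (1 : R) (fun t => f (g t)) (e * d).
Proof. by move=> dg df; exact: (@is_derive1_comp _ f g x _ _ df dg). Qed.

Lemma is_derive_continuous R (f f' : R -> R) :
  (forall s, is_derive s (1 : R) f (f' s)) -> continuous f.
Proof.
by move=> df s; apply: differentiable_continuous; apply/derivable1_diffP; have [] := df s.
Qed.

Lemma is_derive_pospow R (k : nat) (x : R) :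
  is_derive x (1 : R) (pospow k.+2) (k.+2%:R * pospow k.+1 x).
Proof.
have [x0|x0|->] := ltgtP x 0.
- rewrite /pospow (max_r (ltW x0)) expr0n/= mulr0.
  apply: (@near_eq_is_derive _ _ _ (cst 0)).
  near=> y; rewrite /pospow max_r ?expr0n//; apply: ltW; near: y.
  exact: lt_nbhsl.
- have -> : pospow k.+1 x = x ^+ k.+1 by rewrite /pospow (max_l (ltW x0)).
  apply: (@near_eq_is_derive _ _ _ (id ^+ k.+2 : R -> R)).
    near=> y.
    have y0 : 0 < y by near: y; exact: lt_nbhsr.
    rewrite /pospow (max_l (ltW y0)).
    by rewrite exprfctE.
  apply: (is_derive_cong (is_deriveX k.+2 (is_derive_id x (1 : R)))) => //.
  by rewrite /GRing.scale/= mulr1.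
rewrite /pospow maxxx expr0n/= mulr0.
suff h : (fun h : R => h^-1 *: ((pospow k.+2 \o shift 0) (h *: 1) - pospow k.+2 0)) @ 0^' --> (0 : R).
  apply: DeriveDef; first by apply/cvg_ex; exists 0.
  exact/cvg_lim.
apply/cvgr0Pnorm_le => e e0.
near=> h.
rewrite /pospow/= maxxx expr0n/= subr0 addr0 /GRing.scale/= mulr1.
have h1 : `|h| < Num.min e 1.
  near: h; apply: dnbhs0_lt; by rewrite lt_min e0 ltr01.
have h0 : h != 0 by near: h; exact: nbhs_dnbhs_neq.
rewrite normrM normfV ler_pdivrMl ?normr_gt0// normrX.
move: h1; rewrite lt_min => /andP[h1 h2].
have h3 : `|Num.max h 0| <= `|h|.
  by have [h3|h3] := leP h 0; rewrite ?normr0.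
apply: (@le_trans _ _ (`|h| ^+ k.+2)); first by rewrite lerXn2r// nnegrE.
rewrite exprS ler_pM2l ?normr_gt0//.
apply: (@le_trans _ _ (`|h| ^+ 1)); last by rewrite expr1 ltW.
by apply: ler_wiXn2l => //; exact: ltW.
Unshelve. all: by end_near. Qed.

Lemma continuous_pospow R (k : nat) : continuous (@pospow R k).
Proof.
move=> x; rewrite /pospow; apply: (@continuous_comp _ _ _ (fun x : R => Num.max x 0) (fun y => y ^+ k)).
  by apply: continuous_max; [exact: cvg_id|exact: cvg_cst].
exact: exprn_continuous.
Qed.

Lemma pospow_ge0 R (k : nat) (x : R) : 0 <= pospow k x.
Proof. by rewrite exprn_ge0// le_max lexx orbT. Qed.

Lemma pospow_eq0 R (k : nat) (x : R) : x <= 0 -> pospow k.+1 x = 0.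
Proof. by move=> x0; rewrite /pospow max_r// expr0n. Qed.

(** Built from cubes of positive parts, (1 - ((s-a)/(b-a))_+^3)_+^3. The point of
    strict decrease in the last clause is what makes a lower bound for the mass
    of a boundary layer possible. *)
Lemma cutoff_exists R (a b : R) : a < b ->
  exists xi d1 d2 : R -> R,
  [/\ (forall s, is_derive s (1 : R) xi (d1 s)),
      (forall s, is_derive s (1 : R) d1 (d2 s)), continuous d2,
      (forall s, 0 <= xi s <= 1) /\ (forall s, d1 s <= 0) &
  [/\ (forall s, s <= a -> xi s = 1), (forall s, b <= s -> xi s = 0),
      (forall s, s <= a \/ b <= s -> d1 s = 0 /\ d2 s = 0) &
      exists2 s, a < s < b & d1 s < 0]].
Proof.
move=> ab.
pose c := (b - a)^-1.
have c0 : 0 < c by rewrite invr_gt0 subr_gt0.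
pose L (s : R) := c * (s - a).
pose P k s := pospow k (L s).
pose xi (s : R) : R := pospow 3 (1 - P 3 s).
pose d1 (s : R) : R := - (9 * c) * (pospow 2 (1 - P 3 s) * P 2 s).
pose d2 (s : R) : R := - (9 * c) * ((- (6 * c)) * (pospow 1 (1 - P 3 s) * (P 2 s * P 2 s)) + (2 * c) * (pospow 2 (1 - P 3 s) * P 1 s)).
have dL s : is_derive s (1 : R) L c.
  have h : is_derive s (1 : R) (fun s : R => c *: (s - a)) (c *: (1 - 0)).
    by apply: is_deriveZ.
  apply: (is_derive_eq h); by rewrite subr0 /GRing.scale/= mulr1.
have dP k s : is_derive s (1 : R) (P k.+2) (c * (k.+2%:R * P k.+1 s)).
  by have := is_derive_chain (dL s) (is_derive_pospow k (L s)); rewrite mulrC.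
have dQ k s : is_derive s (1 : R) (fun s => pospow k.+2 (1 - P 3 s)) (- (3 * c * P 2 s) * (k.+2%:R * pospow k.+1 (1 - P 3 s))).
  have h : is_derive s (1 : R) (fun s => 1 - P 3 s) (0 - c * (3%:R * P 2 s)).
    by apply: is_deriveB.
  have h2 := is_derive_chain h (is_derive_pospow k (1 - P 3%N s)).
  have e : k.+2%:R * pospow k.+1 (1 - P 3 s) * (0 - c * (3%:R * P 2%N s)) =
    - (3 * c * P 2 s) * (k.+2%:R * pospow k.+1 (1 - P 3 s)) by ring.
  by rewrite -e.
have cL : continuous L by move=> s; apply: differentiable_continuous; apply/derivable1_diffP; have [] := dL s.
have cP k : continuous (P k).
  by move=> s; apply: (@continuous_comp _ _ _ L (@pospow R k)); [exact: cL|exact: continuous_pospow].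
have cQ k : continuous (fun s => pospow k (1 - P 3 s)).
  move=> s; apply: (@continuous_comp _ _ _ (fun s => 1 - P 3 s) (@pospow R k)).
    by apply: continuousB; [exact: cst_continuous|exact: cP].
  exact: continuous_pospow.
have L0 s : s <= a -> L s <= 0.
  by move=> sa; rewrite /L pmulr_rle0// subr_le0.
have L1 s : b <= s -> 1 <= L s.
  move=> bs; rewrite /L mulrC -(@mulfV _ (b - a)) ?gt_eqF ?subr_gt0//.
  by rewrite ler_pM2r// lerD2r.
have P1 s : b <= s -> 1 <= P 3 s.
  move=> /L1 h; rewrite /P /pospow max_l ?(le_trans ler01)//; exact: exprn_ege1.
have Pa s k : s <= a -> P k.+1 s = 0 by move=> /L0; exact: pospow_eq0.
have Qb s k : b <= s -> pospow k.+1 (1 - P 3 s) = 0.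
  by move=> /P1 h; apply: pospow_eq0; rewrite subr_le0.
exists xi, d1, d2; split.
- move=> s; apply: (is_derive_eq (dQ 1%N s)); rewrite /d1; ring.
- move=> s.
  have h1 := is_deriveM (dQ 0%N s) (dP 0%N s).
  have h2 := is_deriveZ (- (9 * c)) h1.
  apply: (is_derive_eq h2); rewrite /d2 /GRing.scale/=; ring.
- move=> s; suff : {for s, continuous (fun s : R => - (9 * c) * ((- (6 * c)) * (pospow 1 (1 - P 3%N s) * (P 2%N s * P 2%N s)) + (2 * c) * (pospow 2 (1 - P 3%N s) * P 1%N s)))} by [].
  apply: contM; first exact: contC.
  apply: contD; (apply: contM; first exact: contC).
    by apply: contM; [exact: cQ|apply: contM; exact: cP].
  by apply: contM; [exact: cQ|exact: cP].
- split => s.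
    rewrite pospow_ge0/= /xi /pospow exprn_ile1 ?le_max ?lexx ?orbT//.
    by rewrite ge_max ler01 andbT lerBlDr lerDl pospow_ge0.
  rewrite /d1 mulNr oppr_le0; apply: mulr_ge0; first by rewrite mulr_ge0// ltW.
  by rewrite mulr_ge0// pospow_ge0.
split.
- by move=> s sa; rewrite /xi Pa// subr0 /pospow max_l// expr1n.
- by move=> s sb; rewrite /xi Qb.
- by move=> s [sa|sb]; split; rewrite /d1 /d2 ?(Pa _ _ sa) ?(Qb _ _ sb); ring.
exists ((a + b) / 2); first by lra.
have Lm : L ((a + b) / 2) = 2^-1.
  by rewrite /L /c; field; lra.
rewrite /d1 /P Lm /pospow (max_l (_ : 0 <= 2^-1))// max_l; lra.
Qed.

Lemma is_derive_comp_scalar R n (f : 'rV[R]_n -> R) (g : R -> R)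
    (x v : 'rV[R]_n) (d e : R) :
  is_derive x v f d -> is_derive (f x) (1 : R) g e -> is_derive x v (g \o f) (e * d).
Proof.
move=> df dg.
have x0 : x + 0 *: v = x by rewrite scale0r addr0.
have h := is_derive_line f x v 0 d; rewrite x0 in h; move/h : df => df.
have k := is_derive_line (g \o f) x v 0 (e * d); rewrite x0 in k; apply/k.
by apply: (@is_derive1_comp _ g (fun t : R => f (x + t *: v))); rewrite ?x0.
Qed.

Definition sqdist R n (z x : 'rV[R]_n) : R :=
  \sum_(i < n) (x 0 i - z 0 i) ^+ 2.

Lemma is_derive_coord R n (j : 'I_n) (x v : 'rV[R]_n) :
  is_derive x v (fun y : 'rV[R]_n => y 0 j) (v 0 j).
Proof.
have x0 : x = x + 0 *: v by rewrite scale0r addr0.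
rewrite x0; apply: (iffRL (is_derive_line (fun y : 'rV[R]_n => y 0 j) x v 0 (v 0 j))).
rewrite (_ : (fun t : R => _) = (fun t : R => x 0 j + v 0 j *: t)); last first.
  by apply/funext => t; rewrite !mxE mulrC.
have h : is_derive (0 : R) (1 : R) (fun t : R => x 0 j + v 0 j *: t) (0 + v 0 j *: 1).
  by apply: is_deriveD.
by apply: (is_derive_eq h); rewrite add0r /GRing.scale/= mulr1.
Qed.

Lemma is_derive_sqdist R n (z x v : 'rV[R]_n) :
  is_derive x v (sqdist z) (2 * \sum_(i < n) (x 0 i - z 0 i) * v 0 i).
Proof.
have h (i : 'I_n) : is_derive x v (fun y : 'rV[R]_n => (y 0 i - z 0 i) ^+ 2) (2 * ((x 0 i - z 0 i) * v 0 i)).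
  have h1 : is_derive x v (fun y : 'rV[R]_n => y 0 i - z 0 i) (v 0 i - 0).
    by apply: is_deriveB; exact: is_derive_coord.
  apply: (is_derive_cong (is_deriveX 2 h1)) => //.
  by rewrite /GRing.scale/= subr0 expr1; ring.
apply: (is_derive_cong (is_derive_sum h)); last by rewrite mulr_sumr.
by move=> y; rewrite /sqdist fct_sumE.
Qed.

Lemma partial_sqdist R n (z x : 'rV[R]_n) (i : 'I_n) :
  is_derive x (delta_mx 0 i : 'rV[R]_n) (sqdist z) (2 * (x 0 i - z 0 i)).
Proof.
apply: (is_derive_eq (is_derive_sqdist _ _ _)); congr (2 * _).
rewrite (bigD1 i)//= mxE !eqxx mulr1 big1 ?addr0// => j ji.
by rewrite mxE (negbTE ji) andbF mulr0.
Qed.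

Lemma continuous_sqdist R n (z : 'rV[R]_n) : continuous (sqdist z).
Proof.
move=> x; apply: cont_sum => i.
by apply: contX; apply: contD; [exact: coord_continuous|exact: contC].
Qed.

Lemma sqdist_ge0 R n (z x : 'rV[R]_n) : 0 <= sqdist z x.
Proof. by apply: sumr_ge0 => i _; exact: sqr_ge0. Qed.

Lemma norm_le_sqdist R n (z x : 'rV[R]_n) (r : R) :
  0 <= r -> sqdist z x <= r ^+ 2 -> `|x - z| <= r.
Proof.
move=> r0 h; apply/(rV_norm_le _ r0) => i; rewrite !mxE.
rewrite -(@ler_pXn2r _ 2)// ?nnegrE// real_normK ?num_real//; apply: le_trans h.
by rewrite /sqdist (bigD1 i)//= lerDl sumr_ge0// => j _; exact: sqr_ge0.
Qed.

Lemma sqdist_le_norm R n (z x : 'rV[R]_n) (r : R) :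
  0 <= r -> `|x - z| <= r -> sqdist z x <= n%:R * r ^+ 2.
Proof.
move=> r0 /(rV_norm_le _ r0) h.
rewrite mulr_natl -[in leRHS](card_ord n) -sumr_const; apply: ler_sum => i _.
have := h i; rewrite !mxE => hi.
by rewrite -real_normK ?num_real// lerXn2r// nnegrE.
Qed.

(** A path parallel to the axes between the two points stays in the sup-norm ball,
    and along it only partial derivatives intervene. *)
Lemma MVT_coord R n (f : 'rV[R]_n -> R) (y w : 'rV[R]_n) :
  (forall i x, `|x - y| <= `|w| -> has_partial i f x) ->
  exists xi : 'I_n -> 'rV[R]_n, (forall i, `|xi i - y| <= `|w|) /\
    f (y + w) - f y = \sum_(i < n) w 0 i * partial i f (xi i).
Proof.
move=> df.
pose W (k : nat) : 'rV[R]_n := \row_j (if (j < k)%N then w 0 j else 0).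
have WS (k : 'I_n) : W k.+1 = W k + w 0 k *: delta_mx 0 k.
  apply/rowP => j; rewrite !mxE eqxx/= ltnS leq_eqVlt (inj_eq val_inj).
  have [->|jk] := eqVneq j k; first by rewrite ltnn mulr1 add0r.
  by rewrite /= mulr0 addr0.
have Wle k (s : R) (i : 'I_n) : 0 <= s <= 1 -> i = k :> nat ->
    `|W k + (s * w 0 i) *: delta_mx 0 i| <= `|w|.
  move=> /andP[s0 s1] ik; apply/(rV_norm_le _ (normr_ge0 _)) => j; rewrite !mxE eqxx/=.
  have hj : `|w 0 j| <= `|w| by move: (lexx `|w|) => /(rV_norm_le _ (normr_ge0 _)).
  have [->|ji] := eqVneq j i.
    rewrite ik ltnn add0r mulr1 normrM (ger0_norm s0).
    have hi : `|w 0 i| <= `|w| by move: (lexx `|w|) => /(rV_norm_le _ (normr_ge0 _)).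
    by apply: le_trans hi; rewrite ler_piMl.
  by rewrite mulr0 addr0; case: ifP => // _; rewrite normr0.
have step (k : 'I_n) : exists x, `|x - y| <= `|w| /\
    f (y + W k.+1) - f (y + W k) = w 0 k * partial k f x.
  pose F (s : R) := f (y + W k + s *: (w 0 k *: delta_mx 0 k)).
  have hx (s : R) : 0 <= s <= 1 -> `|y + W k + s *: (w 0 k *: delta_mx 0 k) - y| <= `|w|.
    move=> s01; rewrite scalerA (_ : _ - y = W k + (s * w 0 k) *: delta_mx 0 k); first exact: Wle.
    by rewrite -[y + W k + _]addrA [y + _]addrC addrK.
  have dF (s : R) : 0 <= s <= 1 -> is_derive s (1 : R) F (w 0 k * partial k f (y + W k + s *: (w 0 k *: delta_mx 0 k))).
    move=> s01.
    have h := derivableP (df k _ (hx s s01)).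
    pose G t := f (y + W k + t *: delta_mx 0 k).
    rewrite scalerA in h.
    have hG := iffLR (is_derive_line f (y + W k) (delta_mx 0 k) (s * w 0 k) _) h.
    have hm : is_derive s (1 : R) (fun s : R => s * w 0 k) (w 0 k).
      have hm := is_deriveZ (w 0 k) (is_derive_id s (1 : R)).
      rewrite (_ : (fun s : R => _) = (w 0 k) *: (id : R -> R)); last first.
        by apply/funext => t; rewrite mulrC.
      by apply: (is_derive_eq hm); rewrite /GRing.scale/= mulr1.
    rewrite scalerA /partial.
    apply: (is_derive_cong (is_derive_chain hm hG)); last exact: mulrC.
    by move=> t; rewrite /F/= scalerA.
  have cF : {within `[0, 1], continuous F}.
    apply: continuous_in_subspaceT => s; rewrite inE/= in_itv/= => s01.
    by apply: differentiable_continuous; apply/derivable1_diffP; have [] := dF s s01.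
  have [|c] := @MVT _ F (fun s => w 0 k * partial k f (y + W k + s *: (w 0 k *: delta_mx 0 k))) 0 1 ltr01 _ cF.
    by move=> s; rewrite in_itv/= => /andP[s0 s1]; apply: dF; rewrite !ltW.
  rewrite in_itv/= => /andP[c0 c1]; rewrite subr0 mulr1 /F scale1r scale0r addr0 => e.
  exists (y + W k + c *: (w 0 k *: delta_mx 0 k)); split.
    by apply: hx; rewrite !ltW.
  by rewrite WS addrA e.
have /choice[xi hxi] := step.
exists xi; split => [i|]; first by have [] := hxi i.
transitivity (\sum_(0 <= k < n) (f (y + W k.+1) - f (y + W k))).
  rewrite telescope_sumr//; congr (f (y + _) - f _).
    by apply/rowP => j; rewrite mxE ltn_ord.
  by rewrite (_ : W 0%N = 0) ?addr0//; apply/rowP => j; rewrite !mxE.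
by rewrite big_mkord; apply: eq_bigr => i _; have [_] := hxi i.
Qed.

Lemma derive_le0_nonincreasing R (f : R -> R) (a b : R) :
  a <= b ->
  (forall s, a <= s <= b -> exists2 d : R, is_derive s (1 : R) f d & d <= 0) ->
  f b <= f a.
Proof.
move=> ab df; apply: (@ler0_derive1_le_cc _ f a b) => //.
- by move=> s; rewrite in_itv/= => /andP[h1 h2]; have [|d []//] := df s; rewrite !ltW.
- move=> s; rewrite in_itv/= => /andP[h1 h2]; rewrite derive1E.
  by have [|d [_ ->]//] := df s; rewrite !ltW.
- apply: continuous_in_subspaceT => s /set_mem/=; rewrite in_itv/= => h.
  by apply: differentiable_continuous; apply/derivable1_diffP; have [|d []//] := df s.
- by rewrite in_itv/= lexx ab.
- by rewrite in_itv/= lexx ab.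
Qed.

(** The class C^2, as far as the Laplacian needs it: pure second derivatives. *)
Definition C2on R n (W : set 'rV[R]_n) (f : 'rV[R]_n -> R) : Prop :=
  forall x, W x -> {for x, continuous f} /\ forall i,
    [/\ has_partial i f x, {for x, continuous (partial i f)},
        has_partial i (partial i f) x & {for x, continuous (partial i (partial i f))}].

Lemma radial_C2 R n (z : 'rV[R]_n) (P P1 P2 : R -> R) :
  (forall s, is_derive s (1 : R) P (P1 s)) -> (forall s, is_derive s (1 : R) P1 (P2 s)) ->
  continuous P2 ->
  [/\ forall W, C2on W (P \o sqdist z),
      forall i x, partial i (P \o sqdist z) x = P1 (sqdist z x) * (2 * (x 0 i - z 0 i)) &
      forall x, laplacian (P \o sqdist z) x = 4 * sqdist z x * P2 (sqdist z x) + 2 * n%:R * P1 (sqdist z x)].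
Proof.
move=> dP dP1 cP2.
have cq := @continuous_sqdist R n z.
have D1 (i : 'I_n) (x : 'rV[R]_n) : is_derive x (delta_mx 0 i : 'rV[R]_n) (P \o sqdist z) (P1 (sqdist z x) * (2 * (x 0 i - z 0 i))).
  exact: (is_derive_comp_scalar (partial_sqdist z x i) (dP _)).
have E1 i : partial i (P \o sqdist z) = (fun x => P1 (sqdist z x) * (2 * (x 0 i - z 0 i))).
  by apply/funext => x; have [_] := D1 i x.
have D2 (i : 'I_n) (x : 'rV[R]_n) : is_derive x (delta_mx 0 i : 'rV[R]_n) (partial i (P \o sqdist z))
    (4 * (x 0 i - z 0 i) ^+ 2 * P2 (sqdist z x) + 2 * P1 (sqdist z x)).
  rewrite E1.
  have h1 := is_derive_comp_scalar (partial_sqdist z x i) (dP1 (sqdist z x)).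
  have h2 : is_derive x (delta_mx 0 i : 'rV[R]_n) (fun y : 'rV[R]_n => 2 * (y 0 i - z 0 i)) (2 *: (1 - 0)).
    apply: is_deriveZ; apply: is_deriveB.
    by apply: (is_derive_cong (is_derive_coord i x _)) => //; rewrite mxE !eqxx.
  apply: (is_derive_cong (is_deriveM h1 h2)) => //.
  by rewrite /GRing.scale/= subr0; ring.
have cx (i : 'I_n) (x : 'rV[R]_n) : {for x, continuous (fun y : 'rV[R]_n => y 0 i - z 0 i)}.
  by apply: contD; [exact: coord_continuous|exact: contC].
split => [W x _|i x|x].
- split => [|i]; first by apply: cont_comp; [exact: cq|exact: (is_derive_continuous dP)].
  split; [by have [] := D1 i x| |by have [] := D2 i x|].
    rewrite E1; apply: contM; last by apply: contM; [exact: contC|exact: cx].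
    by apply: cont_comp; [exact: cq|exact: (is_derive_continuous dP1)].
  rewrite (_ : partial i (partial i _) = (fun x => 4 * (x 0 i - z 0 i) ^+ 2 * P2 (sqdist z x) + 2 * P1 (sqdist z x))); last first.
    by apply/funext => y; have [_] := D2 i y.
  apply: contD; (apply: contM; last by apply: cont_comp; [exact: cq|first [exact: cP2|exact: (is_derive_continuous dP1)]]).
    apply: contM; first exact: contC.
    exact/contX/cx.
  exact: contC.
- by rewrite E1.
rewrite /laplacian (eq_bigr (fun i => 4 * P2 (sqdist z x) * (x 0 i - z 0 i) ^+ 2 + 2 * P1 (sqdist z x))); last first.
  by move=> i _; have [_ e] := D2 i x; rewrite [LHS]e; ring.
by rewrite big_split/= -mulr_sumr -/(sqdist z x) sumr_const card_ord -mulr_natl; ring.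
Qed.

Lemma lint_laplacian_by_parts R n (W K : set 'rV[R]_n) (f g : 'rV[R]_n -> R) :
  open W -> compact K -> K `<=` W -> C2on W f -> C2on W g ->
  (forall x, ~ K x -> f x = 0) ->
  [/\ bms (fun x => f x * laplacian g x), bms (fun x => laplacian f x * g x) &
   lint (fun x => f x * laplacian g x) = lint (fun x => laplacian f x * g x)].
Proof.
move=> oW cK KW fW gW f0.
have p0 i x : ~ K x -> partial i f x = 0.
  by move=> nKx; have [_] := near0_partial i (near_off_compact cK f0 nKx).
have h1 i : [/\ bms (fun x => f x * partial i (partial i g) x),
    bms (fun x => partial i f x * partial i g x) &
    lint (fun x => f x * partial i (partial i g) x) = - lint (fun x => partial i f x * partial i g x)].
  apply: (lint_by_parts oW cK KW) => // x Wx.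
    by have [? /(_ i)[]] := fW x Wx.
  by have [? /(_ i)[]] := gW x Wx.
have h2 i : [/\ bms (fun x => partial i f x * partial i g x),
    bms (fun x => partial i (partial i f) x * g x) &
    lint (fun x => partial i f x * partial i g x) = - lint (fun x => partial i (partial i f) x * g x)].
  apply: (lint_by_parts oW cK KW) => [x Wx|x Wx|x nKx]; last exact: p0.
    by have [? /(_ i)[]] := fW x Wx.
  by have [? /(_ i)[]] := gW x Wx.
have e1 : (fun x => f x * laplacian g x) = (fun x => \sum_(i < n) f x * partial i (partial i g) x).
  by apply/funext => x; rewrite /laplacian mulr_sumr.
have e2 : (fun x => laplacian f x * g x) = (fun x => \sum_(i < n) partial i (partial i f) x * g x).
  by apply/funext => x; rewrite /laplacian mulr_suml.
rewrite e1 e2; split.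
- by apply: bms_sum => i; have [] := h1 i.
- by apply: bms_sum => i; have [] := h2 i.
rewrite !lint_sum; [|by move=> i; have [] := h2 i|by move=> i; have [] := h1 i].
by apply: eq_bigr => i _; have [_ _ ->] := h1 i; have [_ _ ->] := h2 i; rewrite opprK.
Qed.

(** * The localized heat kernel *)

(** The heat kernel, up to a constant factor, at time [sg] and at a point of
    squared distance [q] to its centre. *)
Definition gauss R n (sg q : R) : R :=
  expR (- (n%:R / 2 * ln sg) - q / (4 * sg)).

(** Away from its centre the heat kernel, even divided by powers of the time,
    stays bounded as time goes to zero: the exponential beats every power. *)
Lemma expR_ln_bound R (N a : R) : 0 <= N -> 0 < a ->
  exists2 D : R, 0 < D & forall s : R, 0 < s -> expR (- (N * ln s) - a / s) <= D.
Proof.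
move=> N0 a0; pose e := a / (N + 1).
have N1 : 0 < N + 1 by lra.
have e0 : 0 < e by rewrite divr_gt0.
exists (expR (- (N * ln e))); first exact: expR_gt0.
move=> s s0; rewrite ler_expR.
have h : ln (e / s) <= e / s - 1.
  have := @le_ln1Dx R (e / s - 1); rewrite addrCA subrr addr0; apply.
  by rewrite ltrBrDr addrC subrr divr_gt0.
rewrite ln_div ?posrE// in h.
have Ne : N * e <= a.
  by rewrite /e mulrCA ler_piMr ?(ltW a0)// ler_pdivrMr// mul1r lerDl.
have hs : N * e / s <= a / s by rewrite ler_pM2r// invr_gt0.
have h2 : N * (ln e - ln s) <= N * (e / s - 1) by rewrite ler_wpM2l.
have e1 : N * (e / s) = N * e / s by rewrite mulrA.
rewrite !mulrBr e1 in h2; lra.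
Qed.

Lemma is_derive_expR_comp R (f : R -> R) (x d : R) :
  is_derive x (1 : R) f d -> is_derive x (1 : R) (fun t => expR (f t)) (expR (f x) * d).
Proof. by move=> df; apply: is_derive_chain df _; exact: is_derive_expR. Qed.

Lemma is_derive_gauss_q R n (sg q : R) :
  is_derive q (1 : R) (gauss n sg) (gauss n sg q * - (4 * sg)^-1).
Proof.
apply: is_derive_expR_comp.
have h : is_derive q (1 : R) (fun q : R => - (n%:R / 2 * ln sg) - (4 * sg)^-1 *: q) (0 - (4 * sg)^-1 *: 1).
  by apply: is_deriveB.
apply: (is_derive_cong h); last by rewrite /GRing.scale/=; ring.
by move=> y; rewrite /GRing.scale/= [_ * y]mulrC.
Qed.

Lemma is_derive_gauss_sg R n (q sg : R) : 0 < sg ->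
  is_derive sg (1 : R) (fun sg => gauss n sg q) (gauss n sg q * (q / (4 * sg ^+ 2) - n%:R / (2 * sg))).
Proof.
move=> s0; apply: is_derive_expR_comp.
have s00 : sg != 0 by rewrite gt_eqF.
have h1 : is_derive sg (1 : R) (@ln R) (sg^-1) by exact: is_derive1_ln.
have h2 : is_derive sg (1 : R) (fun s : R => s^-1) (- sg ^- 2 *: 1).
  exact: (is_deriveV s00).
have h : is_derive sg (1 : R) (fun s : R => (- (n%:R / 2)) *: ln s - (q / 4) *: s^-1) ((- (n%:R / 2)) *: sg^-1 - (q / 4) *: (- sg ^- 2 *: 1)).
  by apply: is_deriveB; apply: is_deriveZ.
apply: (is_derive_cong h).
  by move=> y; rewrite /GRing.scale/= invfM; ring.
by rewrite /GRing.scale/=; field.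
Qed.

Lemma continuous_gauss R n (T : topologicalType) (f g : T -> R) (x : T) :
  {for x, continuous f} -> {for x, continuous g} -> 0 < f x ->
  {for x, continuous (fun y => gauss n (f y) (g y))}.
Proof.
move=> cf cg f0; apply: (@cont_comp _ _ _ (fun y => - (n%:R / 2 * ln (f y)) - g y / (4 * f y)) (@expR R)); last exact: continuous_expR.
apply: contD; apply: contN.
  apply: contM; first exact: contC.
  apply: (@cont_comp _ _ _ f (@ln R)) => //; exact: continuous_ln.
apply: contM => //; apply: (@cont_comp _ _ _ (fun y => 4 * f y) (fun y : R => y^-1)).
  by apply: contM => //; exact: contC.
by apply: inv_continuous; rewrite gt_eqF// mulr_gt0.
Qed.

Definition bump_kernel R n (xi : R -> R) (z : 'rV[R]_n) (sg : R) : 'rV[R]_n -> R :=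
  (fun q => gauss n sg q * xi q) \o sqdist z.

(** The first summand of the Laplacian is the time derivative of the kernel; the
    second, which carries the derivatives of the cutoff, is the price of
    localization. *)
Lemma bump_kernel_C2 R n (xi d1 d2 : R -> R) (z : 'rV[R]_n) (sg : R) :
  0 < sg ->
  (forall s, is_derive s (1 : R) xi (d1 s)) -> (forall s, is_derive s (1 : R) d1 (d2 s)) ->
  continuous d2 ->
  (forall W, C2on W (bump_kernel xi z sg)) /\
  forall x, let q := sqdist z x in
    laplacian (bump_kernel xi z sg) x =
      gauss n sg q * (xi q * (q / (4 * sg ^+ 2) - n%:R / (2 * sg)))
      + gauss n sg q * (4 * q * d2 q - 2 * q * d1 q / sg + 2 * n%:R * d1 q).
Proof.
move=> s0 dxi dd1 cd2; have s00 : sg != 0 by rewrite gt_eqF.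
pose P q := gauss n sg q * xi q.
pose P1 q := gauss n sg q * (d1 q - xi q * (4 * sg)^-1).
pose P2 q := gauss n sg q * (d2 q - d1 q * (2 * sg)^-1 + xi q * (16 * sg ^+ 2)^-1).
have dP q : is_derive q (1 : R) P (P1 q).
  apply: (is_derive_cong (is_deriveM (is_derive_gauss_q n sg q) (dxi q))) => //.
  by rewrite /GRing.scale/= /P1; ring.
have dP1 q : is_derive q (1 : R) P1 (P2 q).
  have h : is_derive q (1 : R) (fun q => d1 q - (4 * sg)^-1 *: xi q) (d2 q - (4 * sg)^-1 *: d1 q).
    by apply: is_deriveB.
  apply: (is_derive_cong (is_deriveM (is_derive_gauss_q n sg q) h)).
    by move=> y; rewrite /P1/= mulrfctE /GRing.scale/= [xi y * _]mulrC.
  by rewrite /GRing.scale/= /P2; field.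
have cP2 : continuous P2.
  move=> q; rewrite /P2; apply: contM; first exact: (is_derive_continuous (is_derive_gauss_q n sg)).
  apply: contD; last by apply: contM; [exact: (is_derive_continuous dxi)|exact: contC].
  by apply: contD; [exact: cd2|apply: contN; apply: contM; [exact: (is_derive_continuous dd1)|exact: contC]].
have [h1 h2 h3] := radial_C2 z dP dP1 cP2.
split => // x q; rewrite /bump_kernel h3 -/q /P1 /P2; by field.
Qed.

(** * Mean value inequality for subcaloric functions *)

Definition subcaloric R n (W : set 'rV[R]_n) (a b : R)
    (u : 'rV[R]_n -> R -> R) : Prop :=
  [/\ forall t, a < t < b -> C2on W (u ^~ t),
      forall x t, W x -> a < t < b -> derivable (u x) t 1,
      {within W `*` [set` `]a, b[], continuous (fun z => u z.1 z.2)} /\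
      {within W `*` [set` `]a, b[], continuous (fun z => derive1 (u z.1) z.2)},
      forall x t, W x -> a < t < b -> 0 <= u x t &
      forall x t, W x -> a < t < b -> derive1 (u x) t <= laplacian (u ^~ t) x].

Lemma C2on_sub R n (W W' : set 'rV[R]_n) (f : 'rV[R]_n -> R) :
  W' `<=` W -> C2on W f -> C2on W' f.
Proof. by move=> s h x /s; exact: h. Qed.

Lemma closed_sqball R n (z : 'rV[R]_n) (c : R) :
  closed [set x | sqdist z x <= c].
Proof.
rewrite (_ : mkset _ = sqdist z @^-1` [set y | y <= c])//.
by apply: closed_comp => [x _|]; [exact: continuous_sqdist|exact: closed_le].
Qed.

Lemma compact_sqball R n (z : 'rV[R]_n) (c : R) :
  0 <= c -> compact [set x | sqdist z x <= c].
Proof.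
move=> c0; apply: bounded_closed_compact; last exact: closed_sqball.
exists (`|z| + Num.sqrt c); split; first exact: num_real.
move=> M hM x /=; rewrite -{1}(sqr_sqrtr c0) => /(norm_le_sqdist (sqrtr_ge0 c)) h.
apply: le_trans (ltW hM).
by rewrite -[x](subrK z) addrC (le_trans (ler_normD _ _))// lerD2l.
Qed.

Lemma gauss_gt0 R n (sg q : R) : 0 < gauss n sg q.
Proof. exact: expR_gt0. Qed.

(** The error made by localization lives where the cutoff is not constant, hence
    away from the singularity of the kernel. *)
Lemma bump_kernel_error R n (xi d1 d2 : R -> R) (a b L : R) :
  0 < a -> a < b -> 0 < L ->
  continuous d1 -> continuous d2 -> (forall s, d1 s <= 0) ->
  (forall s, s <= a \/ b <= s -> d1 s = 0 /\ d2 s = 0) ->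
  exists2 D : R, 0 <= D & forall sg q : R, 0 < sg <= L -> 0 <= q ->
    gauss n sg q * (4 * q * d2 q - 2 * q * d1 q / sg + 2 * n%:R * d1 q) <=
    (if q <= b then D else 0).
Proof.
move=> a0 ab L0 cd1 cd2 d1le d0.
have b0 : 0 < b by apply: lt_trans ab.
have N0 : 0 <= n%:R / 2 + 1 :> R by rewrite addr_ge0// divr_ge0.
have [D D0 hD] := expR_ln_bound N0 (divr_gt0 a0 (ltr0n R 4)).
have bnd (f : R -> R) : continuous f -> exists2 M : R, 0 <= M & forall s, `[a, b]%classic s -> `|f s| <= M.
  by move=> cf; apply: compact_within_bounded; [exact: segment_compact|exact: continuous_subspaceT].
have [M1 M10 hM1] := bnd _ cd1.
have [M2 M20 hM2] := bnd _ cd2.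
exists (D * (L * (4 * b * M2) + 2 * b * M1)).
  by rewrite mulr_ge0 ?(ltW D0)// addr_ge0// !mulr_ge0// ltW.
move=> sg q /andP[s0 sL] q0.
have [bq|qb] := ltP b q.
  have [-> ->] := d0 q (or_intror (ltW bq)).
  by rewrite !mulr0 mul0r subr0 addr0 mulr0.
have R0 : 0 <= D * (L * (4 * b * M2) + 2 * b * M1).
  by rewrite mulr_ge0 ?(ltW D0)// addr_ge0// !mulr_ge0// ltW.
have [qa|aq] := leP q a.
  have [-> ->] := d0 q (or_introl qa).
  by rewrite !mulr0 mul0r subr0 addr0 mulr0.
have qab : `[a, b]%classic q by rewrite /= in_itv/= qb ltW.
have h1 := hM1 q qab; have h2 := hM2 q qab.
have G : gauss n sg q / sg <= D.
  apply: le_trans (hD sg s0).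
  have -> : gauss n sg q / sg = expR (- ((n%:R / 2 + 1) * ln sg) - q / (4 * sg)).
    rewrite -{2}(lnK s0) -expRN /gauss -expRD; congr expR; ring.
  rewrite ler_expR lerD2l lerN2 -mulrA -invfM ler_pM2r ?invr_gt0 ?mulr_gt0//.
  exact: ltW.
have Gs : gauss n sg q <= D * L.
  have -> : gauss n sg q = gauss n sg q / sg * sg by rewrite mulfVK// gt_eqF.
  by rewrite ler_pM// ?(ltW s0)// divr_ge0 ?ltW// gauss_gt0.
have G0 : 0 <= gauss n sg q by rewrite ltW// gauss_gt0.
have Gs0 : 0 <= gauss n sg q / sg by rewrite divr_ge0// ltW.
have e1 : 4 * q * d2 q <= 4 * b * M2.
  apply: (le_trans (ler_norm _)); rewrite normrM ger0_norm ?mulr_ge0//.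
  by rewrite ler_pM// ?mulr_ge0// ler_pM2l.
have e2 : - (2 * q * d1 q) <= 2 * b * M1.
  apply: (le_trans (ler_norm _)); rewrite normrN normrM ger0_norm ?mulr_ge0//.
  by rewrite ler_pM// ?mulr_ge0// ler_pM2l.
have e3 : 2 * n%:R * d1 q <= 0 by rewrite mulr_ge0_le0// mulr_ge0.
have -> : gauss n sg q * (4 * q * d2 q - 2 * q * d1 q / sg + 2 * n%:R * d1 q) =
  gauss n sg q * (4 * q * d2 q) + gauss n sg q / sg * (- (2 * q * d1 q)) +
  gauss n sg q * (2 * n%:R * d1 q) by ring.
have f1 : gauss n sg q * (4 * q * d2 q) <= D * L * (4 * b * M2).
  apply: (@le_trans _ _ (gauss n sg q * (4 * b * M2))); first exact: ler_wpM2l.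
  by apply: ler_wpM2r => //; rewrite !mulr_ge0// ltW.
have f2 : gauss n sg q / sg * (- (2 * q * d1 q)) <= D * (2 * b * M1).
  apply: (@le_trans _ _ (gauss n sg q / sg * (2 * b * M1))); first exact: ler_wpM2l.
  by apply: ler_wpM2r => //; rewrite !mulr_ge0// ltW.
have f3 : gauss n sg q * (2 * n%:R * d1 q) <= 0 by rewrite mulr_ge0_le0.
lra.
Qed.

Lemma continuous_within_open (T U : topologicalType) (W : set T) (f : T -> U) (x : T) :
  open W -> W x -> {within W, continuous f} -> {for x, continuous f}.
Proof.
move=> oW Wx; rewrite (continuous_open_subspace f oW) => /(_ x).
by rewrite inE => /(_ Wx).
Qed.

Lemma cont_pairl (T U : topologicalType) (s : U) (x : T) :
  {for x, continuous (fun y : T => (y, s))}.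
Proof. by apply: cvg_pair; [exact: cvg_id|exact: cvg_cst]. Qed.

Lemma open_prod (T U : topologicalType) (A : set T) (B : set U) :
  open A -> open B -> open (A `*` B).
Proof.
rewrite !openE => oA oB [x y] [/= /oA Ax /oB By].
by exists (A, B); [split|move=> [x' y'] []].
Qed.

Lemma within_for (T U : topologicalType) (A : set T) (f : T -> U) :
  (forall x, A x -> {for x, continuous f}) -> {within A, continuous f}.
Proof. by move=> h; apply: continuous_in_subspaceT => x /set_mem /h. Qed.

Lemma bms_indicM R n (K : set 'rV[R]_n) (f : 'rV[R]_n -> R) :
  compact K -> {within K, continuous f} -> bms (fun x => \1_K x * f x).
Proof.
move=> cK cf; apply: (bms_compact cK) => [|x nK]; last by rewrite indicE memNset// mul0r.
apply: (@subspace_eq_continuous _ _ _ f) => // x xK.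
by rewrite /from_subspace/= indicE xK mul1r.
Qed.

(** The backward heat kernel makes the diffusion and the time derivative of the
    kernel cancel, so that only the localization error is left. *)
Lemma bump_mass_derivative R n (W : set 'rV[R]_n) (x0 : 'rV[R]_n)
    (u : 'rV[R]_n -> R -> R) (a b c rr D : R) (xi d1 d2 : R -> R) :
  open W -> 0 <= rr -> [set x | sqdist x0 x <= rr ^+ 2] `<=` W -> b <= c ->
  subcaloric W a b u ->
  (forall s, is_derive s (1 : R) xi (d1 s)) -> (forall s, is_derive s (1 : R) d1 (d2 s)) ->
  continuous d2 -> (forall s, 0 <= xi s) -> (forall s, rr ^+ 2 <= s -> xi s = 0) ->
  (forall sg q : R, 0 < sg <= c - a -> 0 <= q ->
    gauss n sg q * (4 * q * d2 q - 2 * q * d1 q / sg + 2 * n%:R * d1 q) <=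
    (if q <= rr ^+ 2 then D else 0)) ->
  forall s, a < s < b -> exists2 d,
    is_derive s (1 : R) (fun s => lint (fun x => bump_kernel xi x0 (c - s) x * u x s)) d &
    d <= D * lint (fun x => \1_[set x | sqdist x0 x <= rr ^+ 2] x * u x s).
Proof.
move=> oW rr0 KW bc [uC du [cu cdu] u0 usub] dxi dd1 cd2 xi0 xib hD s sab.
set K := [set x | _] in KW *.
have cK : compact K by apply: compact_sqball; exact: sqr_ge0.
have K0 sg x : ~ K x -> bump_kernel xi x0 sg x = 0.
  by move=> /negP; rewrite -ltNge => h; rewrite /bump_kernel/= xib ?mulr0// ltW.
have K0' x : ~ K x -> xi (sqdist x0 x) = 0.
  by move=> /negP; rewrite -ltNge => h; rewrite xib// ltW.
pose ps sg x := gauss n sg (sqdist x0 x) * (sqdist x0 x / (4 * sg ^+ 2) - n%:R / (2 * sg)) * xi (sqdist x0 x).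
have cs0 t : a < t < b -> 0 < c - t by move=> /andP[_ tb]; lra.
have ou : open [set` `]a, b[] by exact: itv_open.
have oQ : open (W `*` [set` `]a, b[]) by exact: open_prod.
have csq (z : 'rV[R]_n * R) : {for z, continuous (fun z : 'rV[R]_n * R => sqdist x0 z.1)}.
  by apply: (@cont_comp _ _ _ fst (sqdist x0)); [exact: cvg_fst|exact: continuous_sqdist].
have csn (z : 'rV[R]_n * R) : {for z, continuous (fun z : 'rV[R]_n * R => c - z.2)}.
  by apply: contD; [exact: contC|apply: contN; exact: cvg_snd].
have cxi (f f' : R -> R) (z : 'rV[R]_n * R) : (forall s, is_derive s (1 : R) f (f' s)) ->
    {for z, continuous (fun z : 'rV[R]_n * R => f (sqdist x0 z.1))}.
  by move=> df; apply: (@cont_comp _ _ _ (fun z : 'rV[R]_n * R => sqdist x0 z.1) f) => //; exact: is_derive_continuous.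
have cg (z : 'rV[R]_n * R) : a < z.2 < b -> {for z, continuous (fun z : 'rV[R]_n * R => gauss n (c - z.2) (sqdist x0 z.1))}.
  by move=> /cs0 h; apply: continuous_gauss.
have kC t : a < t < b -> C2on W (bump_kernel xi x0 (c - t)).
  by move=> /cs0 h; have [h1 _] := bump_kernel_C2 x0 h dxi dd1 cd2; exact: h1.
pose f' s x := bump_kernel xi x0 (c - s) x * u x s.
pose g' s x := - ps (c - s) x * u x s + bump_kernel xi x0 (c - s) x * derive1 (u x) s.
have D1 : is_derive s (1 : R) (fun s => lint (f' s)) (lint (g' s)).
  apply: (@is_derive_lint_compact _ _ K f' g' s a b cK sab).
  - move=> t tab; apply: within_for => x /KW Wx; apply: contM.
      by have [] := kC t tab x Wx.
    by have [] := uC t tab x Wx.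
  - by move=> t x _ /(K0 (c - t)) h; rewrite /f' h mul0r.
  - move=> t x tab /KW Wx.
    have h1 : is_derive t (1 : R) (fun t : R => c - t) (0 - 1) by apply: is_deriveB.
    have h2 := is_derive_chain h1 (is_derive_gauss_sg n (sqdist x0 x) (cs0 t tab)).
    have h3 := derivableP (du x t Wx tab).
    have h4 := is_deriveM h2 h3.
    have h5 := is_deriveZ (xi (sqdist x0 x)) h4.
    apply: (is_derive_cong h5).
      by move=> y; rewrite /= mulrfctE /f' /bump_kernel /GRing.scale/=; ring.
    by rewrite /GRing.scale/= -derive1E /g' /ps /bump_kernel/=; ring.
  - by move=> t x nK; rewrite /g' K0// /ps K0'// !mulr0 oppr0 !mul0r addr0.
  apply: within_for => -[x t] /= [/KW Wx]; rewrite in_itv/= => tab.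
  have Qz : (W `*` [set` `]a, b[]) (x, t) by split => //=; rewrite in_itv.
  apply: (@contD _ _ (fun z : 'rV[R]_n * R => - ps (c - z.2) z.1 * u z.1 z.2)
    (fun z : 'rV[R]_n * R => bump_kernel xi x0 (c - z.2) z.1 * derive1 (u z.1) z.2)).
    apply: (@contM _ _ (fun z : 'rV[R]_n * R => - ps (c - z.2) z.1) (fun z => u z.1 z.2)); last first.
      exact: continuous_within_open oQ Qz cu.
    apply: (@contN _ _ (fun z : 'rV[R]_n * R => ps (c - z.2) z.1)).
    apply: contM; last exact: cxi dxi.
    apply: contM; first exact: (cg (x, t)).
    apply: contD; last apply: contN; apply: contM => //; first last.
    + apply: (@cont_comp _ _ _ (fun z : 'rV[R]_n * R => 2 * (c - z.2)) (fun y : R => y^-1)).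
        by apply: contM => //; exact: contC.
      by apply: inv_continuous; rewrite gt_eqF// mulr_gt0// cs0.
    + exact: contC.
    apply: (@cont_comp _ _ _ (fun z : 'rV[R]_n * R => 4 * (c - z.2) ^+ 2) (fun y : R => y^-1)).
      by apply: contM; [exact: contC|exact: contX].
    by apply: inv_continuous; rewrite gt_eqF// mulr_gt0// exprn_gt0// cs0.
  apply: (@contM _ _ (fun z : 'rV[R]_n * R => bump_kernel xi x0 (c - z.2) z.1) (fun z => derive1 (u z.1) z.2)); last first.
    exact: continuous_within_open oQ Qz cdu.
  by apply: contM; [exact: (cg (x, t))|exact: cxi dxi].
exists (lint (g' s)); first exact: D1.
rewrite /g'.
have [b1 b2 e12] := lint_laplacian_by_parts oW cK KW (kC s sab) (uC s sab) (K0 (c - s)).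
have cps x : {for x, continuous (fun x => ps (c - s) x)}.
  rewrite /ps; apply: contM; last first.
    by apply: (@cont_comp _ _ _ (sqdist x0) xi); [exact: continuous_sqdist|exact: is_derive_continuous].
  apply: contM; first by apply: continuous_gauss; [exact: contC|exact: continuous_sqdist|exact: cs0].
  by apply: contD; [apply: contM; [exact: continuous_sqdist|exact: contC]|exact: contC].
have bps : bms (fun x => ps (c - s) x * u x s).
  apply: (bms_open cK KW) => [x Wx|x nK]; last by rewrite /ps K0'// mulr0 mul0r.
  by apply: contM; [exact: cps|have [] := uC s sab x Wx].
have bpu : bms (fun x => bump_kernel xi x0 (c - s) x * derive1 (u x) s).
  apply: (bms_open cK KW) => [x Wx|x nK]; last by rewrite K0// mul0r.
  apply: contM; first by have [] := kC s sab x Wx.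
  have Qz : (W `*` [set` `]a, b[]) (x, s) by split => //=; rewrite in_itv.
  have h := continuous_within_open oQ Qz cdu.
  apply: (@cont_comp _ _ _ (fun x : 'rV[R]_n => (x, s)) (fun z : 'rV[R]_n * R => derive1 (u z.1) z.2)) => //.
  exact: cont_pairl.
have bK : bms (fun x => \1_K x * u x s).
  by apply: bms_indicM => //; apply: within_for => x /KW Wx; have [] := uC s sab x Wx.
have bN : bms (fun x => - ps (c - s) x * u x s).
  by under eq_fun do rewrite mulNr; exact: bmsN.
rewrite lintD// -lintZ//.
apply: (@le_trans _ _ (lint (fun x => - ps (c - s) x * u x s) + lint (fun x => bump_kernel xi x0 (c - s) x * laplacian (u ^~ s) x))).
  rewrite lerD2l; apply: le_lint => // x; have [Kx|nK] := pselect (K x); last by rewrite K0// !mul0r.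
  apply: ler_wpM2l; last by apply: usub => //; exact: KW.
  by rewrite mulr_ge0// ltW// gauss_gt0.
rewrite e12 -lintD//; apply: le_lint; [exact: bmsD|exact: bmsZ|move=> x].
have [Kx|nK] := pselect (K x); last first.
  have L0 : laplacian (bump_kernel xi x0 (c - s)) x = 0.
    apply: big1 => i _.
    have p0 y : ~ K y -> partial i (bump_kernel xi x0 (c - s)) y = 0.
      by move=> nKy; have [_] := near0_partial i (near_off_compact cK (K0 (c - s)) nKy).
    by have [_] := near0_partial i (near_off_compact cK p0 nK).
  by rewrite L0 /ps K0'// indicE memNset// !(mulr0, oppr0, mul0r) addr0.
rewrite indicE mem_set// mul1r -mulrDl; apply: ler_wpM2r; first by apply: u0 => //; exact: KW.
have cs := cs0 s sab.
have [_ ->] := bump_kernel_C2 x0 cs dxi dd1 cd2.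
have csa : 0 < c - s <= c - a by rewrite cs; move: sab => /andP[h1 _]; rewrite lerD2l lerN2 ltW.
have := hD _ _ csa (sqdist_ge0 x0 x).
rewrite (_ : sqdist x0 x <= rr ^+ 2)//; apply: le_trans.
by rewrite /ps; lra.
Qed.

Lemma near_within_ball R n (f : 'rV[R]_n -> R) (x : 'rV[R]_n) (e : R) :
  {for x, continuous f} -> 0 < e ->
  exists2 d : R, 0 < d & forall y, `|y - x| < d -> `|f y - f x| < e.
Proof.
move=> cf e0; have /cvgrPdist_lt/(_ e e0) := cf.
move=> /nbhs_ballP[d /= d0 h]; exists d => // y yx.
rewrite distrC; apply: h; rewrite -ball_normE/= distrC//.
Qed.

(** Test with a localized backward heat kernel that concentrates at [(x0, t0)].
    The weighted mass is at most a multiple of [M] at time [t1], grows no faster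
    than a multiple of [G], and at time [t0] is at least a multiple of [u x0 t0 - e], because the
    kernel is then a narrow bump around [x0], of mass bounded below. The local mass
    enters through a primitive [G] of an upper bound because such primitives are
    what the applications provide; [C] depends neither on the point nor on the
    function. *)
Lemma mean_value R n (r T tau : R) :
  0 < r -> 0 < T -> 0 < tau -> exists2 C : R, 0 <= C &
  forall (u : 'rV[R]_n -> R -> R) (x0 : 'rV[R]_n) (a t1 t0 b M : R) (G dG : R -> R),
    0 <= a -> b <= T -> a < t1 -> t1 + tau <= t0 -> t0 < b ->
    subcaloric (ball x0 r) a b u ->
    (forall s, t1 <= s <= t0 -> is_derive s (1 : R) G (dG s)) ->
    (forall s, t1 <= s <= t0 ->
      lint (fun x => \1_[set x | sqdist x0 x <= (r / 2) ^+ 2] x * u x s) <= dG s) ->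
    (forall x, ball x0 r x -> u x t1 <= M) ->
    u x0 t0 <= C * (M + (G t0 - G t1)).
Proof.
move=> r0 T0 tau0.
have r20 : 0 < r / 2 by rewrite divr_gt0.
have ab : (r / 2) ^+ 2 / 2 < (r / 2) ^+ 2.
  by rewrite ltr_pdivrMr// ltr_pMr ?exprn_gt0// ltr1n.
have [xi [d1 [d2 [dxi dd1 cd2 [xi01 d1le] [xia xib dab _]]]]] := cutoff_exists ab.
have cd1 := is_derive_continuous dd1.
have a0 : 0 < (r / 2) ^+ 2 / 2 by rewrite divr_gt0// exprn_gt0.
have T1 : 0 < T + 1 by lra.
have [D D0 hD] := bump_kernel_error n xi a0 ab T1 cd1 cd2 d1le dab.
pose B := expR (- (n%:R / 2 * ln tau)) * (2 * r) ^+ n.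
have B0 : 0 <= B by rewrite mulr_ge0 ?expR_ge0// exprn_ge0// mulr_ge0// ltW.
pose A := expR (n%:R / 4) * (2 ^+ n)^-1 : R.
have A0 : 0 < A by rewrite mulr_gt0 ?expR_gt0// invr_gt0 exprn_gt0.
exists (A * (B + D)); first by rewrite mulr_ge0 ?addr_ge0// ltW.
move=> u x0 a t1 t0 b M G dG ale bT at1 t10 t0b usub HG hG uM.
have [uC du cu u0 us] := usub.
set K := [set x | _] in hG.
have KW : K `<=` ball x0 r.
  move=> x /= h; rewrite -ball_normE/= distrC.
  by apply: le_lt_trans (norm_le_sqdist (ltW r20) h) _; lra.
have oW : open (ball x0 r : set 'rV[R]_n) by exact: ball_open.
have t0ab : a < t0 < b by rewrite t0b andbT; clear - at1 t10 tau0; lra.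
have t1ab : a < t1 < b by rewrite at1/=; clear - t0b t10 tau0; lra.
have M0 : 0 <= M.
  by apply: le_trans (uM x0 (ballxx _ r0)); apply: u0 => //; exact: ballxx.
have cK : compact K by apply: compact_sqball; exact: sqr_ge0.
have bK s : a < s < b -> bms (fun x => \1_K x * u x s).
  by move=> sab; apply: bms_indicM => //; apply: within_for => x /KW Wx; have [] := uC s sab x Wx.
have mass0 s : a < s < b -> 0 <= lint (fun x => \1_K x * u x s).
  move=> sab; apply: lint_ge0 => x; have [Kx|nK] := pselect (K x); last by rewrite indicE memNset// mul0r.
  by rewrite mulr_ge0// ?indicE//; apply: u0 => //; exact: KW.
have GG : 0 <= G t0 - G t1.
  suff : - G t0 <= - G t1 by lra.
  apply: (@derive_le0_nonincreasing _ (fun s => - G s)); first by lra.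
  move=> s s01; exists (- dG s); first exact: is_deriveN (HG s s01).
  by rewrite oppr_le0; apply: le_trans (hG s s01); apply: mass0; lra.
apply/ler_addgt0Pr => e e0.
have [ue|ue] := leP (u x0 t0 - e) 0.
  rewrite -lerBlDr; apply: le_trans ue _; apply: mulr_ge0; last exact: addr_ge0.
  by apply: mulr_ge0; [exact: ltW|exact: addr_ge0].
have cu0 : {for x0, continuous (u ^~ t0)} by have [] := uC t0 t0ab x0 (ballxx _ r0).
have [d d0 hd] := near_within_ball cu0 e0.
(* [ka] is the width of the kernel at the final time: small enough for [u] to be
   almost constant, and the cutoff equal to 1, on the cube of radius [ka] *)
pose ka := Num.min (Num.min (d / 2) (r / 2)) (Num.min 1 (r / (2 * (2 * n%:R + 2)))).
have ka0 : 0 < ka.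
  by rewrite !lt_min ltr01 !divr_gt0// mulr_gt0// ltr_wpDl// mulr_ge0.
have kd : ka < d.
  by apply: (@le_lt_trans _ _ (d / 2)); [rewrite /ka !ge_min lexx|clear - d0; lra].
have k1 : ka <= 1 by rewrite /ka !ge_min lexx !orbT.
have kr : ka <= r / 2 by rewrite /ka !ge_min lexx !orbT.
have kn : n%:R * ka ^+ 2 <= (r / 2) ^+ 2 / 2.
  have h : ka <= r / (2 * (2 * n%:R + 2)) by rewrite /ka !ge_min lexx !orbT.
  have N2 : 0 < 2 * (2 * n%:R + 2) :> R by rewrite mulr_gt0// ltr_wpDl// mulr_ge0.
  have h' : 4 * n%:R * ka + 4 * ka <= r.
    by move: h; rewrite ler_pdivlMr//; apply: le_trans; clear - ka0; lra.
  have n0 : 0 <= n%:R :> R by [].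
  have h2 : (4 * n%:R * ka + 4 * ka) ^+ 2 <= r ^+ 2.
    by rewrite lerXn2r// ?nnegrE ?addr_ge0 ?mulr_ge0// ltW.
  have h3 : n%:R * ka ^+ 2 * 16 <= (4 * n%:R * ka + 4 * ka) ^+ 2.
    have -> : (4 * n%:R * ka + 4 * ka) ^+ 2 = 16 * ka ^+ 2 * (n%:R ^+ 2 + n%:R + 1) + n%:R * ka ^+ 2 * 16 by ring.
    rewrite lerDr; apply: mulr_ge0; first by apply: mulr_ge0 => //; exact: sqr_ge0.
    by apply: addr_ge0 => //; apply: addr_ge0 => //; exact: sqr_ge0.
  by rewrite expr_div_n; have := sqr_ge0 r; clear - h2 h3; lra.
pose c := t0 + ka ^+ 2.
pose b' := Num.min b c.
have ka20 : 0 < ka ^+ 2 by rewrite exprn_gt0.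
have b'c : b' <= c by rewrite ge_min lexx orbT.
have b'b : b' <= b by rewrite ge_min lexx.
have t0b' : t0 < b' by rewrite lt_min t0b /c ltrDl.
have sub' : subcaloric (ball x0 r) a b' u.
  have s1 t : a < t < b' -> a < t < b by move=> /andP[-> h]; exact: lt_le_trans h b'b.
  split.
  - by move=> t /s1; exact: uC.
  - by move=> x t Wx /s1; exact: du.
  - by split; apply: continuous_subspaceW (proj1 cu) + apply: continuous_subspaceW (proj2 cu);
      move=> -[x t] [/= Wx]; rewrite !in_itv/= => /s1.
  - by move=> x t Wx /s1; exact: u0.
  - by move=> x t Wx /s1; exact: us.
have ka21 : ka ^+ 2 <= 1 by rewrite exprn_ile1// ltW.
have hD' sg q : 0 < sg <= c - a -> 0 <= q ->
    gauss n sg q * (4 * q * d2 q - 2 * q * d1 q / sg + 2 * n%:R * d1 q) <=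
    (if q <= (r / 2) ^+ 2 then D else 0).
  move=> /andP[h1 h2] q0; apply: hD => //; rewrite h1/=; apply: le_trans h2 _.
  by rewrite /c; clear - ka21 t0b bT ale; lra.
have xi0 s : 0 <= xi s by have /andP[] := xi01 s.
have xi1 s : xi s <= 1 by have /andP[] := xi01 s.
have mass' := bump_mass_derivative oW (ltW r20) KW b'c sub' dxi dd1 cd2 xi0 xib hD'.
pose N s := lint (fun x => bump_kernel xi x0 (c - s) x * u x s).
have t10' : t1 <= t0 by clear - t10 tau0; lra.
have decr : N t0 - D * G t0 <= N t1 - D * G t1.
  pose h s := N s - D * G s.
  have dh s : t1 <= s <= t0 -> exists2 d, is_derive s (1 : R) h d & d <= 0.
    move=> s01; have sab : a < s < b' by move: s01 => /andP[h1 h2]; rewrite (lt_le_trans at1 h1) (le_lt_trans h2 t0b').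
    have [e1 He1 e1le] := mass' s sab.
    exists (e1 - D * dG s); last by rewrite subr_le0; apply: le_trans e1le _; rewrite ler_wpM2l// hG.
    have h2 := is_deriveB He1 (is_deriveZ D (HG s s01)).
    exact: (is_derive_cong h2).
  exact: (derive_le0_nonincreasing t10' dh).
have ct1 : 0 < c - t1 by rewrite /c; clear - t10' ka20; lra.
have bN t : a < t < b' -> bms (fun x => bump_kernel xi x0 (c - t) x * u x t).
  move=> tab; have [uC' _ _ _ _] := sub'.
  have ct : 0 < c - t by move: tab => /andP[_ h]; rewrite subr_gt0 (lt_le_trans h).
  apply: (bms_open cK KW) => [x Wx|x]; last first.
    by move=> /negP; rewrite -ltNge => h; rewrite /bump_kernel/= (xib _ (ltW h)) mulr0 mul0r.
  have [kC _] := bump_kernel_C2 x0 ct dxi dd1 cd2.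
  by apply: contM; [have [] := kC setT x I|have [] := uC' t tab x Wx].
have N1 : N t1 <= B * M.
  have -> : B * M = lint (fun x => expR (- (n%:R / 2 * ln tau)) * M * cube_indic x0 r x).
    rewrite lintZ ?lint_cube_indic ?(ltW r0)//; [by rewrite /B; ring|exact: bms_cube_indic].
  apply: le_lint => [||x].
  - by apply: bN; rewrite at1 (le_lt_trans t10').
  - exact/bmsZ/bms_cube_indic.
  have eM : 0 <= expR (- (n%:R / 2 * ln tau)) * M by rewrite mulr_ge0// expR_ge0.
  have [Kx|/negP] := pselect (K x); last first.
    rewrite -ltNge => h; rewrite /bump_kernel/= (xib _ (ltW h)) mulr0 mul0r.
    by rewrite mulr_ge0// /cube_indic indicE.
  have Wx := KW x Kx.
  rewrite /cube_indic indicE mem_set/=; last first.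
    by move: Wx; rewrite -ball_normE/= distrC => /ltW.
  rewrite mulr1; apply: ler_pM; [|exact: u0| |exact: uM].
    by rewrite mulr_ge0// ltW// gauss_gt0.
  rewrite -[leRHS]mulr1; apply: ler_pM => //; first by rewrite ltW// gauss_gt0.
  rewrite ler_expR lerBlDr -[leLHS]addr0 lerD//.
    rewrite lerN2 ler_wpM2l ?divr_ge0// ler_ln ?posrE//; rewrite /c; clear - t10 ka20; lra.
  by rewrite divr_ge0 ?sqdist_ge0// mulr_ge0// ltW.
have N0 : A^-1 * (u x0 t0 - e) <= N t0.
  have -> : A^-1 * (u x0 t0 - e) = lint (fun x => (u x0 t0 - e) * (expR (- (n%:R / 4)) * ka ^- n) * cube_indic x0 ka x).
    rewrite lintZ ?lint_cube_indic ?(ltW ka0)//; last exact: bms_cube_indic.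
    rewrite /A invfM invrK expRN exprMn mulrC -!mulrA; congr (_ * (_ * _)).
    by rewrite mulrCA mulVf ?mulr1// expf_neq0// gt_eqF.
  apply: le_lint => [||x]; [exact/bmsZ/bms_cube_indic|by apply: bN; rewrite t0b' andbT (lt_le_trans at1 t10')|].
  have kv : 0 <= (u x0 t0 - e) * (expR (- (n%:R / 4)) * ka ^- n).
    by rewrite mulr_ge0 ?mulr_ge0 ?expR_ge0 ?invr_ge0 ?exprn_ge0// ltW.
  rewrite /cube_indic indicE; case: (boolP (_ \in _)) => [/set_mem/= xk|_]; last first.
    rewrite mulr0; have [Kx|/negP] := pselect (K x).
      by rewrite mulr_ge0// ?u0 ?mulr_ge0 ?(ltW (gauss_gt0 _ _ _))//; exact: KW.
    by rewrite -ltNge => h; rewrite /bump_kernel/= (xib _ (ltW h)) mulr0 mul0r.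
  have qx : sqdist x0 x <= n%:R * ka ^+ 2 := sqdist_le_norm (ltW ka0) xk.
  rewrite mulr1 /bump_kernel/= xia ?mulr1; last by apply: le_trans kn.
  have ux : u x0 t0 - e <= u x t0.
    by have := hd x (le_lt_trans xk kd); rewrite ltr_distl => /andP[/ltW].
  rewrite mulrC; apply: ler_pM => //; [|exact: ltW|].
    by rewrite mulr_ge0 ?expR_ge0 ?invr_ge0 ?exprn_ge0// ltW.
  have -> : ka ^- n = expR (- (n%:R * ln ka)) by rewrite expRN expRM_natl lnK.
  rewrite /c addrAC subrr add0r /gauss -expRD ler_expR lnXn//.
  have h : sqdist x0 x / (4 * ka ^+ 2) <= n%:R / 4.
    by rewrite ler_pdivrMr ?mulr_gt0//; clear - qx; lra.
  have -> : n%:R / 2 * (ln ka *+ 2) = n%:R * ln ka :> R by rewrite -mulr_natr; field.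
  clear - h; lra.
have fin : A^-1 * (u x0 t0 - e) <= (B + D) * (M + (G t0 - G t1)).
  have h1 : 0 <= B * (G t0 - G t1) by exact: mulr_ge0.
  have h2 : 0 <= D * M by exact: mulr_ge0.
  apply: (le_trans N0); clear - N1 decr h1 h2; lra.
by rewrite -lerBlDr -mulrA -ler_pdivrMl.
Qed.

(** * Powers and superlinear differential inequalities *)

Lemma powR_young R (p l e : R) : 0 < p -> p < l -> 0 < e ->
  exists2 K : R, 0 <= K & forall s : R, 0 <= s -> s `^ p <= e * s `^ l + K.
Proof.
move=> p0 pl e0; pose M := (e^-1) `^ (l - p)^-1.
have lp : 0 < l - p by rewrite subr_gt0.
have M0 : 0 < M by rewrite powR_gt0// invr_gt0.
exists (M `^ p); first exact: powR_ge0.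
move=> s s0; have [sM|Ms] := leP s M.
  have : s `^ p <= M `^ p by apply: ge0_ler_powR; rewrite ?nnegrE// ltW.
  have : 0 <= e * s `^ l by rewrite mulr_ge0 ?powR_ge0// ltW.
  lra.
have s00 : 0 < s by exact: lt_trans Ms.
have h1 : e^-1 <= s `^ (l - p).
  have <- : M `^ (l - p) = e^-1 by rewrite /M -powRrM mulVf ?gt_eqF// powRr1// invr_ge0 ltW.
  by apply: ge0_ler_powR; rewrite ?nnegrE ltW.
have h2 : s `^ l = s `^ p * s `^ (l - p).
  by rewrite -powRD ?(gt_eqF s00) ?implybT// addrC subrK.
have h3 : s `^ p <= e * s `^ l.
  rewrite h2 mulrCA ler_peMr ?powR_ge0//.
  have e1 : e * e^-1 = 1 by rewrite mulfV// gt_eqF.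
  by rewrite -e1 ler_pM2l.
have := powR_ge0 M p; lra.
Qed.

(** Either [s <= lam], or (s / lam)^(l - 1) exceeds 1. *)
Lemma le_lambda_powR R (l lam s : R) : 1 < l -> 0 < lam -> 0 <= s ->
  s <= lam `^ (1 - l) * s `^ l + lam.
Proof.
move=> l1 lam0 s0; have [sl|ls] := leP s lam.
  have : 0 <= lam `^ (1 - l) * s `^ l by rewrite mulr_ge0 ?powR_ge0.
  lra.
have s00 : 0 < s by exact: lt_trans ls.
have h : 1 <= lam `^ (1 - l) * s `^ (l - 1).
  have -> : lam `^ (1 - l) = (lam `^ (l - 1))^-1 by rewrite -powRN opprB.
  rewrite mulrC ler_pdivlMr ?powR_gt0// mul1r.
  by apply: ge0_ler_powR; rewrite ?nnegrE ?subr_ge0; exact: ltW.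
have e : s `^ l = s `^ (l - 1) * s by rewrite mulrC mulr_powRB1//; lra.
rewrite e mulrA; apply: (@le_trans _ _ (lam `^ (1 - l) * s `^ (l - 1) * s)); first by rewrite ler_peMl.
by rewrite lerDl ltW.
Qed.

(** The positive function (y + 1)^(1 - l) decreases at a definite rate, up to an
    exponential factor that absorbs [K]; so it is at least a multiple of the time
    [b - a] that is left to it. *)
Lemma superlinear_bound R (l c K L : R) :
  1 < l -> 0 < c -> 0 <= K -> 0 < L -> exists2 A : R, 0 <= A &
  forall (a b : R) (y dy : R -> R), a < b -> b - a <= L ->
    (forall s, a <= s <= b -> [/\ 0 <= y s, is_derive s (1 : R) y (dy s) &
       c * y s `^ l - K <= dy s]) ->
    y a <= A * (b - a) `^ (- (l - 1)^-1).
Proof.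
move=> l1 c0 K0 L0.
have l0 : 0 < l by lra.
have l10 : 0 < l - 1 by lra.
pose al := (l - 1) * (c * 2 `^ (- l)); pose be := (l - 1) * (c + K).
have al0 : 0 < al by rewrite !mulr_gt0// powR_gt0.
have be0 : 0 <= be by apply: mulr_ge0; [exact: ltW|apply: addr_ge0 => //; exact: ltW].
pose ka := al * expR (- be * L).
have ka0 : 0 < ka by rewrite mulr_gt0 ?expR_gt0.
exists (ka `^ (- (l - 1)^-1)); first exact: powR_ge0.
move=> a b y dy ab bL hy.
pose w s := (y s + 1) `^ (1 - l).
pose v s := w s * expR (- be * (s - a)) + ka * (s - a).
have dv s : a <= s <= b -> exists2 d : R, is_derive s (1 : R) v d & d <= 0.
  move=> sab; have [y0 Dy dyge] := hy s sab.
  have y1 : 0 < y s + 1 by lra.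
  have h1 : is_derive s (1 : R) (fun s => y s + 1) (dy s + 0) by apply: is_deriveD.
  have h2 : is_derive s (1 : R) w ((1 - l) * (y s + 1) `^ (- l) * dy s).
    apply: (is_derive_cong (is_derive_chain h1 (is_derive1_powR (1 - l) y1))) => //.
    by rewrite addr0; congr (_ * _ `^ _ * _); lra.
  have h3 : is_derive s (1 : R) (fun s : R => - be * (s - a)) (- be).
    have h : is_derive s (1 : R) (fun s : R => (- be) *: (s - a)) ((- be) *: (1 - 0)).
      by apply: is_deriveZ; apply: is_deriveB.
    by apply: (is_derive_cong h) => //; rewrite /GRing.scale/= subr0 mulr1.
  have h4 := is_derive_expR_comp h3.
  have h5 : is_derive s (1 : R) (fun s : R => ka * (s - a)) ka.
    have h : is_derive s (1 : R) (fun s : R => ka *: (s - a)) (ka *: (1 - 0)).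
      by apply: is_deriveZ; apply: is_deriveB.
    by apply: (is_derive_cong h) => //; rewrite /GRing.scale/= subr0 mulr1.
  have h6 := is_deriveD (is_deriveM h2 h4) h5.
  exists (expR (- be * (s - a)) * ((1 - l) * (y s + 1) `^ (- l) * dy s - be * w s) + ka).
    apply: (is_derive_cong h6) => //.
    by rewrite /GRing.scale/=; ring.
  have kE : ka <= al * expR (- be * (s - a)).
    rewrite ler_pM2l// ler_expR ler_wnM2l// ?oppr_le0//; move: sab => /andP[_ sb]; lra.
  have E0 : 0 < expR (- be * (s - a)) by exact: expR_gt0.
  suff : (1 - l) * (y s + 1) `^ (- l) * dy s - be * w s <= - al.
    rewrite -(ler_pM2l E0) => h; have := lerD h kE; lra.
  set z := (y s + 1) `^ (- l).
  have z0 : 0 < z by rewrite powR_gt0.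
  have zw : z <= w s.
    by apply: ler_powR; lra.
  have yl : 2 `^ (- l) * z^-1 <= y s `^ l + 1.
    rewrite /z !powRN invrK mulrC ler_pdivrMr ?powR_gt0//.
    have [ys|ys] := leP (y s) 1.
      apply: (@le_trans _ _ (2 `^ l)); first by apply: ge0_ler_powR; rewrite ?nnegrE; clear - l0 y0 ys; lra.
      by rewrite ler_peMl ?powR_ge0// lerDr powR_ge0.
    apply: (@le_trans _ _ ((y s * 2) `^ l)); first by apply: ge0_ler_powR; rewrite ?nnegrE; clear - l0 y0 ys; lra.
    rewrite powRM//; apply: ler_wpM2r; first exact: powR_ge0.
    by rewrite lerDl.
  have g1 : c * (2 `^ (- l) * z^-1) <= c * (y s `^ l + 1) by rewrite ler_pM2l.
  have g2 : c * (2 `^ (- l) * z^-1) - (c + K) <= dy s by lra.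
  have g3 : (l - 1) * z * (c * (2 `^ (- l) * z^-1) - (c + K)) <= (l - 1) * z * dy s.
    by apply: ler_wpM2l => //; rewrite mulr_ge0// ltW.
  have e3 : (l - 1) * z * (c * (2 `^ (- l) * z^-1) - (c + K)) = al - be * z.
    by rewrite /al /be; field; rewrite gt_eqF.
  rewrite e3 in g3.
  have g4 : be * z <= be * w s by rewrite ler_wpM2l.
  lra.
have := derive_le0_nonincreasing (ltW ab) dv.
rewrite {2}/v subrr !mulr0 expR0 mulr1 addr0 => vba.
have wa : ka * (b - a) <= w a.
  apply: le_trans vba; rewrite /v lerDr mulr_ge0 ?expR_ge0// powR_ge0//.
have [ya _ _] : [/\ 0 <= y a, is_derive a (1 : R) y (dy a) & c * y a `^ l - K <= dy a].
  by apply: hy; rewrite lexx ltW.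
have ba0 : 0 < ka * (b - a) by rewrite mulr_gt0// subr_gt0.
have -> : ka `^ (- (l - 1)^-1) * (b - a) `^ (- (l - 1)^-1) = (ka * (b - a)) `^ (- (l - 1)^-1).
  by rewrite powRM// ?ltW// subr_gt0.
apply: (@le_trans _ _ (y a + 1)); first by lra.
have -> : y a + 1 = (w a) `^ (- (l - 1)^-1).
  rewrite /w -powRrM (_ : (1 - l) * - (l - 1)^-1 = 1); first by rewrite powRr1//; lra.
  by field; rewrite gt_eqF.
have wa0 : 0 < w a by exact: lt_le_trans wa.
rewrite !powRN lef_pV2 ?posrE ?powR_gt0//; last by lra.
apply: ge0_ler_powR => //; rewrite ?nnegrE ?invr_ge0; [exact: ltW|exact: ltW|].
by apply: le_trans wa; exact: ltW.
Qed.

Lemma bms_powR R n (f : 'rV[R]_n -> R) (l : R) :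
  0 < l -> (forall x, 0 <= f x) -> bms f -> bms (fun x => f x `^ l).
Proof.
move=> l0 f0 [mf [M [r hM]]]; split.
  have := measurableT_comp (measurable_powR l) mf; exact.
exists (M `^ l), r => x; have [h1 h2] := hM x; split.
  rewrite ger0_norm ?powR_ge0//; apply: ge0_ler_powR; rewrite ?nnegrE ?(ltW l0)//.
    exact: le_trans h1.
  by rewrite -(ger0_norm (f0 x)).
by move=> /h2 ->; rewrite powR0// gt_eqF.
Qed.

(** * Directional derivatives and gradients on a zero set *)

(** By [MVT_coord] the increment of [f] is a combination of partial derivatives at
    nearby points. *)
Lemma C1_is_derive R n (f : 'rV[R]_n -> R) (x v : 'rV[R]_n) (r : R) :
  0 < r -> (forall i y, `|y - x| < r -> has_partial i f y) ->
  (forall i, {for x, continuous (partial i f)}) ->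
  is_derive x v f (\sum_(i < n) v 0 i * partial i f x).
Proof.
move=> r0 df cf.
set S := \sum_(i < n) _.
suff h : (fun h : R => h^-1 *: ((f \o shift x) (h *: v) - f x)) @ 0^' --> S.
  apply: DeriveDef; first by apply/cvg_ex; exists S.
  exact/cvg_lim.
apply/cvgrPdist_le => e e0.
pose V := \sum_(i < n) `|v 0 i|.
have V0 : 0 <= V by apply: sumr_ge0.
have V1 : 0 < V + 1 by lra.
have eV : 0 < e / (V + 1) by rewrite divr_gt0.
have /choice[d hd] : forall i, exists d : R, 0 < d /\ forall y, `|y - x| < d -> `|partial i f y - partial i f x| < e / (V + 1).
  by move=> i; have [d d0 hd] := near_within_ball (cf i) eV; exists d.
pose d1 := \big[Num.min/r]_(i < n) d i.
have d10 : 0 < d1.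
  by apply: lt_bigmin => // i _; have [] := hd i.
have d1r : d1 <= r by exact: bigmin_le_id.
have d1i i : d1 <= d i by exact: bigmin_le_cond.
near=> h.
have h0 : h != 0 by near: h; exact: nbhs_dnbhs_neq.
have hv : `|h *: v| < d1.
  rewrite normrZ; have : `|h| < d1 / (`|v| + 1).
    by near: h; apply: dnbhs0_lt; rewrite divr_gt0// ltr_wpDl.
  rewrite ltr_pdivlMr ?ltr_wpDl//; apply: le_lt_trans; rewrite ler_wpM2l//; lra.
have [|xi [hxi e1]] := @MVT_coord R n f x (h *: v).
  by move=> i y yx; apply: df; apply: le_lt_trans yx (lt_le_trans hv d1r).
rewrite /= [h *: v + x]addrC e1.
have -> : h^-1 *: (\sum_(i < n) (h *: v) 0 i * partial i f (xi i)) = \sum_(i < n) v 0 i * partial i f (xi i).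
  rewrite scaler_sumr; apply: eq_bigr => i _; rewrite mxE /GRing.scale/= !mulrA mulVf//.
  by rewrite mul1r.
rewrite /S -sumrB.
apply: (@le_trans _ _ (\sum_(i < n) `|v 0 i| * (e / (V + 1)))).
  apply: (le_trans (ler_norm_sum _ _ _)); apply: ler_sum => i _.
  rewrite -mulrBr normrM ler_wpM2l// distrC ltW//.
  by have [_] := hd i; apply; apply: le_lt_trans (hxi i) (lt_le_trans hv (d1i i)).
rewrite -mulr_suml -/V mulrA ler_pdivrMr// mulrC ler_pM2l//; lra.
Unshelve. all: by end_near. Qed.

Lemma is_derive_gt0_near R (V : normedModType R) (f : V -> R) (x v : V) (s : R) :
  is_derive x v f s -> 0 < s -> exists2 h0 : R, 0 < h0 & forall h : R, 0 < h < h0 -> f x < f (x + h *: v).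
Proof.
move=> [df <-] s0.
have := df; rewrite /derivable => /cvgrPdist_lt/(_ _ s0)/nbhs_ballP[h0 /= h00 hh].
exists h0 => // h /andP[hp hlt].
have := hh h; rewrite /ball/= sub0r normrN gtr0_norm// => /(_ hlt).
rewrite gt_eqF// => /(_ isT).
rewrite -/('D_v f x) ltr_distlC subrr => /andP[h1 _].
move: h1; rewrite pmulr_rgt0 ?invr_gt0// subr_gt0/= addrC//.
Qed.

Lemma is_derive_lt0_near R (V : normedModType R) (f : V -> R) (x v : V) (s : R) :
  is_derive x v f s -> s < 0 -> exists2 h0 : R, 0 < h0 & forall h : R, 0 < h < h0 -> f (x + h *: v) < f x.
Proof.
move=> df s0; have h1 := is_deriveN df.
have [|h0 h00 hh] := is_derive_gt0_near h1; first by rewrite oppr_gt0.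
by exists h0 => // h /hh; rewrite ltrN2.
Qed.

Definition dot R n (v w : 'rV[R]_n) : R := \sum_(i < n) v 0 i * w 0 i.

Lemma dotC R n (v w : 'rV[R]_n) : dot v w = dot w v.
Proof. by apply: eq_bigr => i _; rewrite mulrC. Qed.

Lemma dotDl R n (u v w : 'rV[R]_n) : dot (u + v) w = dot u w + dot v w.
Proof. by rewrite -big_split; apply: eq_bigr => i _; rewrite mxE mulrDl. Qed.

Lemma dotZl R n (k : R) (v w : 'rV[R]_n) : dot (k *: v) w = k * dot v w.
Proof. by rewrite mulr_sumr; apply: eq_bigr => i _; rewrite mxE mulrA. Qed.

Lemma dot_ge0 R n (v : 'rV[R]_n) : 0 <= dot v v.
Proof. by apply: sumr_ge0 => i _; rewrite -expr2 sqr_ge0. Qed.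

Lemma dot_eq0 R n (v : 'rV[R]_n) : dot v v = 0 -> v = 0.
Proof.
move=> /eqP; rewrite psumr_eq0 => [/allP h|i _]; last by rewrite -expr2 sqr_ge0.
apply/rowP => i; have := h i (mem_index_enum i); rewrite mulf_eq0 orbb mxE.
by move/eqP.
Qed.

Lemma enorm_dot R n (v : 'rV[R]_n) : enorm v = Num.sqrt (dot v v).
Proof. by rewrite /enorm; congr Num.sqrt; apply: eq_bigr => i _; rewrite expr2. Qed.

(** The component [w] of [a] orthogonal to [b] vanishes: [w] can be tilted into the
    open half-space of [b] by an arbitrarily small multiple of [b]. *)
Lemma half_space_parallel R n (a b : 'rV[R]_n) :
  a <> 0 -> b <> 0 -> (forall v, dot v b < 0 -> dot v a <= 0) ->
  exists2 lam : R, 0 < lam & a = lam *: b.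
Proof.
move=> a0 b0 hv.
have bb : 0 < dot b b by rewrite lt_neqAle dot_ge0 andbT eq_sym; apply/eqP => /dot_eq0.
pose lam := dot a b / dot b b.
have [w wE] : exists w, w = a + (- lam) *: b by exists (a + (- lam) *: b).
have wb : dot w b = 0 by rewrite wE dotDl dotZl /lam mulNr mulfVK ?subrr// gt_eqF.
have wa s : 0 < s -> dot w a <= s * dot a b.
  move=> s0; have := hv (w + (- s) *: b); rewrite !dotDl !dotZl wb add0r mulNr oppr_lt0.
  by rewrite mulr_gt0// => /(_ isT); rewrite (dotC b a); lra.
have wa0 : dot w a <= 0.
  have [ab|ab] := leP (dot a b) 0.
    by have := wa 1 ltr01; lra.
  apply/ler_addgt0Pr => e e0; have := wa (e / dot a b); rewrite divr_gt0// => /(_ isT).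
  by rewrite mulfVK ?gt_eqF// add0r.
have aw : a = w + lam *: b by rewrite wE scaleNr subrK.
have ww : dot w w = dot w a.
  by rewrite [in RHS]aw (dotC w (_ + _)) dotDl dotZl (dotC b) wb mulr0 addr0.
have w0 : w = 0 by apply: dot_eq0; apply/eqP; rewrite eq_le dot_ge0 andbT ww.
have al : a = lam *: b by rewrite {1}aw w0 add0r.
have lam0 : 0 <= lam.
  have := hv ((-1) *: b); rewrite !dotZl !mulN1r oppr_lt0 => /(_ bb).
  by rewrite oppr_le0 (dotC b a) => ab; rewrite divr_ge0// ltW.
exists lam => //; rewrite lt_neqAle lam0 andbT eq_sym; apply/eqP => l0.
by apply: a0; rewrite al l0 scale0r.
Qed.

Lemma C1_dot R n (f : 'rV[R]_n -> R) (x v : 'rV[R]_n) (r : R) :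
  0 < r -> (forall i y, `|y - x| < r -> has_partial i f y) ->
  (forall i, {for x, continuous (partial i f)}) ->
  is_derive x v f (dot v (grad f x)).
Proof.
move=> r0 df cf; apply: (is_derive_eq (C1_is_derive v r0 df cf)).
by apply: eq_bigr => i _; rewrite mxE.
Qed.

(** A direction in which [g] decreases cannot be one in which [f] increases, so the
    two half-spaces of decrease are nested. This is why the unit normal does not
    depend on the defining function. *)
Lemma grad_parallel R n (f g : 'rV[R]_n -> R) (x : 'rV[R]_n) (r : R) :
  0 < r ->
  (forall i y, `|y - x| < r -> has_partial i f y) -> (forall i, {for x, continuous (partial i f)}) ->
  (forall i y, `|y - x| < r -> has_partial i g y) -> (forall i, {for x, continuous (partial i g)}) ->
  f x = 0 -> g x = 0 -> (forall y, `|y - x| < r -> g y < 0 -> f y < 0) ->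
  grad f x <> 0 -> grad g x <> 0 ->
  exists2 lam : R, 0 < lam & grad f x = lam *: grad g x.
Proof.
move=> r0 df cf dg cg fx gx gf f0 g0; apply: half_space_parallel => // v vg.
rewrite leNgt; apply/negP => vf.
have [h1 h10 H1] := is_derive_gt0_near (C1_dot v r0 df cf) vf.
have [h2 h20 H2] := is_derive_lt0_near (C1_dot v r0 dg cg) vg.
pose h := Num.min (Num.min (h1 / 2) (h2 / 2)) (r / (2 * (`|v| + 1))).
have v1 : 0 < 2 * (`|v| + 1) by rewrite mulr_gt0// ltr_wpDl.
have h0 : 0 < h by rewrite !lt_min !divr_gt0.
have hh1 : h < h1 by rewrite /h !gt_min; apply/orP; left; apply/orP; left; lra.
have hh2 : h < h2 by rewrite /h !gt_min; apply/orP; left; apply/orP; right; lra.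
have hr : `|x + h *: v - x| < r.
  rewrite addrAC subrr add0r normrZ gtr0_norm//.
  have : h <= r / (2 * (`|v| + 1)) by rewrite /h ge_min lexx orbT.
  rewrite ler_pdivlMr//; have : 0 <= h * `|v| by rewrite mulr_ge0// ltW.
  lra.
have := H1 h; rewrite h0 hh1 fx => /(_ isT).
have := H2 h; rewrite h0 hh2 gx => /(_ isT) /(gf _ hr); lra.
Qed.

(** * Charts at a boundary point and the normal derivative *)

(** Otherwise the set would be closed as well, and would contain a whole line. *)
Lemma boundary_nonempty R n (D : set 'rV[R]_n.+1) :
  open D -> bounded_set D -> D !=set0 -> exists x, boundary D x.
Proof.
move=> oD [M [_ bD]] [x Dx]; apply: contrapT => nb.
have cD : closure D `<=` D.
  move=> y cy; apply: contrapT => nDy; apply: nb; exists y; split => //.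
  by move/interior_subset.
pose L (s : R) : 'rV[R]_n.+1 := x + s *: const_mx 1.
have cL : continuous L.
  move=> s; apply: (@continuousD R _ _ (fun=> x) (fun s : R => s *: const_mx 1)).
    exact: cst_continuous.
  exact: scalel_continuous.
have : L @^-1` D = [set: R].
  have /(_ (L @^-1` D)) := (connected_intervalP [set: R]).2 (fun _ _ _ _ _ _ => I).
  apply.
  - by exists 0; rewrite /= /L scale0r addr0.
  - by exists (L @^-1` D); [exact: open_comp|rewrite setTI].
  - exists (L @^-1` closure D); first by apply: closed_comp => [s _|]; [exact: cL|exact: closed_closure].
    by rewrite setTI; apply/seteqP; split => s /=; [exact: subset_closure|exact: cD].
move=> LD.
pose s := `|M| + 1 + `|x| + 1.
have Ds : D (L s) by have : [set: R] s by []; rewrite -LD.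
have := bD (`|M| + 1); rewrite ltr_pwDr ?ler_norm// => /(_ isT _ Ds)/=.
rewrite leNgt => /negP; apply.
have n1 : `|const_mx 1 : 'rV[R]_n.+1| = 1.
  apply/eqP; rewrite eq_le; apply/andP; split.
    by apply/rV_norm_le => // i; rewrite mxE normr1.
  have := lexx `|const_mx 1 : 'rV[R]_n.+1|.
  by move/(rV_norm_le _ (normr_ge0 _)) => /(_ ord0); rewrite mxE normr1.
have s0 : 0 <= s by rewrite /s !addr_ge0.
have : `|s *: const_mx 1 : 'rV[R]_n.+1| <= `|L s| + `|x|.
  by rewrite -[X in `|X|](addrK x) [s *: _ + x]addrC; exact: ler_normB.
rewrite normrZ n1 mulr1 ger0_norm// /s; lra.
Qed.

(** What remains of a defining function after normalizing its gradient at the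
    centre: [e] stands for the outward unit normal there. *)
Definition chart R n (D : set 'rV[R]_n) (nu : 'rV[R]_n -> 'rV[R]_n)
    (z e : 'rV[R]_n) (r eps : R) (rho : 'rV[R]_n -> R) : Prop :=
  [/\ forall x, `|x - z| < r -> {for x, continuous rho} /\ forall i,
        [/\ has_partial i rho x, {for x, continuous (partial i rho)} &
            `|partial i rho x - e 0 i| <= eps],
      forall x, `|x - z| < r -> (D x <-> rho x < 0) /\ (boundary D x <-> rho x = 0) &
      forall x, `|x - z| < r -> boundary D x ->
        exists2 lam : R, 2^-1 <= lam & forall i, partial i rho x = lam * nu x 0 i].

Lemma partialZ R n (f : 'rV[R]_n -> R) (k : R) (i : 'I_n) (x : 'rV[R]_n) :
  has_partial i f x -> is_derive x (delta_mx 0 i : 'rV[R]_n) (fun y => k * f y) (k * partial i f x).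
Proof.
move=> df; exact: (is_deriveZ k (derivableP df)).
Qed.

Lemma enorm_gt0 R n (v : 'rV[R]_n) : v <> 0 -> 0 < enorm v.
Proof.
move=> v0; rewrite enorm_dot sqrtr_gt0 lt_neqAle dot_ge0 andbT eq_sym.
by apply/eqP => /dot_eq0.
Qed.

Lemma enorm_sq R n (v : 'rV[R]_n) : enorm v ^+ 2 = dot v v.
Proof. by rewrite enorm_dot sqr_sqrtr// dot_ge0. Qed.

Lemma dot_unit R n (v : 'rV[R]_n) : v <> 0 ->
  dot ((enorm v)^-1 *: v) ((enorm v)^-1 *: v) = 1.
Proof.
move=> v0; rewrite dotZl dotC dotZl -enorm_sq expr2.
by have := enorm_gt0 v0 => h; field; rewrite gt_eqF.
Qed.

Lemma dot_le1 R n (v w : 'rV[R]_n) : dot v v = 1 -> dot w w = 1 -> dot v w <= 1.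
Proof.
move=> v1 w1; have : 0 <= dot (v + (-1) *: w) (v + (-1) *: w) by exact: dot_ge0.
rewrite dotDl dotZl (dotC v (_ + _)) (dotC w (_ + _)) !dotDl !dotZl v1 w1 (dotC w v); lra.
Qed.

Lemma unit_coord_le1 R n (e : 'rV[R]_n) (i : 'I_n) :
  dot e e = 1 -> `|e 0 i| <= 1.
Proof.
move=> e1; rewrite -(@ler_pXn2r _ 2)// ?nnegrE// expr1n real_normK ?num_real//.
rewrite -e1 /dot (bigD1 i)//= -expr2 lerDl sumr_ge0// => j _.
by rewrite -expr2 sqr_ge0.
Qed.

Lemma smooth_on_C1 R n (U : set 'rV[R]_n) (f : 'rV[R]_n -> R) (x : 'rV[R]_n) :
  smooth_on U f -> U x -> {for x, continuous f} /\ forall i,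
    has_partial i f x /\ {for x, continuous (partial i f)}.
Proof.
move=> sf Ux; have [h1 h2] := sf [::] x Ux; split => // i; split; first exact: h2.
by have [] := sf [:: i] x Ux.
Qed.

Lemma open_norm_ball R n (U : set 'rV[R]_n) (x : 'rV[R]_n) :
  open U -> U x -> exists2 r : R, 0 < r & forall y, `|y - x| < r -> U y.
Proof.
rewrite openE => oU /oU /nbhs_ballP[r /= r0 h]; exists r => // y yx; apply: h.
by rewrite -ball_normE/= distrC.
Qed.

(** A defining function at [z], divided by the length of its gradient at [z]. At a
    nearby boundary point [nu] may come from another defining function;
    [grad_parallel] compares the two, and [lam] is at least 1/2 because the gradient
    of [rho] stays close to the unit vector [e]. *)
Lemma chart_exists R n (D : set 'rV[R]_n) (nu : 'rV[R]_n -> 'rV[R]_n)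
    (z : 'rV[R]_n) (eps : R) :
  outward_unit_normal D nu -> smooth_boundary D -> boundary D z -> 0 < eps -> n%:R * eps <= 2^-1 ->
  exists e r rho, [/\ 0 < r, dot e e = 1 & chart D nu z e r eps rho].
Proof.
move=> hnu sb bz eps0 neps.
have [phi [U [oU Uz sU gU hU]]] := sb z bz.
pose b := grad phi z; have b0 : b <> 0 by exact: gU.
have B0 := enorm_gt0 b0; pose k := (enorm b)^-1.
have k0 : 0 < k by rewrite invr_gt0.
pose e := k *: b; pose rho y := k * phi y.
have ee : dot e e = 1 by exact: dot_unit.
have [r1 r10 hr1] := open_norm_ball oU Uz.
have dr i y : U y -> is_derive y (delta_mx 0 i : 'rV[R]_n) rho (k * partial i phi y).
  by move=> Uy; apply: partialZ; have [_ /(_ i)[]] := smooth_on_C1 sU Uy.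
have pr i y : U y -> partial i rho y = k * partial i phi y by move=> /(dr i)[].
have nU y : U y -> \forall w \near y, U w by move=> Uy; move: oU; rewrite openE => /(_ y Uy).
have cr i y : U y -> {for y, continuous (partial i rho)}.
  move=> Uy; apply: (@near_eq_continuous _ _ (fun w => k * partial i phi w)).
    by apply: filterS (nU y Uy) => w Uw; rewrite pr.
  by apply: contM; [exact: contC|have [_ /(_ i)[]] := smooth_on_C1 sU Uy].
have /choice[d hd] : forall i, exists d : R, 0 < d /\ forall y, `|y - z| < d -> `|partial i rho y - partial i rho z| < eps.
  by move=> i; have [d d0 hd] := near_within_ball (cr i z Uz) eps0; exists d.
pose r := \big[Num.min/r1]_(i < n) d i.
have r0 : 0 < r by apply: lt_bigmin => // i _; have [] := hd i.
have rr1 : r <= r1 by exact: bigmin_le_id.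
have rd i : r <= d i by exact: bigmin_le_cond.
have rU y : `|y - z| < r -> U y by move=> h; apply: hr1; exact: lt_le_trans rr1.
have pe i y : `|y - z| < r -> `|partial i rho y - e 0 i| <= eps.
  move=> h; have -> : e 0 i = partial i rho z by rewrite pr// !mxE.
  by apply/ltW; have [_] := hd i; apply; exact: lt_le_trans (rd i).
exists e, r, rho; split => //; split.
- move=> x xr; have Ux := rU x xr; split.
    by apply: contM; [exact: contC|have [] := smooth_on_C1 sU Ux].
  by move=> i; split; [have [] := dr i x Ux|exact: cr|exact: pe].
- move=> x xr; have [h1 h2] := hU x (rU x xr); split.
    by rewrite h1 /rho pmulr_rlt0.
  rewrite h2 /rho; split => [->|]; first by rewrite mulr0.
  by move/eqP; rewrite mulf_eq0 gt_eqF//= => /eqP.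
move=> x xr bx; have Ux := rU x xr.
have [psi [[V [oV Vx sV gV hV]] nuE]] := hnu x bx.
have [r2 r20 hr2] := open_norm_ball oV Vx.
have [r3 r30 hr3] := open_norm_ball oU Ux.
pose s := Num.min r2 r3.
have s0 : 0 < s by rewrite lt_min r20.
have phx : phi x = 0 by have [_ h] := hU x Ux; exact/h.
have psx : psi x = 0 by have [_ h] := hV x Vx; exact/h.
have [|||||lam lam0 par] := @grad_parallel R n phi psi x s s0 _ _ _ _ phx psx _ (gU x Ux) (gV x Vx).
- move=> i y; rewrite lt_min => /andP[_ /hr3 Uy].
  by have [_ /(_ i)[]] := smooth_on_C1 sU Uy.
- by move=> i; have [_ /(_ i)[]] := smooth_on_C1 sU Ux.
- move=> i y; rewrite lt_min => /andP[/hr2 Vy _].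
  by have [_ /(_ i)[]] := smooth_on_C1 sV Vy.
- by move=> i; have [_ /(_ i)[]] := smooth_on_C1 sV Vx.
- move=> y; rewrite lt_min => /andP[/hr2 Vy /hr3 Uy] py.
  by apply/((hU y Uy).1); apply/((hV y Vy).1).
have P0 := enorm_gt0 (gV x Vx).
pose mu := k * lam * enorm (grad psi x).
have mu0 : 0 < mu by rewrite !mulr_gt0.
have pmu i : partial i rho x = mu * nu x 0 i.
  rewrite pr// nuE !mxE /mu.
  have -> : partial i phi x = lam * partial i psi x.
    by have := congr1 (fun v : 'rV[R]_n => v 0 i) par; rewrite !mxE.
  by field; rewrite gt_eqF.
exists mu => //.
have nn : dot (nu x) (nu x) = 1 by rewrite nuE dot_unit//; exact: gV.
have h1 : mu * dot (nu x) e = \sum_(i < n) partial i rho x * e 0 i.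
  by rewrite mulr_sumr; apply: eq_bigr => i _; rewrite pmu mulrA.
have h2 : 1 - n%:R * eps <= \sum_(i < n) partial i rho x * e 0 i.
  have nE : n%:R * eps = \sum_(i < n) eps by rewrite sumr_const card_ord mulr_natl.
  suff : dot e e <= \sum_(i < n) partial i rho x * e 0 i + \sum_(i < n) eps by rewrite ee -nE; clear; lra.
  rewrite -big_split/=.
  apply: ler_sum => i _.
  have a1 := pe i x xr; have a2 := unit_coord_le1 i ee.
  have : (e 0 i - partial i rho x) * e 0 i <= eps.
    apply: (le_trans (ler_norm _)); rewrite normrM distrC -[eps]mulr1; exact: ler_pM.
  by rewrite mulrBl; clear; lra.
have h3 : mu * dot (nu x) e <= mu by rewrite ler_piMr ?(ltW mu0)// dot_le1.
clear - h1 h2 h3 neps; lra.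
Qed.

Lemma within_epsP R (V : normedModType R) (A : set V) (f : V -> R) :
  {within A, continuous f} <->
  forall x, A x -> forall e : R, 0 < e ->
    exists2 d : R, 0 < d & forall y, A y -> `|y - x| < d -> `|f y - f x| < e.
Proof.
split.
  move=> /subspace_continuousP cf x Ax e e0.
  have /cvgrPdist_lt/(_ e e0) := cf x Ax.
  rewrite near_withinE => /nbhs_ballP[d /= d0 hd]; exists d => // y Ay yx.
  by rewrite distrC; apply: hd => //; rewrite -ball_normE/= distrC.
move=> h; apply/subspace_continuousP => x Ax; apply/cvgrPdist_lt => e e0.
rewrite near_withinE; have [d d0 hd] := h x Ax e e0.
apply/nbhs_ballP; exists d => // y; rewrite -ball_normE/= => xy Ay.
by rewrite distrC; apply: hd => //; rewrite distrC.
Qed.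

(** The open segment from the boundary point along the inner normal lies in the
    domain, where the mean value theorem applies; the point it provides tends to
    the boundary point. *)
Lemma normal_derivativeE R n (D : set 'rV[R]_n) (nu : 'rV[R]_n -> 'rV[R]_n)
    (f : 'rV[R]_n -> R) (g : 'I_n -> 'rV[R]_n -> R) (x : 'rV[R]_n) (d : R) :
  open D -> outward_unit_normal D nu -> boundary D x ->
  {within closure D, continuous f} ->
  (forall i, {within closure D, continuous (g i)}) ->
  (forall i y, D y -> has_partial i f y /\ partial i f y = g i y) ->
  (forall i y, D y -> {for y, continuous (partial i f)}) ->
  is_normal_derivative nu f x d -> d = \sum_(i < n) nu x 0 i * g i x.
Proof.
move=> oD hnu bx cf cg pf cp hd.
have [psi [[V [oV Vx sV gV hV]] nuE]] := hnu x bx.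
have [r2 r20 hr2] := open_norm_ball oV Vx.
have psx : psi x = 0 by have [_ h] := hV x Vx; exact/h.
have P0 := enorm_gt0 (gV x Vx).
have dpsi : is_derive x (- nu x) psi (dot (- nu x) (grad psi x)).
  apply: (C1_dot _ r20) => [i y /hr2 Vy|i]; first by have [_ /(_ i)[]] := smooth_on_C1 sV Vy.
  by have [_ /(_ i)[]] := smooth_on_C1 sV Vx.
have [|h0 h00 inD0] := is_derive_lt0_near dpsi.
  rewrite -scaleN1r dotZl mulN1r oppr_lt0 nuE dotZl -enorm_sq.
  by rewrite mulr_gt0// ?invr_gt0// exprn_gt0.
pose h1 := Num.min h0 (r2 / (`|nu x| + 1)).
have n1 : 0 < `|nu x| + 1 by rewrite ltr_wpDl.
have h10 : 0 < h1 by rewrite lt_min h00 divr_gt0.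
have inD s : 0 < s < h1 -> D (x - s *: nu x).
  move=> /andP[s0]; rewrite lt_min => /andP[s1 s2].
  have Vs : V (x - s *: nu x).
    apply: hr2; rewrite addrAC subrr add0r normrN normrZ gtr0_norm//.
    move: s2; rewrite ltr_pdivlMr// mulrDr mulr1; lra.
  apply/((hV _ Vs).1); have := inD0 s; rewrite s0 s1 => /(_ isT).
  by rewrite psx scalerN.
have clx : closure D x by have [] := bx.
pose S y := \sum_(i < n) nu x 0 i * g i y.
have cS : {within closure D, continuous S}.
  by move=> y; apply: cont_sum => i; apply: contM; [exact: contC|exact: cg].
suff lim : (f x - f (x - h *: nu x)) / h @[h --> 0^'+] --> S x.
  exact: (cvg_unique _ hd lim).
apply/cvgrPdist_le => eps eps0.
have [dl dl0 hdl] := (within_epsP (closure D) S).1 cS x clx eps eps0.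
near=> h.
have hp : 0 < h by near: h; exact: nbhs_right_gt.
have hh1 : h < h1 by near: h; exact: nbhs_right_lt.
have hdl1 : h < dl / (`|nu x| + 1) by near: h; apply: nbhs_right_lt; rewrite divr_gt0.
pose F (s : R) := f (x - s *: nu x).
have inD' s : 0 <= s <= h -> closure D (x - s *: nu x).
  move=> /andP[]; rewrite le_eqVlt => /predU1P[<- _|s0 sh]; first by rewrite scale0r subr0.
  by apply: subset_closure; apply: inD; rewrite s0 (le_lt_trans sh).
have dF s : 0 < s < h -> is_derive s (1 : R) F (- S (x - s *: nu x)).
  move=> /andP[s0 sh]; have Ds : D (x - s *: nu x) by apply: inD; rewrite s0 (lt_trans sh).
  have [r4 r40 hr4] := open_norm_ball oD Ds.
  have h2 : is_derive (x - s *: nu x) (- nu x) f (\sum_(i < n) (- nu x) 0 i * partial i f (x - s *: nu x)).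
    apply: (C1_is_derive _ r40) => [i y /hr4 Dy|i]; first by have [] := pf i y Dy.
    exact: cp.
  rewrite -scalerN in h2.
  have := iffLR (is_derive_line f x (- nu x) s _) h2.
  move=> h3; apply: (is_derive_cong h3); first by move=> t; rewrite /F scalerN.
  rewrite /S -sumrN; apply: eq_bigr => i _; rewrite !mxE mulNr scalerN.
  by have [_ ->] := pf i _ Ds.
have cF : {within `[0, h], continuous F}.
  apply/within_epsP => s; rewrite /= in_itv/= => /inD' Ds e e0.
  have [d1 d10 hd1] := (within_epsP (closure D) f).1 cf _ Ds e e0.
  exists (d1 / (`|nu x| + 1)); first by rewrite divr_gt0.
  move=> t; rewrite /= in_itv/= => /inD' Dt ts; apply: hd1 => //.
  have -> : x - t *: nu x - (x - s *: nu x) = (s - t) *: nu x.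
    by rewrite scalerBl opprB addrC addrA subrK.
  rewrite normrZ distrC.
  move: ts; rewrite ltr_pdivlMr//; apply: le_lt_trans.
  by rewrite ler_wpM2l// lerDl.
have dF' (s : R) : s \in `]0, h[ -> is_derive s (1 : R) F (- S (x - s *: nu x)).
  by rewrite in_itv/=; exact: dF.
have [c] := @MVT _ F (fun s => - S (x - s *: nu x)) 0 h hp dF' cF.
rewrite in_itv/= => c0h e1.
have -> : (f x - f (x - h *: nu x)) / h = S (x - c *: nu x).
  move: e1; rewrite /F scale0r !subr0 => e1.
  apply: (@mulIf _ h); first by rewrite gt_eqF.
  by rewrite mulfVK ?gt_eqF//; lra.
have Dc : D (x - c *: nu x) by apply: inD; move: c0h => /andP[-> ch]; exact: lt_trans hh1.
rewrite distrC ltW//; apply: hdl; first exact: subset_closure.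
rewrite addrAC subrr add0r normrN normrZ gtr0_norm; last by case/andP: c0h.
move: hdl1; rewrite ltr_pdivlMr//; apply: le_lt_trans.
move: c0h => /andP[c0 ch]; apply: ler_pM => //; [exact: ltW|exact: ltW|by rewrite lerDl].
Unshelve. all: by end_near. Qed.

(** * Compactness *)

Lemma compact_sublevel R (V : normedModType R) (K : set V) (f : V -> R) (c : R) :
  compact K -> {within K, continuous f} -> compact (K `&` [set x | f x <= c]).
Proof.
move=> cK cf; apply: (subclosed_compact _ cK); last by move=> x [].
rewrite closure_id; apply/seteqP; split; first exact: subset_closure.
move=> x cx.
have Kx : K x.
  have : closed K by apply: compact_closed => //; exact: norm_hausdorff.
  rewrite closure_id => ->; by move: cx; apply: closureS => y [].
split => //=; rewrite leNgt; apply/negP => fx.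
have [d d0 hd] := (within_epsP K f).1 cf x Kx (f x - c) ltac:(by rewrite subr_gt0).
have [|y [[Ky /= fy] xy]] := cx (ball x d); first exact: nbhsx_ballx.
have := hd y Ky; rewrite -ball_normE/= distrC in xy; move=> /(_ xy).
rewrite ltr_distl => /andP[h _]; lra.
Qed.

(** The pairs whose values are at least [e] apart form a compact set, on which the
    distance of the two points has a positive minimum. *)
Lemma compact_uniformly_continuous R (V : normedModType R) (K : set V) (f : V -> R) (e : R) :
  compact K -> {within K, continuous f} -> 0 < e ->
  exists2 d : R, 0 < d & forall x y, K x -> K y -> `|x - y| < d -> `|f x - f y| < e.
Proof.
move=> cK cf e0.
pose g (z : V * V) : R := - `|f z.1 - f z.2|.
have cKK : compact (K `*` K) by exact: compact_setX.
have cg : {within K `*` K, continuous g}.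
  apply/within_epsP => -[x y] [/= Kx Ky] b b0.
  have b20 : 0 < b / 2 by rewrite divr_gt0.
  have [d1 d10 h1] := (within_epsP K f).1 cf x Kx _ b20.
  have [d2 d20 h2] := (within_epsP K f).1 cf y Ky _ b20.
  exists (Num.min d1 d2); first by rewrite lt_min d10.
  move=> [x' y'] [/= Kx' Ky']; rewrite lt_min !prod_normE/= !gt_max.
  move=> /andP[/andP[xx1 _] /andP[_ yy2]].
  rewrite /g/= opprK addrC; apply: le_lt_trans (ler_dist_dist _ _) _.
  rewrite (_ : f x - f y - (f x' - f y') = (f x - f x') - (f y - f y')); last by ring.
  apply: le_lt_trans (ler_normB _ _) _.
  have := h1 x' Kx' xx1; have := h2 y' Ky' yy2; rewrite distrC [`|f x' - _|]distrC; lra.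
have cS := @compact_sublevel R (V * V)%type _ _ (- e) cKK cg.
have [[z0 Sz0]|S0] := pselect ((K `*` K `&` [set z | g z <= - e]) !=set0); last first.
  exists 1 => // x y Kx Ky _; rewrite ltNge; apply/negP => h; apply: S0.
  by exists (x, y); split => //=; rewrite /g/= lerN2.
have cd : {within K `*` K `&` [set z | g z <= - e], continuous (fun z : V * V => `|z.1 - z.2|)}.
  apply: continuous_subspaceT => z; apply: (@cont_comp _ _ _ (fun z : V * V => z.1 - z.2) (fun y : V => `|y|)); last exact: norm_continuous.
  by apply: (@continuousB R _ _ fst snd); [exact: cvg_fst|exact: cvg_snd].
have [|[x1 y1] /set_mem[[/= Kx1 Ky1] gz] hmin] := compact_EVT_min _ cS cd; first by exists z0.
exists `|x1 - y1|.
  rewrite normr_gt0 subr_eq0; apply/eqP => xy; move: gz.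
  by rewrite /g/= xy subrr normr0 oppr0 leNgt oppr_lt0 e0.
move=> x y Kx Ky xy; rewrite ltNge; apply/negP => h.
have := hmin (x, y); rewrite inE => /(_ (conj (conj Kx Ky) _)).
rewrite /g/= lerN2 => /(_ h) /=; by rewrite leNgt xy.
Qed.

(** * A test function in the boundary layer *)

Lemma sqdist_shift R n (z e x : 'rV[R]_n) (s : R) : dot e e = 1 ->
  sqdist (z + s *: e) x = dot (x - z) (x - z) - 2 * s * dot e (x - z) + s ^+ 2.
Proof.
move=> ee; have -> : s ^+ 2 = s ^+ 2 * dot e e by rewrite ee mulr1.
rewrite /sqdist /dot !mulr_sumr -sumrB -big_split/=; apply: eq_bigr => i _.
by rewrite !mxE; ring.
Qed.

Lemma dot_norm_le R n (a b v : 'rV[R]_n) (eps s : R) :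
  0 <= s -> (forall i, `|a 0 i - b 0 i| <= eps) -> `|v| <= s ->
  `|dot a v - dot b v| <= n%:R * eps * s.
Proof.
move=> s0 h /(rV_norm_le _ s0) hv.
have nE : n%:R * eps * s = \sum_(i < n) eps * s by rewrite sumr_const card_ord mulr_natl mulrnAl.
rewrite nE /dot -sumrB; apply: le_trans (ler_norm_sum _ _ _) _; apply: ler_sum => i _.
by rewrite -mulrBl normrM; apply: ler_pM.
Qed.

(** The chart is small enough for [rho] to be almost the linear function
    [dot e (x - z)], with an error that does not depend on the dimension. *)
Definition flat_chart R n (D : set 'rV[R]_n) (nu : 'rV[R]_n -> 'rV[R]_n)
    (z e : 'rV[R]_n) (r eps : R) (rho : 'rV[R]_n -> R) : Prop :=
  [/\ 0 < r /\ dot e e = 1, chart D nu z e r eps rho, 0 < eps, n%:R * eps <= 24^-1 & boundary D z].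

Lemma chart_increment R n (D : set 'rV[R]_n) nu z e r eps rho (x v : 'rV[R]_n) :
  flat_chart D nu z e r eps rho -> `|x - z| + `|v| < r ->
  `|rho (x + v) - rho x - dot e v| <= n%:R * eps * `|v|.
Proof.
move=> [[r0 ee] ch eps0 neps bz] xv; have [h1 _ _] := ch.
have inb y : `|y - x| <= `|v| -> `|y - z| < r.
  move=> yx; apply: le_lt_trans xv; rewrite -[y - z](subrKA x).
  by apply: (le_trans (ler_normD _ _)); rewrite addrC lerD2l.
have [|xi [hxi ->]] := @MVT_coord R n rho x v.
  by move=> i y /inb /h1[_ /(_ i)[]].
pose a : 'rV[R]_n := \row_i partial i rho (xi i).
have -> : \sum_(i < n) v 0 i * partial i rho (xi i) = dot a v.
  by apply: eq_bigr => i _; rewrite mxE mulrC.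
apply: dot_norm_le => // i; rewrite mxE.
by have [_ /(_ i)[]] := h1 _ (inb _ (hxi i)).
Qed.

Lemma chart_center R n (D : set 'rV[R]_n) nu z e r eps rho :
  flat_chart D nu z e r eps rho -> rho z = 0.
Proof.
move=> [[r0 ee] ch eps0 neps bz]; have [_ h _] := ch; have [_ h2] := h z ltac:(by rewrite subrr normr0).
exact/h2.
Qed.

Lemma chart_rho_dot R n (D : set 'rV[R]_n) nu z e r eps rho (x : 'rV[R]_n) (s : R) :
  flat_chart D nu z e r eps rho -> `|x - z| <= s -> s < r -> `|rho x - dot e (x - z)| <= 24^-1 * s.
Proof.
move=> fc xz sr; have [_ _ eps0 neps _] := fc.
have := @chart_increment _ _ D nu z e r eps rho z (x - z) fc.
rewrite subrr normr0 add0r => /(_ (le_lt_trans xz sr)).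
rewrite (addrC z) subrK (chart_center fc) subr0 => h; apply: (le_trans h).
by apply: ler_pM => //; apply: mulr_ge0 => //; exact: ltW.
Qed.

Lemma chart_dot R n (D : set 'rV[R]_n) nu z e r eps rho (x v : 'rV[R]_n) (s : R) :
  flat_chart D nu z e r eps rho -> `|x - z| < r -> 0 <= s -> `|v| <= s ->
  `|\sum_(i < n) partial i rho x * v 0 i - dot e v| <= n%:R * eps * s.
Proof.
move=> [[r0 ee] ch eps0 neps bz] xr s0 vs; have [h1 _ _] := ch.
have -> : \sum_(i < n) partial i rho x * v 0 i = dot (grad rho x) v.
  by apply: eq_bigr => i _; rewrite mxE.
by apply: dot_norm_le => // i; rewrite mxE; have [_ /(_ i)[]] := h1 x xr.
Qed.

Lemma unit_norm_le1 R n (e : 'rV[R]_n) : dot e e = 1 -> `|e| <= 1.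
Proof. by move=> ee; apply/rV_norm_le => // i; exact: unit_coord_le1. Qed.

(** Continuity of [f] itself is part of the definition because one partial
    derivative does not imply it. *)
Definition C1in R n (i : 'I_n) (W : set 'rV[R]_n) (f : 'rV[R]_n -> R) : Prop :=
  forall x, W x -> [/\ {for x, continuous f}, has_partial i f x & {for x, continuous (partial i f)}].

Lemma layer_product_C1 R n (i : 'I_n) (W : set 'rV[R]_n) (rho phi : 'rV[R]_n -> R)
    (H dH : R -> R) :
  open W -> C1in i W rho -> C1in i W phi -> (forall s, is_derive s (1 : R) H (dH s)) -> continuous dH ->
  C1in i W (fun x => H (rho x) * phi x) /\ forall x, W x ->
    partial i (fun x => H (rho x) * phi x) x =
    dH (rho x) * partial i rho x * phi x + H (rho x) * partial i phi x.
Proof.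
move=> oW hrho hphi dHd cdH.
have cH := is_derive_continuous dHd.
have D1 x : W x -> is_derive x (delta_mx 0 i : 'rV[R]_n) (fun x => H (rho x) * phi x)
    (dH (rho x) * partial i rho x * phi x + H (rho x) * partial i phi x).
  move=> Wx; have [_ r1 _] := hrho x Wx; have [_ p1 _] := hphi x Wx.
  have h1 := is_derive_comp_scalar (derivableP r1) (dHd (rho x)).
  apply: (is_derive_cong (is_deriveM h1 (derivableP p1))) => //.
  by rewrite /GRing.scale/= /partial; ring.
split => [x Wx|x /D1[]//].
have [cr _ cri] := hrho x Wx; have [cp _ cpi] := hphi x Wx.
have cHr : {for x, continuous (fun y => H (rho y))} by apply: (@cont_comp _ _ _ rho H) => //; exact: cH.
split; [by apply: contM|by have [] := D1 x Wx|].
apply: (@near_eq_continuous _ _ (fun y => dH (rho y) * partial i rho y * phi y + H (rho y) * partial i phi y)).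
  by move: oW; rewrite openE => /(_ x Wx); apply: filterS => y /D1[_ e]; rewrite [RHS]e.
apply: contD; last exact: contM.
apply: contM => //; apply: contM => //.
by apply: (@cont_comp _ _ _ rho dH) => //; exact: cdH.
Qed.

Lemma C2on_C1 R n (i : 'I_n) (W : set 'rV[R]_n) (f : 'rV[R]_n -> R) :
  C2on W f -> C1in i W f /\ C1in i W (partial i f).
Proof. by move=> h; split => x /h[c hp]; have [] := hp i. Qed.

Lemma open_norm_lt R n (z : 'rV[R]_n) (r : R) : open [set x | `|x - z| < r].
Proof.
rewrite (_ : mkset _ = ball_ Num.norm z r); last by apply/seteqP; split => x /=; rewrite distrC.
rewrite ball_normE openE => x xz; apply/nbhs_ballP.
have xr : `|z - x| < r by move: xz; rewrite -ball_normE.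
exists (r - `|z - x|); first by rewrite /= subr_gt0.
move=> y; rewrite -!ball_normE/= => xy; rewrite -(subrKA x).
by apply: le_lt_trans (ler_normD _ _) _; lra.
Qed.

Lemma continuous_dot R n (e z x : 'rV[R]_n) :
  {for x, continuous (fun y : 'rV[R]_n => dot e (y - z))}.
Proof.
apply: cont_sum => i; apply: contM; first exact: contC.
apply: (@near_eq_continuous _ _ (fun y : 'rV[R]_n => y 0 i - z 0 i)).
  by near=> y; rewrite !mxE.
by apply: contD; [exact: coord_continuous|exact: contC].
Unshelve. all: by end_near. Qed.

Lemma chart_C1 R n (D : set 'rV[R]_n) nu z e r eps rho :
  flat_chart D nu z e r eps rho -> forall i, C1in i [set x | `|x - z| < r] rho.
Proof. by move=> [_ [h _ _] _ _ _] i x /h[c hp]; have [] := hp i. Qed.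

(** The mass that the layer carries does not degenerate with its thickness [d].
    Let [xi] be a bump centred at [zp], on the outer side. The derivative of
    [H(rho) xi] in the direction [e] has integral zero, so the integral of
    [- dH(rho) xi], up to a factor close to 1, is that of [H(rho)] times the
    derivative of [xi] along [e]. The latter is nonnegative in the domain, where
    [xi] increases towards its centre, and bounded below on a cube around [y0],
    which lies inside the domain at a distance from the boundary that does not
    depend on [d]. As [phi] is 1 on the part of the layer where [xi] is positive,
    the mass in question is at least the integral of [- dH(rho) xi]. *)
Lemma layer_mass R n (D : set 'rV[R]_n) nu z e r eps rho :
  flat_chart D nu z e r eps rho ->
  exists ca d0 : R, [/\ 0 < ca, 0 < d0 &
  forall (H dH : R -> R) (d : R), 0 < d <= d0 ->
    (forall s, is_derive s (1 : R) H (dH s)) -> continuous dH ->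
    (forall s, 0 <= H s) -> (forall s, dH s <= 0) ->
    (forall s, s <= - (2 * d) -> H s = 1) -> (forall s, - d <= s -> H s = 0 /\ dH s = 0) ->
    forall phi : 'rV[R]_n -> R, (forall x, 0 <= phi x) ->
      bms (fun x => phi x * - dH (rho x)) ->
      (forall x, rho x <= 0 -> `|x - z| <= 3 * (r / 4) ->
         sqdist (z - (r / 4) *: e) x <= 3 * (r / 4) ^+ 2 -> phi x = 1) ->
      ca <= lint (fun x => phi x * - dH (rho x))].
Proof.
move=> fc; have [[r0 ee] ch eps0 neps bz] := fc.
pose tau := r / 4.
have tau0 : 0 < tau by rewrite divr_gt0.
have ab : tau ^+ 2 < 2 * tau ^+ 2 by rewrite ltr_pMl ?exprn_gt0// ltr1n.
have [xi [x1 [x2 [dxi dx1 cx2 [xi01 x1le] [xia xib xab [q /andP[q1 q2] xq]]]]]] := cutoff_exists ab.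
pose zp := z + tau *: e.
have nE : 0 <= n%:R * eps by rewrite mulr_ge0// ltW.
have [h1 h2 h3] := ch.
have cx1 := is_derive_continuous dx1.
pose g x := 2 * x1 (sqdist zp x) * dot e (x - zp).
have supp x : sqdist zp x <= 2 * tau ^+ 2 -> `|x - z| <= 3 * tau.
  move=> h; have : `|x - zp| <= 2 * tau.
    apply: norm_le_sqdist; first by rewrite mulr_ge0// ltW.
    apply: le_trans h _; have -> : (2 * tau) ^+ 2 = 4 * tau ^+ 2 by ring.
    by rewrite ler_wpM2r ?exprn_ge0 ?(ltW tau0)//; lra.
  have : `|tau *: e| <= tau.
    by rewrite normrZ (gtr0_norm tau0) ler_piMr ?(ltW tau0)//; exact: unit_norm_le1.
  have -> : x - z = (x - zp) + tau *: e by rewrite /zp opprD addrA subrK.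
  move=> a1 a2; apply: (le_trans (ler_normD _ _)); lra.
have tr x : `|x - z| <= 3 * tau -> `|x - z| < r by move=> h; apply: le_lt_trans h _; rewrite /tau; lra.
have rhoe x : `|x - z| <= 3 * tau -> `|rho x - dot e (x - z)| <= tau / 8.
  by move=> xz; have := chart_rho_dot fc xz (_ : 3 * tau < r); have -> : 24^-1 * (3 * tau) = tau / 8; [field|apply; rewrite /tau; lra].
have dzp x : dot e (x - zp) = dot e (x - z) - tau.
  rewrite /zp opprD addrA (dotC e) dotDl -scaleNr dotZl ee mulr1 (dotC _ e) //.
have gge x : rho x <= 0 -> 0 <= g x.
  move=> rx; have [qx|qx] := leP (sqdist zp x) (2 * tau ^+ 2); last first.
    by rewrite /g (proj1 (xab _ (or_intror (ltW qx)))) mulr0 mul0r.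
  have := rhoe x (supp x qx); rewrite ler_distl => /andP[a1 a2].
  by rewrite /g mulr_le0// ?pmulr_rle0// dzp; lra.
have cg : continuous g.
  move=> x; apply: (@contM _ _ (fun x => 2 * x1 (sqdist zp x)) (fun x => dot e (x - zp))).
    apply: (@contM _ _ (fun=> 2)); first exact: contC.
    by apply: (@cont_comp _ _ _ (sqdist zp) x1); [exact: continuous_sqdist|exact: cx1].
  exact: continuous_dot.
pose h := Num.sqrt q - tau.
have q0 : 0 < q by apply: lt_trans q1; rewrite exprn_gt0.
have sq : Num.sqrt q ^+ 2 = q by rewrite sqr_sqrtr// ltW.
have h0 : 0 < h.
  by rewrite subr_gt0 -(@ltr_pXn2r _ 2)// ?nnegrE ?sqrtr_ge0// ?(ltW tau0)// sq.
have ht : h < tau.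
  rewrite ltrBlDr -(@ltr_pXn2r _ 2)// ?nnegrE ?sqrtr_ge0//; last by rewrite addr_ge0// ltW.
  rewrite sq; apply: (lt_le_trans q2); have -> : (tau + tau) ^+ 2 = 4 * tau ^+ 2 by ring.
  by rewrite ler_pM2r ?exprn_gt0//; lra.
pose y0 := z - h *: e.
have y0z : y0 - z = - h *: e by rewrite /y0 addrAC subrr add0r scaleNr.
have hdot : dot e (y0 - z) = - h by rewrite y0z dotC dotZl ee mulr1.
have qy0 : sqdist zp y0 = q.
  rewrite /zp sqdist_shift// hdot y0z dotZl (dotC e) dotZl ee -sq /h; ring.
have gy0 : 0 < g y0.
  rewrite /g qy0 dzp hdot nmulr_lgt0; last lra.
  by rewrite pmulr_rlt0.
have ny : `|- h *: e| <= h.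
  by rewrite normrZ normrN (gtr0_norm h0) ler_piMr ?(ltW h0)//; exact: unit_norm_le1.
have ry0 : rho y0 < 0.
  have := @chart_increment _ _ D nu z e r eps rho z (- h *: e) fc; rewrite subrr normr0 add0r => hh.
  have hr : `|- h *: e| < r by apply: le_lt_trans ny _; rewrite /tau in ht; lra.
  have := hh hr; rewrite (chart_center fc) subr0 (dotC e) dotZl ee mulr1 opprK.
  rewrite (_ : z + - h *: e = y0); last by rewrite /y0 scaleNr.
  move=> a1; have a2 : n%:R * eps * `|- h *: e| <= 24^-1 * h by exact: ler_pM.
  have := le_trans a1 a2; rewrite ler_norml => /andP[_ a3]; clear - a3 h0; lra.
have y0tau : `|y0 - z| <= 3 * tau by rewrite y0z; apply: le_trans ny _; clear - ht tau0; lra.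
have [d1 d10 hd1] := near_within_ball (cg y0) (divr_gt0 gy0 (ltr0n R 2)).
have cr0 : {for y0, continuous rho} by have [] := h1 y0 (tr _ y0tau).
have ry2 : 0 < - rho y0 / 2 by rewrite divr_gt0// oppr_gt0.
have [d2 d20 hd2] := near_within_ball cr0 ry2.
pose ka := Num.min d1 d2 / 2.
have ka0 : 0 < ka by rewrite divr_gt0// lt_min d10.
have dm : 0 < Num.min d1 d2 by rewrite lt_min d10.
have dm1 : Num.min d1 d2 <= d1 by rewrite ge_min lexx.
have dm2 : Num.min d1 d2 <= d2 by rewrite ge_min lexx orbT.
have kd1 : ka < d1 by rewrite /ka; clear - dm dm1; lra.
have kd2 : ka < d2 by rewrite /ka; clear - dm dm2; lra.
exists (2^-1 * (g y0 / 2 * (2 * ka) ^+ n)), (- rho y0 / 4); split.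
- apply: mulr_gt0; first by rewrite invr_gt0.
  by apply: mulr_gt0; [exact: divr_gt0|apply: exprn_gt0; exact: mulr_gt0].
- by rewrite divr_gt0// oppr_gt0.
move=> H dH d /andP[dp dle] dHd cdH H0 dHle H1 Hd phi phi0 bphi phi1.
pose W := [set x : 'rV[R]_n | `|x - z| < r].
have oW : open W by exact: open_norm_lt.
pose K := [set x : 'rV[R]_n | sqdist zp x <= 2 * tau ^+ 2].
have cK : compact K by apply: compact_sqball; rewrite mulr_ge0// sqr_ge0.
have KW : K `<=` W by move=> x /supp /tr.
have [P2 Pd _] := radial_C2 zp dxi dx1 cx2.
pose f x := H (rho x) * (xi \o sqdist zp) x.
have hf i := layer_product_C1 oW (chart_C1 fc i) (C2on_C1 i (P2 W)).1 dHd cdH.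
have fC i : C1in i W f by have [] := hf i.
have fd i : forall x, W x -> partial i f x = dH (rho x) * partial i rho x * (xi \o sqdist zp) x + H (rho x) * partial i (xi \o sqdist zp) x.
  by have [] := hf i.
have f0 x : ~ K x -> f x = 0.
  by move=> /negP; rewrite -ltNge => hx; rewrite /f/= xib ?mulr0// ltW.
have pf0 i x : ~ K x -> partial i f x = 0.
  by move=> nK; have [_] := near0_partial i (near_off_compact cK f0 nK).
have bf i : bms (partial i f).
  by apply: (bms_open cK KW) => [x /(fC i)[]//|x]; exact: pf0.
have I0 i : lint (partial i f) = 0.
  exact: (lint_partial_eq0 (W := W) cK KW (fC i) f0).
have gK x : ~ K x -> g x = 0.
  move=> /negP; rewrite -ltNge => hx.
  by rewrite /g (proj1 (xab _ (or_intror (ltW hx)))) mulr0 mul0r.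
have pt x : W x -> \sum_(i < n) e 0 i * partial i f x =
    dH (rho x) * (xi (sqdist zp x) * \sum_(i < n) partial i rho x * e 0 i) + H (rho x) * g x.
  move=> Wx; rewrite /g /dot !mulr_sumr -big_split/=; apply: eq_bigr => i _.
  by rewrite fd// Pd !mxE/=; ring.
have main x : g y0 / 2 * cube_indic y0 ka x - 2 * (phi x * - dH (rho x)) <= \sum_(i < n) e 0 i * partial i f x.
  have ph0 : 0 <= phi x * - dH (rho x) by rewrite mulr_ge0// oppr_ge0.
  have Ng : cube_indic y0 ka x = 1 -> [/\ K x, g y0 / 2 <= g x & rho x <= - (2 * d)].
    rewrite /cube_indic indicE; case: (boolP (_ \in _)) => [/set_mem/= xN _|_ /eqP]; last by rewrite eq_sym oner_eq0.
    have := hd1 x (le_lt_trans xN kd1); rewrite ltr_distl => /andP[a1 _].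
    have := hd2 x (le_lt_trans xN kd2); rewrite ltr_distl => /andP[_ a2].
    have gx : g y0 / 2 <= g x by clear - a1; lra.
    split => //; last by clear - a2 dle; lra.
    by apply: contrapT => /gK gx0; clear - gx gx0 gy0; lra.
  have N01 : cube_indic y0 ka x = 1 \/ cube_indic y0 ka x = 0.
    by rewrite /cube_indic indicE; case: (_ \in _); [left|right].
  have [Kx|nK] := pselect (K x); last first.
    rewrite big1; last by move=> i _; rewrite pf0// mulr0.
    by case: N01 => [/Ng[]//|->]; clear - ph0; lra.
  have Wx := KW x Kx; rewrite pt//.
  have t2 : g y0 / 2 * cube_indic y0 ka x <= H (rho x) * g x.
    case: N01 => [N|->]; first by have [_ gx rx] := Ng N; rewrite N H1// mulr1 mul1r.
    rewrite mulr0; have [rx|rx] := leP (rho x) 0; first by rewrite mulr_ge0// gge.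
    by rewrite (proj1 (Hd (rho x) _)) ?mul0r//; clear - rx dp; lra.
  have t1 : - (2 * (phi x * - dH (rho x))) <= dH (rho x) * (xi (sqdist zp x) * \sum_(i < n) partial i rho x * e 0 i).
    have [dH0|dHn] := eqVneq (dH (rho x)) 0; first by rewrite dH0 oppr0 !mulr0 mul0r oppr0.
    have rx : rho x <= 0.
      rewrite leNgt; apply/negP => rx; move/eqP: dHn; apply.
      by apply: (proj2 (Hd _ _)); clear - rx dp; lra.
    have xz := supp x Kx.
    have := rhoe x xz; rewrite ler_distl => /andP[a1 a2].
    have q3 : sqdist (z - tau *: e) x <= 3 * tau ^+ 2.
      move: Kx; rewrite /K/= /zp -scaleNr !sqdist_shift// sqrrN => a3.
      have : 4 * tau * dot e (x - z) <= 4 * tau * (tau / 8) by rewrite ler_pM2l ?mulr_gt0//; clear - a1 rx; lra.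
      have -> : 4 * tau * (tau / 8) = tau ^+ 2 / 2 by field.
      have : 0 <= tau ^+ 2 by exact: sqr_ge0.
      clear - a3; lra.
    rewrite (phi1 x rx xz q3).
    have := @chart_dot _ _ _ _ _ _ _ _ _ x e 1 fc Wx ler01 (unit_norm_le1 ee).
    rewrite ee mulr1 ler_distl => /andP[s1 s2].
    have := dHle (rho x); have /andP[xi0 xi1] := xi01 (sqdist zp x) => dl.
    have b1 : xi (sqdist zp x) * \sum_(i < n) partial i rho x * e 0 i <= 2.
      by rewrite -[leRHS]mul1r; apply: ler_pM => //; clear - s1 s2 neps; lra.
    have := ler_wnM2l dl b1; clear; lra.
  clear - t1 t2; lra.
have bN := bms_cube_indic y0 ka.
have := le_lint _ _ main.
have bS : bms (fun x => \sum_(i < n) e 0 i * partial i f x).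
  by apply: (bms_sum (f := fun i x => e 0 i * partial i f x)) => i; exact: bmsZ.
have bL : bms (fun x => g y0 / 2 * cube_indic y0 ka x - 2 * (phi x * - dH (rho x))).
  by apply: bmsB; exact: bmsZ.
move=> /(_ bL bS); rewrite lintB; [|exact: bmsZ|exact: bmsZ].
rewrite (lint_sum (f := fun i x => e 0 i * partial i f x)) => [|i]; last exact: bmsZ.
rewrite big1 => [|i _]; last by rewrite lintZ// I0 mulr0.
by rewrite !lintZ// lint_cube_indic ?(ltW ka0)//; clear; lra.
Qed.

(** To first order the sum is [dot e (x - z)], which is about [rho x], plus r/4. *)
Lemma bump_slope R n (D : set 'rV[R]_n) nu z e r eps rho (x : 'rV[R]_n) :
  flat_chart D nu z e r eps rho -> `|x - z| <= 3 * (r / 4) -> - (r / 8) <= rho x ->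
  0 <= \sum_(i < n) partial i rho x * (x 0 i - (z - (r / 4) *: e) 0 i).
Proof.
move=> fc xz rx; have [[r0 ee] _ eps0 neps _] := fc.
have xr : 3 * (r / 4) < r by lra.
have h1 := chart_rho_dot fc xz xr.
have h2 := @chart_dot _ _ _ _ _ _ _ _ _ x (x - z) _ fc (le_lt_trans xz xr) (le_trans (normr_ge0 _) xz) xz.
have h3 := @chart_dot _ _ _ _ _ _ _ _ _ x e 1 fc (le_lt_trans xz xr) ler01 (unit_norm_le1 ee).
have -> : \sum_(i < n) partial i rho x * (x 0 i - (z - (r / 4) *: e) 0 i) =
   \sum_(i < n) partial i rho x * (x - z) 0 i + (r / 4) * \sum_(i < n) partial i rho x * e 0 i.
  rewrite mulr_sumr -big_split/=; apply: eq_bigr => i _; rewrite !mxE; ring.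
set S1 := \sum_(i < n) partial i rho x * (x - z) 0 i in h2 *.
set S2 := \sum_(i < n) partial i rho x * e 0 i in h3 *.
have h4 : n%:R * eps * (3 * (r / 4)) <= 24^-1 * (3 * (r / 4)) by rewrite ler_wpM2r//; lra.
move: h1 h2 h3; rewrite ee mulr1 !ler_distl => /andP[a1 a2] /andP[a3 a4] /andP[a5 a6].
have : (r / 4) * (1 - 24^-1) <= (r / 4) * S2 by rewrite ler_wpM2l//; lra.
lra.
Qed.


Lemma C1in_sub R n (i : 'I_n) (W W' : set 'rV[R]_n) (f : 'rV[R]_n -> R) :
  W' `<=` W -> C1in i W f -> C1in i W' f.
Proof. by move=> s h x /s; exact: h. Qed.

Lemma sqball_shifted R n (z e x : 'rV[R]_n) (s : R) :
  0 <= s -> dot e e = 1 -> sqdist (z - s *: e) x <= 4 * s ^+ 2 -> `|x - z| <= 3 * s.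
Proof.
move=> s0 ee h.
have h1 : `|x - (z - s *: e)| <= 2 * s.
  apply: norm_le_sqdist; first exact: mulr_ge0.
  by apply: le_trans h _; have -> : (2 * s) ^+ 2 = 4 * s ^+ 2 by ring.
have h2 : `|s *: e| <= s.
  by rewrite normrZ (ger0_norm s0) ler_piMr//; exact: unit_norm_le1.
have -> : x - z = (x - (z - s *: e)) - s *: e by rewrite -addrA -opprD subrK.
apply: (le_trans (ler_normB _ _)); lra.
Qed.

(** One integration by parts gives the flux through the layer where [H] varies; the
    second, in the remaining term only, moves the last derivative off [U]. *)
Lemma layer_identity R n (W K : set 'rV[R]_n) (rho phi U : 'rV[R]_n -> R)
    (H dH : R -> R) :
  open W -> compact K -> K `<=` W -> (forall i, C1in i W rho) -> C2on W phi -> C2on W U ->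
  (forall s, is_derive s (1 : R) H (dH s)) -> continuous dH ->
  (forall x, ~ K x -> H (rho x) = 0 /\ dH (rho x) = 0 \/
     phi x = 0 /\ forall i, partial i phi x = 0 /\ partial i (partial i phi) x = 0) ->
  let flux i x := - (dH (rho x) * partial i rho x * phi x * partial i U x) in
  let err i x := (dH (rho x) * partial i rho x * partial i phi x +
     H (rho x) * partial i (partial i phi) x) * U x in
  [/\ bms (fun x => H (rho x) * phi x * laplacian U x),
      forall i, bms (flux i), forall i, bms (err i) &
    lint (fun x => H (rho x) * phi x * laplacian U x) =
      \sum_(i < n) (lint (flux i) + lint (err i))].
Proof.
move=> oW cK KW crho cphi cU dHd cdH off flux err.
pose f x := H (rho x) * phi x.
pose g i x := H (rho x) * partial i phi x.
have f0 x : ~ K x -> f x = 0.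
  by move=> /off[[h _]|[h _]]; rewrite /f h ?mul0r ?mulr0.
have g0 i x : ~ K x -> g i x = 0.
  by move=> /off[[h _]|[_ /(_ i)[h _]]]; rewrite /g h ?mul0r ?mulr0.
have p0 (h : 'rV[R]_n -> R) i x : (forall y, ~ K y -> h y = 0) -> ~ K x -> partial i h x = 0.
  by move=> h0 nK; have [_] := near0_partial i (near_off_compact cK h0 nK).
have F i : C1in i W f /\ forall x, W x -> partial i f x =
    dH (rho x) * partial i rho x * phi x + H (rho x) * partial i phi x.
  exact: (layer_product_C1 oW (crho i) (C2on_C1 i cphi).1 dHd cdH).
have G i : C1in i W (g i) /\ forall x, W x -> partial i (g i) x =
    dH (rho x) * partial i rho x * partial i phi x + H (rho x) * partial i (partial i phi) x.
  exact: (layer_product_C1 oW (crho i) (C2on_C1 i cphi).2 dHd cdH).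
have A1 i := lint_by_parts oW cK KW (F i).1 (C2on_C1 i cU).2 f0.
have A2 i := lint_by_parts oW cK KW (G i).1 (C2on_C1 i cU).1 (g0 i).
have fluxE i : flux i = (fun x => g i x * partial i U x - partial i f x * partial i U x).
  apply/funext => x; have [Kx|nK] := pselect (K x).
    by rewrite (F i).2 ?/flux /g; [ring|exact: KW].
  have -> : g i x = 0 by exact: g0.
  have -> : partial i f x = 0 by exact: (p0 f).
  rewrite !mul0r subr0 /flux.
  by case: (off x nK) => [[_ h]|[h _]]; rewrite h ?mulr0 !mul0r oppr0.
have errE i : err i = (fun x => partial i (g i) x * U x).
  apply/funext => x; have [Kx|nK] := pselect (K x).
    by rewrite (G i).2//; exact: KW.
  rewrite (p0 (g i))//; last exact: g0.
  rewrite mul0r /err.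
  by case: (off x nK) => [[h1 h2]|[_ /(_ i)[h1 h2]]]; rewrite h1 h2; ring.
have lapE : (fun x => H (rho x) * phi x * laplacian U x) =
    (fun x => \sum_(i < n) f x * partial i (partial i U) x).
  by apply/funext => x; rewrite /laplacian mulr_sumr.
have bflux i : bms (flux i).
  by rewrite fluxE; apply: bmsB; [have [] := A2 i|have [] := A1 i].
split => //.
- by rewrite lapE; apply: bms_sum => i; have [] := A1 i.
- by move=> i; rewrite errE; have [] := A2 i.
rewrite lapE lint_sum; last by move=> i; have [] := A1 i.
apply: eq_bigr => i _; have [_ b1 e1] := A1 i; have [b2 b3 e2] := A2 i.
by rewrite fluxE errE lintB// e1 e2; ring.
Qed.

(** The test function is [H(rho) phi] divided by the mass of the layer, with [phi] a
    bump centred at [zp], on the inner normal at [z]. Of the error terms, the one that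
    contains [dH], of size 1/d, has a sign: [dH <= 0], and [phi] decreases in the
    direction of the gradient of [rho] ([bump_slope]). The other one is
    bounded independently of [d]. *)
Lemma boundary_test R n (D : set 'rV[R]_n) nu z e r eps rho :
  open D -> flat_chart D nu z e r eps rho ->
  exists M d0 : R, [/\ 0 <= M, 0 < d0 & forall d : R, 0 < d <= d0 ->
    exists (Phi : 'rV[R]_n -> R) (K : set 'rV[R]_n),
    [/\ compact K /\ K `<=` D, forall x, 0 <= Phi x <= M, forall x, ~ K x -> Phi x = 0,
        {within K, continuous Phi} &
      forall (U : 'rV[R]_n -> R) (B : R), C2on D U -> (forall x, D x -> 0 <= U x) ->
        bms (fun x => \1_D x * U x) ->
        (forall x, `|x - z| <= 3 * (r / 4) -> - (2 * d) <= rho x <= - d ->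
           B <= \sum_(i < n) partial i rho x * partial i U x) ->
        B - M * lint (fun x => \1_D x * U x) <= lint (fun x => Phi x * laplacian U x)]].
Proof.
move=> oD fc; have [[r0 ee] ch eps0 neps bz] := fc.
pose tau := r / 4.
have tau0 : 0 < tau by rewrite divr_gt0.
have ab : 3 * tau ^+ 2 < 4 * tau ^+ 2 by rewrite ltr_pM2r ?exprn_gt0//; lra.
have [xi [x1 [x2 [dxi dx1 cx2 [xi01 x1le] [xia xib xab _]]]]] := cutoff_exists ab.
pose zp := z - tau *: e.
have [P2 Pd Pl] := radial_C2 zp dxi dx1 cx2.
pose phi : 'rV[R]_n -> R := xi \o sqdist zp.
have c2 W : C2on W phi by exact: P2.
pose K0 := [set x : 'rV[R]_n | sqdist zp x <= 4 * tau ^+ 2].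
have cK0 : compact K0 by apply: compact_sqball; rewrite mulr_ge0// sqr_ge0.
have K0z x : K0 x -> `|x - z| <= 3 * tau by apply: sqball_shifted => //; exact: ltW.
have t3 : 3 * tau < r by rewrite /tau; lra.
have K0r x : K0 x -> `|x - z| < r by move=> /K0z h; exact: le_lt_trans t3.
have phiK x : ~ K0 x -> phi x = 0.
  by move=> /negP; rewrite -ltNge => h; rewrite /phi/= xib// ltW.
have phi1K i x : ~ K0 x -> partial i phi x = 0.
  by move=> nK; have [_] := near0_partial i (near_off_compact cK0 phiK nK).
have phi2K i x : ~ K0 x -> partial i (partial i phi) x = 0.
  move=> nK; by have [_] := near0_partial i (near_off_compact cK0 (phi1K i) nK).
have claplace : {within K0, continuous (laplacian phi)}.
  apply: within_for => x K0x; apply: cont_sum => i.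
  by have [_ /(_ i)[]] := c2 K0 x K0x.
have [ML ML0 hML] := compact_within_bounded cK0 claplace.
have [ca [d1 [ca0 d10 hca]]] := layer_mass fc.
exists (ca^-1 + ML / ca), (Num.min d1 (r / 16)); split.
- by apply: addr_ge0; [rewrite invr_ge0 ltW|apply: mulr_ge0 => //; rewrite invr_ge0 ltW].
- by rewrite lt_min d10/=; lra.
move=> d /andP[dp]; rewrite le_min => /andP[dd1 dr].
have dd : - (2 * d) < - d by lra.
have [H [dH [ddH [dHd dHd2 cdH [H01 dHle] [Ha Hb Hab _]]]]] := cutoff_exists dd.
have cdH1 := is_derive_continuous dHd2.
have cH := is_derive_continuous dHd.
pose K := K0 `&` [set x | rho x <= - d].
have [h1 h2 h3] := ch.
have crho : {within K0, continuous rho}.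
  by apply: within_for => x /K0r/h1[].
have cK : compact K by exact: compact_sublevel.
have KD : K `<=` D.
  by move=> x [/K0r/h2[hD _] /= rx]; apply/hD; clear - rx dp; lra.
pose W := D `&` [set x | `|x - z| < r].
have oW : open W by apply: openI => //; exact: open_norm_lt.
have KW : K `<=` W by move=> x Kx; split; [exact: KD|apply: K0r; case: Kx].
have off x : ~ K x -> H (rho x) = 0 /\ dH (rho x) = 0 \/
     phi x = 0 /\ forall i, partial i phi x = 0 /\ partial i (partial i phi) x = 0.
  move=> nK; have [K0x|nK0] := pselect (K0 x); last first.
    by right; split; [exact: phiK|move=> i; split; [exact: phi1K|exact: phi2K]].
  have rx : - d <= rho x by rewrite leNgt; apply/negP => h; apply: nK; split => //=; exact: ltW.
  by left; split; [exact: Hb|have [] := Hab _ (or_intror rx)].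
pose f x := H (rho x) * phi x.
pose w x := phi x * - dH (rho x).
have w0 x : 0 <= w x.
  by apply: mulr_ge0; [have /andP[] := xi01 (sqdist zp x)|rewrite oppr_ge0].
have wK x : ~ K x -> w x = 0.
  by move=> /off[[_ h]|[h _]]; rewrite /w h ?oppr0 ?mulr0 ?mul0r.
have bw : bms w.
  apply: (bms_open cK KW) => // x Wx; apply: contM; first by have [] := c2 W x Wx.
  by apply: contN; apply: (@cont_comp _ _ _ rho dH); [have [] := h1 x Wx.2|exact: cdH1].
have aw : ca <= lint w.
  apply: (hca H dH d) => //.
  - by rewrite dp.
  - by move=> s; have /andP[] := H01 s.
  - by move=> s hs; split; [exact: Hb|have [] := Hab _ (or_intror hs)].
  - by move=> x; have /andP[] := xi01 (sqdist zp x).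
  - by move=> x _ _ h; exact: xia.
have a0 : 0 < lint w by exact: lt_le_trans aw.
have ia : (lint w)^-1 <= ca^-1 by rewrite lef_pV2.
have ia0 : 0 < (lint w)^-1 by rewrite invr_gt0.
have f01 x : 0 <= f x <= 1.
  have /andP[a1 a2] := H01 (rho x); have /andP[a3 a4] := xi01 (sqdist zp x).
  by rewrite /f mulr_ge0//= -[1]mulr1 ler_pM.
exists (fun x => (lint w)^-1 * f x), K; split => //.
- move=> x; have /andP[f0 f1] := f01 x; rewrite mulr_ge0 ?(ltW ia0)//=.
  apply: (@le_trans _ _ ca^-1); last by rewrite lerDl mulr_ge0// invr_ge0 ltW.
  by rewrite -[ca^-1]mulr1 ler_pM// ltW.
- by move=> x /off[[h _]|[h _]]; rewrite /f h ?mul0r ?mulr0.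
- apply: within_for => x Kx; apply: contM; first exact: contC.
  apply: contM; last by have [] := c2 W x (KW x Kx).
  by apply: (@cont_comp _ _ _ rho H); [have [] := h1 x (KW x Kx).2|exact: cH].
move=> U B cU U0 bU hB.
have crW i : C1in i W rho by apply: (C1in_sub (W := [set x | `|x - z| < r])) (chart_C1 fc i) => x [].
have cUW : C2on W U by apply: (C2on_sub (W := D)) cU => x [].
have [bl bflux berr E] := layer_identity oW cK KW crW (c2 W) cUW dHd cdH1 off.
have eqf : lint (fun x => (lint w)^-1 * f x * laplacian U x) =
    (lint w)^-1 * lint (fun x => f x * laplacian U x).
  by rewrite -lintZ//; apply: eq_lint => x; rewrite mulrA.
rewrite eqf; have -> : lint (fun x => f x * laplacian U x) = _ := E.
rewrite big_split/= -lint_sum// -lint_sum//.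
set Fl := lint (fun x => \sum_(i < n) - (dH (rho x) * partial i rho x * phi x * partial i U x)).
set Er := lint (fun x => \sum_(i < n) (dH (rho x) * partial i rho x * partial i phi x +
  H (rho x) * partial i (partial i phi) x) * U x).
have hFl : B * lint w <= Fl.
  rewrite -lintZ//; apply: le_lint; [exact: bmsZ|by apply: bms_sum|move=> x].
  have [Kx|nK] := pselect (K x); last first.
    rewrite wK// mulr0 big1// => i _.
    by case: (off x nK) => [[_ h]|[h _]]; rewrite h ?mulr0 !mul0r oppr0.
  rewrite (_ : \sum_(i < n) _ = w x * \sum_(i < n) partial i rho x * partial i U x); last first.
    by rewrite mulr_sumr; apply: eq_bigr => i _; rewrite /w; ring.
  have [rd|rd] := leP (- (2 * d)) (rho x); last first.
    by rewrite /w (proj1 (Hab _ (or_introl (ltW rd)))) oppr0 !mulr0 mul0r.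
  rewrite mulrC; apply: ler_wpM2l => //; apply: hB; first by apply: K0z; case: Kx.
  by rewrite rd/=; case: Kx.
have hEr : - ML * lint (fun x => \1_D x * U x) <= Er.
  rewrite -lintZ//; apply: le_lint; [exact: bmsZ|by apply: bms_sum|move=> x].
  have [Kx|nK] := pselect (K x); last first.
    rewrite big1; last first.
      move=> i _; case: (off x nK) => [[a1 a2]|[_ /(_ i)[a1 a2]]]; rewrite a1 a2; ring.
    rewrite mulNr oppr_le0 mulr_ge0// indicE; case: (boolP (_ \in _)) => [/set_mem Dx|_]; last by rewrite mul0r.
    by rewrite mul1r U0.
  have Dx := KD x Kx.
  rewrite indicE mem_set// mul1r -mulr_suml; apply: ler_wpM2r; first exact: U0.
  rewrite big_split/= -mulr_sumr -/(laplacian phi x).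
  have t1 : - ML <= H (rho x) * laplacian phi x.
    have := hML x Kx.1; have /andP[a1 a2] := H01 (rho x) => hl.
    have : `|H (rho x) * laplacian phi x| <= ML by rewrite normrM ger0_norm// -[ML]mul1r ler_pM.
    by rewrite ler_norml => /andP[].
  have [rd|rd] := leP (- (2 * d)) (rho x); last first.
    rewrite big1 ?add0r// => i _.
    by rewrite (proj1 (Hab _ (or_introl (ltW rd)))) !mul0r.
  have t2 : 0 <= \sum_(i < n) dH (rho x) * partial i rho x * partial i phi x.
    have S0 := @bump_slope R n D nu z e r eps rho x fc (K0z x Kx.1).
    have {}S0 := S0 ltac:(clear - rd dr; lra).
    rewrite (_ : \sum_(i < n) _ = dH (rho x) * x1 (sqdist zp x) * 2 *
       \sum_(i < n) partial i rho x * (x 0 i - zp 0 i)); last first.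
      by rewrite mulr_sumr; apply: eq_bigr => i _; rewrite Pd; ring.
    by apply: mulr_ge0 => //; apply: mulr_ge0 => //; rewrite mulr_le0.
  clear - t1 t2; lra.
have F0 : 0 <= lint (fun x => \1_D x * U x).
  apply: lint_ge0 => x; rewrite indicE; case: (boolP (_ \in _)) => [/set_mem Dx|_]; last by rewrite mul0r.
  by rewrite mul1r U0.
rewrite mulrDr; apply: lerD.
  by rewrite mulrC ler_pdivlMr.
rewrite -mulNr; apply: (@le_trans _ _ ((lint w)^-1 * (- ML * lint (fun x => \1_D x * U x)))); last exact: ler_wpM2l (ltW ia0) _ _ hEr.
rewrite mulrA ler_wpM2r// mulrN lerN2 mulrC.
apply: (@le_trans _ _ (ML / ca)); first exact: ler_wpM2l.
by rewrite lerDr invr_ge0 ltW.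
Qed.

(** * The boundary functional *)

(** What the argument retains of a solution: absorption and boundary kernel enter
    through an upper bound [Mc] and a lower bound [k0]. *)
Definition flux_solution R n (D : set 'rV[R]_n) (nu : 'rV[R]_n -> 'rV[R]_n)
    (p l Mc k0 T : R) (u : 'rV[R]_n -> R -> R) : Prop :=
  [/\ [/\ open D, bounded_set D, smooth_boundary D & outward_unit_normal D nu],
      C21 D T u /\ C10_closure D T u,
      forall x t, closure D x -> 0 <= t < T -> 0 <= u x t,
      forall x t, D x -> 0 < t < T ->
        laplacian (u ^~ t) x - Mc * u x t `^ p <= derive1 (u x) t <= laplacian (u ^~ t) x &
      forall x t, boundary D x -> 0 < t < T -> exists2 d : R,
        is_normal_derivative nu (u ^~ t) x d & k0 * lint (fun y => \1_D y * u y t `^ l) <= d].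

Lemma compact_closure_bounded R n (D : set 'rV[R]_n) :
  bounded_set D -> compact (closure D).
Proof.
move=> [M [Mr hM]]; apply: bounded_closed_compact; last exact: closed_closure.
pose M1 := `|M| + 1.
have h x : closure D x -> `|x| <= M1.
  move=> cx; rewrite leNgt; apply/negP => xM.
  have [|y [Dy xy]] := cx (ball x (`|x| - M1)); first by apply: nbhsx_ballx; rewrite subr_gt0.
  have := hM M1; rewrite /M1 ltr_pwDr ?ler_norm// => /(_ isT y Dy)/= yM.
  move: xy; rewrite -ball_normE/= => xy.
  have : `|x| <= `|x - y| + `|y| by rewrite -{1}(subrK y x) ler_normD.
  rewrite /M1 in xM xy *; lra.
exists M1; split; first exact: num_real.
by move=> N MN x /h hx; apply: le_trans hx _; exact: ltW.
Qed.

Lemma bms_closure R n (D : set 'rV[R]_n) (f : 'rV[R]_n -> R) :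
  open D -> bounded_set D -> {within closure D, continuous f} -> bms (fun x => \1_D x * f x).
Proof.
move=> oD bD cf.
have [M M0 hM] := compact_within_bounded (compact_closure_bounded bD) cf.
apply: (@bms_within _ _ D _ M) => //.
- exact: open_row_measurable.
- apply: (@subspace_eq_continuous _ _ _ f).
    by move=> x xD; rewrite /from_subspace/= indicE xD mul1r.
  exact: continuous_subspaceW (@subset_closure _ D) cf.
- by move=> x nD; rewrite indicE memNset// mul0r.
- by move=> x Dx; rewrite indicE mem_set// mul1r hM//; exact: subset_closure.
Qed.

Lemma within_slice R (V : normedModType R) (A : set V) (I : set R) (f : V * R -> R) (t : R) :
  {within A `*` I, continuous f} -> I t -> {within A, continuous (fun x => f (x, t))}.
Proof.
move=> cf It; apply/within_epsP => x Ax e e0.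
have [d d0 hd] := (within_epsP _ f).1 cf (x, t) (conj Ax It) e e0.
exists d => // y Ay yx; apply: hd => //.
by rewrite prod_normE/= subrr normr0 gt_max yx.
Qed.

Lemma C10_slice R n (D : set 'rV[R]_n) (T t : R) (u : 'rV[R]_n -> R -> R) :
  C10_closure D T u -> 0 <= t < T -> {within closure D, continuous (u ^~ t)}.
Proof.
move=> [cu _] tT; apply: (within_slice (f := fun z => u z.1 z.2) cu).
by rewrite /= in_itv.
Qed.

Lemma open_itv_set R (a b : R) : open [set` `]a, b[].
Proof. exact: interval_open. Qed.

Lemma C21_C2on R n (D : set 'rV[R]_n) (T t : R) (u : 'rV[R]_n -> R -> R) :
  open D -> C21 D T u -> 0 < t < T -> C2on D (u ^~ t).
Proof.
move=> oD [cu [du cdu] h1 h2] tT x Dx.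
pose Q : set ('rV[R]_n * R) := D `*` [set` `]0, T[].
have oQ : open Q by apply: open_prod => //; exact: open_itv_set.
have It : [set` `]0, T[] t by rewrite /= in_itv.
have Qx : Q (x, t) by [].
have sl (f : 'rV[R]_n * R -> R) : {within Q, continuous f} -> {for x, continuous (fun y => f (y, t))}.
  move=> cf; apply: (@cont_comp _ _ _ (fun y => (y, t)) f); first exact: cont_pairl.
  exact: (continuous_within_open oQ Qx).
split; first exact: (sl (fun z => u z.1 z.2)).
move=> i; have [p1 c1] := h1 i; have [p2 c2] := h2 i i.
split; [exact: p1|exact: (sl (fun z => partial i (u^~ z.2) z.1))|exact: p2|].
exact: (sl (fun z => partial i (partial i (u^~ z.2)) z.1)).
Qed.

Lemma flux_subcaloric R n (D W : set 'rV[R]_n) (nu : 'rV[R]_n -> 'rV[R]_n)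
    (p l Mc k0 T : R) (u : 'rV[R]_n -> R -> R) :
  flux_solution D nu p l Mc k0 T u -> open W -> W `<=` D -> subcaloric W 0 T u.
Proof.
move=> [[oD bD _ _] [c21 c10] u0 eqn _] oW WD.
have [cu [du cdu] _ _] := c21.
have sub : W `*` [set` `]0, T[] `<=` D `*` [set` `]0, T[] by move=> [x t] [/= /WD].
split.
- by move=> t tT; apply: C2on_sub WD _; exact: C21_C2on c21 tT.
- by move=> x t /WD Dx tT; apply: du; split => //=; rewrite in_itv.
- by split; [exact: continuous_subspaceW sub cu|exact: continuous_subspaceW sub cdu].
- move=> x t /WD Dx /andP[t0 tT]; apply: u0; first exact: subset_closure.
  by rewrite tT ltW.
- by move=> x t /WD Dx tT; have /andP[] := eqn x t Dx tT.
Qed.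

(** The gradient extends continuously to the boundary, uniformly for times in a
    compact interval, and every point of a thin layer is close to a boundary point
    where the normal derivative is prescribed. *)
Lemma layer_flux R n (D : set 'rV[R]_n) nu p l Mc k0 T u z e r eps rho (t1 t2 : R) :
  flux_solution D nu p l Mc k0 T u -> 0 <= k0 -> flat_chart D nu z e r eps rho ->
  0 < t1 -> t2 < T ->
  exists2 d1 : R, 0 < d1 & forall d t x, 0 < d <= d1 -> t1 <= t <= t2 ->
    `|x - z| <= 3 * (r / 4) -> - (2 * d) <= rho x <= - d ->
    k0 / 2 * lint (fun y => \1_D y * u y t `^ l) - 1 <=
      \sum_(i < n) partial i rho x * partial i (u ^~ t) x.
Proof.
move=> [[oD bD sb hnu] [c21 c10] u0 eqn flx] k00 fc t10 t2T.
have [[r0 ee] ch eps0 neps bz] := fc; have [h1 h2 h3] := ch.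
have [cu /choice[g hg]] := c10.
pose K0 := [set x : 'rV[R]_n | `|x - z| <= 7 * (r / 8)].
have K0r x : K0 x -> `|x - z| < r by rewrite /K0/= => h; apply: le_lt_trans h _; lra.
have cK0 : compact K0.
  apply: bounded_closed_compact.
    exists (7 * (r / 8) + `|z|); split; first exact: num_real.
    move=> N hN x /= hx; apply: le_trans (ltW hN).
    by rewrite -[x in leLHS](subrK z) (le_trans (ler_normD _ _))// lerD2r.
  rewrite (_ : K0 = (fun x => `|x - z|) @^-1` [set s | s <= 7 * (r / 8)])//.
  apply: closed_comp; last exact: closed_le.
  move=> x _; apply: (@cont_comp _ _ _ (fun x : 'rV[R]_n => x - z) (fun y : 'rV[R]_n => `|y|)); last exact: norm_continuous.
  exact: (cvgB cvg_id (cvg_cst _)).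
have crho : {within K0, continuous rho} by apply: within_for => x /K0r/h1[].
pose K := K0 `&` [set x | rho x <= 0].
have cK : compact K by exact: compact_sublevel.
have Kcl x : K x -> closure D x.
  move=> [/K0r xr /= rx]; have [hD hB] := h2 x xr.
  move: rx; rewrite le_eqVlt => /predU1P[/hB[]//|/hD]; exact: subset_closure.
pose I := [set` `[t1, t2]] : set R.
have cI : compact I by exact: segment_compact.
have cKI : compact (K `*` I) by exact: compact_setX.
pose P (w : 'rV[R]_n * R) := \sum_(i < n) partial i rho w.1 * g i w.
have sub : K `*` I `<=` closure D `*` [set` `[0, T[].
  move=> [x t] [/= /Kcl cx]; rewrite /I/= !in_itv/= => /andP[a b].
  by split => //; rewrite (le_trans (ltW t10) a) (le_lt_trans b).
have cP : {within K `*` I, continuous P}.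
  have cpr i : {within K `*` I, continuous (fun w : 'rV[R]_n * R => partial i rho w.1)}.
    apply: within_for => -[x t] [/= [/K0r xr _] _].
    apply: (@cont_comp _ _ _ fst (partial i rho)); first exact: cvg_fst.
    by have [_ /(_ i)[]] := h1 x xr.
  have cgi i : {within K `*` I, continuous (g i)}.
    by apply: continuous_subspaceW sub _; have [] := hg i.
  move=> w; apply: cont_sum => i; apply: contM; [exact: cpr|exact: cgi].
have [dl dl0 hdl] := compact_uniformly_continuous cKI cP ltr01.
exists (Num.min (dl / 8) (r / 32)); first by rewrite lt_min !divr_gt0.
move=> d t x /andP[d0]; rewrite le_min => /andP[d8 dr] /andP[t1t tt2] xz /andP[rx1 rx2].
have tT : 0 < t < T by rewrite (lt_le_trans t10 t1t) (le_lt_trans tt2).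
have en := unit_norm_le1 ee.
pose y s := x + s *: e.
have ys s : 0 <= s <= 4 * d -> `|y s - z| <= 7 * (r / 8) /\ `|x - y s| <= s.
  move=> /andP[s0 s4].
  have hs : `|s *: e| <= s by rewrite normrZ (ger0_norm s0) ler_piMr.
  split; last by rewrite /y opprD addrA subrr add0r normrN.
  have -> : y s - z = (x - z) + s *: e by rewrite /y addrAC.
  apply: (le_trans (ler_normD _ _)); clear - xz hs s4 dr; lra.
(* [rho] grows along [e] at a rate of at least 1 - 1/24, hence vanishes before 4 d *)
have [s /andP[s0 s4] ry] : exists2 s, 0 <= s <= 4 * d & rho (y s) = 0.
  have c : {within `[0, 4 * d], continuous (rho \o y)}.
    apply: within_for => s; rewrite /= in_itv/= => /ys[/K0r yr _].
    apply: (@cont_comp _ _ _ y rho); last by have [] := h1 _ yr.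
    apply: (@continuousD R _ _ (fun=> x) (fun s : R => s *: e)); first exact: cvg_cst.
    exact: scalel_continuous.
  have d40 : 0 <= 4 * d by clear - d0; lra.
  have [|s sI] := @IVT _ (rho \o y) 0 (4 * d) 0 d40 c; last first.
    by rewrite in_itv/= in sI => hs; exists s.
  have y0 : rho (y 0) = rho x by rewrite /y scale0r addr0.
  have [] := ys (4 * d) _; first by rewrite d40 lexx.
  have v4 : `|(4 * d) *: e| <= 4 * d by rewrite normrZ (ger0_norm d40) ler_piMr.
  have := @chart_increment _ _ D nu z e r eps rho x ((4 * d) *: e) fc.
  move=> hh; have {}hh := hh ltac:(clear - xz v4 dr r0; lra).
  have e1 : n%:R * eps * `|(4 * d) *: e| <= 24^-1 * (4 * d).
    by apply: ler_pM => //; apply: mulr_ge0 => //; exact: ltW.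
  move: hh; rewrite dotC dotZl ee mulr1 ler_distl => /andP[hh _] _ _.
  rewrite /= y0 ge_min le_max; apply/andP; split; apply/orP; [left|right]; rewrite /y; clear - rx1 rx2 hh e1 d0; lra.
have [yz xy] := ys s ltac:(by rewrite s0).
have rx0 : rho x <= 0 by clear - rx2 d0; lra.
have Kx : K x by split => //; rewrite /K0/=; clear - xz r0; lra.
have Ky : K (y s) by split => //=; rewrite ry.
have It : I t by rewrite /I/= in_itv/= t1t.
have Dx : D x by apply/(h2 x (K0r x Kx.1)).1; clear - rx2 d0; lra.
have by_ : boundary D (y s) by apply/(h2 _ (K0r _ Ky.1)).2.
have [dd hdd kd] := flx _ t by_ tT.
have tT' : 0 <= t < T by case/andP: tT => /ltW -> ->.
have It' : [set` `[0, T[] t by rewrite /= in_itv.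
have ddE : dd = \sum_(i < n) nu (y s) 0 i * g i (y s, t).
  apply: (@normal_derivativeE _ _ D nu (u ^~ t) (fun i x => g i (x, t))) hdd => //.
  - exact: C10_slice tT'.
  - by move=> i; have [ci _] := hg i; exact: within_slice ci It'.
  - by move=> i w Dw; have [_] := hg i; apply.
  - by move=> i w Dw; have [_ /(_ i)[]] := C21_C2on oD c21 tT Dw.
have [lam lam2 hlam] := h3 _ (K0r _ Ky.1) by_.
have Py : P (y s, t) = lam * dd.
  by rewrite ddE mulr_sumr; apply: eq_bigr => i _; rewrite /= hlam mulrA.
have F0 : 0 <= lint (fun y => \1_D y * u y t `^ l).
  apply: lint_ge0 => w; apply: mulr_ge0; last exact: powR_ge0.
  by rewrite indicE.
have := hdl (x, t) (y s, t) (conj Kx It) (conj Ky It).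
rewrite prod_normE/= subrr normr0 gt_max dl0 andbT => /(_ ltac:(clear - xy s4 d8 dl0; lra)).
have -> : P (x, t) = \sum_(i < n) partial i rho x * partial i (u ^~ t) x.
  by apply: eq_bigr => i _; have [_ /(_ x t Dx tT')[_ ->]] := hg i.
rewrite Py ltr_distl => /andP[hP _].
have kF : 0 <= k0 * lint (fun y => \1_D y * u y t `^ l) by exact: mulr_ge0.
have : 2^-1 * (k0 * lint (fun y => \1_D y * u y t `^ l)) <= lam * dd by apply: ler_pM.
clear - hP; lra.
Qed.

Lemma within_fst R (V W : normedModType R) (A : set V) (B : set W) (f : V -> R) :
  {within A, continuous f} -> {within A `*` B, continuous (fun w : V * W => f w.1)}.
Proof.
move=> cf; apply/within_epsP => -[x y] [/= Ax _] e e0.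
have [d d0 hd] := (within_epsP A f).1 cf x Ax e e0.
exists d => // -[x' y'] [/= Ax' _]; rewrite prod_normE/= gt_max => /andP[h _].
exact: hd.
Qed.

Lemma contM_within R (T : topologicalType) (A : set T) (f g : T -> R) :
  {within A, continuous f} -> {within A, continuous g} -> {within A, continuous (fun x => f x * g x)}.
Proof. by move=> cf cg x; apply: contM; [exact: cf|exact: cg]. Qed.

Lemma bms_slice_powR R n (D : set 'rV[R]_n) nu p l Mc k0 T u (t q : R) :
  flux_solution D nu p l Mc k0 T u -> 0 <= t < T -> 0 < q ->
  bms (fun x => \1_D x * u x t `^ q).
Proof.
move=> [[oD bD _ _] [_ c10] u0 _ _] tT q0.
have b1 := bms_closure oD bD (C10_slice c10 tT).
have p0 x : 0 <= \1_D x * u x t.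
  rewrite indicE; case: (boolP (_ \in _)) => [/set_mem Dx|_]; last by rewrite mul0r.
  by rewrite mul1r u0//; exact: subset_closure.
rewrite (_ : (fun x => _) = (fun x => (\1_D x * u x t) `^ q)); first exact: bms_powR.
apply/funext => x; rewrite indicE; case: (_ \in _); first by rewrite !mul1r.
by rewrite !mul0r powR0// gt_eqF.
Qed.

Lemma lint_indic_le R n (D : set 'rV[R]_n) (f g : 'rV[R]_n -> R) (a b : R) :
  bms (\1_D : 'rV[R]_n -> R) -> bms (fun x => \1_D x * f x) -> bms (fun x => \1_D x * g x) ->
  (forall x, D x -> f x <= a * g x + b) ->
  lint (fun x => \1_D x * f x) <= a * lint (fun x => \1_D x * g x) + b * lint (\1_D : 'rV[R]_n -> R).
Proof.
move=> bD bf bg fg; rewrite -!lintZ// -lintD; [|exact: bmsZ|exact: bmsZ].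
apply: le_lint => //; first by apply: bmsD; exact: bmsZ.
move=> x; rewrite indicE; case: (boolP (_ \in _)) => [/set_mem /fg h|_]; last by rewrite !mul0r !mulr0 addr0.
by rewrite !mul1r mulr1.
Qed.

(** Jensen's inequality up to a constant, by the choice of [lam] that makes the
    second summand equal to m/2. *)
Lemma powR_le_of_linear_bounds R (l A V F m : R) : 1 < l -> 0 < A -> 0 < V -> 0 <= F -> 0 <= m ->
  (forall lam : R, 0 < lam -> m <= A * (lam `^ (1 - l) * F + lam * V)) ->
  m `^ l <= 2 * A * (2 * A * V) `^ (l - 1) * F.
Proof.
move=> l1 A0 V0 F0; rewrite le_eqVlt => /predU1P[<-|m0] h.
  by rewrite powR0 ?gt_eqF//; [rewrite !mulr_ge0 ?powR_ge0// ltW|lra].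
have a0 : 0 < 2 * A * V by rewrite !mulr_gt0.
pose lam := m / (2 * A * V).
have lam0 : 0 < lam by rewrite divr_gt0.
have := h lam lam0.
have -> : A * (lam `^ (1 - l) * F + lam * V) = A * lam `^ (1 - l) * F + m / 2.
  by rewrite /lam; field; rewrite !gt_eqF.
move=> h1; have h2 : m <= 2 * A * lam `^ (1 - l) * F by lra.
have -> : m `^ l = m * m `^ (l - 1) by rewrite mulr_powRB1//; lra.
have e1 : lam `^ (1 - l) * m `^ (l - 1) = (2 * A * V) `^ (l - 1).
  have -> : lam `^ (1 - l) = (lam `^ (l - 1))^-1 by rewrite -powRN opprB.
  have -> : m = lam * (2 * A * V) by rewrite /lam mulfVK// gt_eqF.
  by rewrite powRM ?ltW// mulrA mulVf ?mul1r// gt_eqF// powR_gt0.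
have := powR_ge0 m (l - 1) => hm.
apply: (le_trans (ler_wpM2r hm h2)).
by rewrite -e1; lra.
Qed.

(** [m] is the mass of [u] weighted by [boundary_test], whose layer has to be
    thinner the closer [t2] is to [T]; the point is that [c1] and [C1] do not
    depend on [t1] and [t2]. By Young's inequality half of the boundary source
    absorbs the mass of [u] and the absorption term. *)
Lemma boundary_functional R n (D : set 'rV[R]_n.+1) nu p l Mc k0 T u :
  flux_solution D nu p l Mc k0 T u -> D !=set0 -> 0 < p -> p < l -> 1 < l -> 0 <= Mc -> 0 < k0 ->
  let F t := lint (fun x => \1_D x * u x t `^ l) in
  exists c1 C1 : R, [/\ 0 < c1, 0 <= C1,
    forall t, 0 <= t < T -> lint (fun x => \1_D x * u x t) <= F t + C1 &
    forall t1 t2, 0 < t1 -> t2 < T -> exists m dm : R -> R, forall t, t1 <= t <= t2 ->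
      [/\ 0 <= m t, is_derive t (1 : R) m (dm t), c1 * F t - C1 <= dm t & c1 * m t `^ l <= F t]].
Proof.
move=> fs D0 p0 pl l1 Mc0 k00 F.
have [[oD bD sb hnu] [c21 c10] u0 eqn flx] := fs.
have l0 : 0 < l by lra.
have [z bz] := boundary_nonempty oD bD D0.
pose eps : R := (24 * n.+1%:R)^-1.
have eps0 : 0 < eps by rewrite invr_gt0 mulr_gt0.
have neps : n.+1%:R * eps = 24^-1 by rewrite /eps; field; rewrite gt_eqF.
have [|e [r [rho [r0 ee ch]]]] := chart_exists hnu sb bz eps0; first by rewrite neps; lra.
have fc : flat_chart D nu z e r eps rho by split => //; rewrite neps.
have [M [d0 [M0 d00 test]]] := boundary_test oD fc.
have bI : bms (\1_D : 'rV[R]_n.+1 -> R) by apply: bms_indic => //; exact: open_row_measurable.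
pose V := lint (\1_D : 'rV[R]_n.+1 -> R).
have V0 : 0 <= V by apply: lint_ge0 => x; rewrite indicE.
have bsl t q : 0 <= t < T -> 0 < q -> bms (fun x => \1_D x * u x t `^ q).
  by move=> tT q0; exact: bms_slice_powR fs tT q0.
have bs1 t : 0 <= t < T -> bms (fun x => \1_D x * u x t).
  by move=> tT; exact: bms_closure oD bD (C10_slice c10 tT).
have uD x t : D x -> 0 <= t < T -> 0 <= u x t.
  by move=> Dx tT; apply: u0 => //; exact: subset_closure.
have F0 t : 0 <= F t by apply: lint_ge0 => x; rewrite mulr_ge0 ?powR_ge0// indicE.
have mass lam t : 0 < lam -> 0 <= t < T ->
    lint (fun x => \1_D x * u x t) <= lam `^ (1 - l) * F t + lam * V.
  move=> lam0 tT; apply: lint_indic_le => //; [exact: bs1|exact: bsl|].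
  by move=> x Dx; apply: le_lambda_powR => //; exact: uD.
have e10 : 0 < k0 / (8 * (M + 1)) by rewrite divr_gt0// mulr_gt0//; lra.
have e20 : 0 < k0 / (8 * (M * Mc + 1)).
  by rewrite divr_gt0// mulr_gt0// ltr_wpDl// mulr_ge0.
have [K1 K10 y1] := @powR_young R 1 l _ ltr01 l1 e10.
have [K2 K20 y2] := @powR_young R p l _ p0 pl e20.
pose A := M + 1; pose V1 := V + 1.
have A0 : 0 < A by rewrite /A ltr_wpDl.
have V10 : 0 < V1 by rewrite /V1 ltr_wpDl.
pose C2 := 2 * A * (2 * A * V1) `^ (l - 1).
have C20 : 0 < C2 by rewrite mulr_gt0 ?powR_gt0 ?mulr_gt0.
pose C1 := V + 1 + M * (K1 * V) + M * Mc * (K2 * V).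
have MK1 : 0 <= M * (K1 * V) by rewrite !mulr_ge0.
have MK2 : 0 <= M * Mc * (K2 * V) by rewrite !mulr_ge0.
exists (Num.min (k0 / 4) C2^-1), C1; split.
- by rewrite lt_min divr_gt0// invr_gt0.
- by rewrite /C1; clear - V0 MK1 MK2; lra.
- by move=> t tT; have := mass 1 t ltr01 tT; rewrite powR1 !mul1r /C1; clear - V0 MK1 MK2; lra.
move=> t1 t2 t10 t2T.
have [d1 d10 hflux] := layer_flux fs (ltW k00) fc t10 t2T.
pose d := Num.min d0 d1.
have [|Phi [K [[cK KD] Phi01 PhiK cPhi hPhi]]] := test d.
  by rewrite lt_min d00 d10 ge_min lexx.
pose m t := lint (fun x => Phi x * u x t).
pose dm t := lint (fun x => Phi x * derive1 (u x) t).
exists m, dm => t /andP[t1t tt2].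
have tT : 0 < t < T by rewrite (lt_le_trans t10 t1t) (le_lt_trans tt2).
have tT' : 0 <= t < T by case/andP: tT => /ltW -> ->.
have [cu [du cdu] _ _] := c21.
pose Q : set ('rV[R]_n.+1 * R) := D `*` [set` `]0, T[].
have oQ : open Q by apply: open_prod => //; exact: open_itv_set.
have subK : K `*` [set` `]0, T[] `<=` Q by move=> [x s] [/= /KD].
have It s : 0 < s < T -> [set` `]0, T[] s by rewrite /= in_itv.
have cuK s : 0 < s < T -> {within K, continuous (fun x => Phi x * u x s)}.
  move=> sT; apply: contM_within => //.
  have := within_slice (f := fun z => u z.1 z.2) (continuous_subspaceW subK cu) (It s sT); exact.
have cduK s : 0 < s < T -> {within K, continuous (fun x => Phi x * derive1 (u x) s)}.
  move=> sT; apply: contM_within => //.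
  have := within_slice (f := fun z => derive1 (u z.1) z.2) (continuous_subspaceW subK cdu) (It s sT); exact.
have bm : bms (fun x => Phi x * u x t).
  by apply: (bms_compact cK (cuK t tT)) => x /PhiK ->; rewrite mul0r.
have bdm : bms (fun x => Phi x * derive1 (u x) t).
  by apply: (bms_compact cK (cduK t tT)) => x /PhiK ->; rewrite mul0r.
have m0 : 0 <= m t.
  apply: lint_ge0 => x; have [Kx|/PhiK ->] := pselect (K x); last by rewrite mul0r.
  by apply: mulr_ge0; [have /andP[] := Phi01 x|apply: uD => //; exact: KD].
have mN : m t <= M * lint (fun x => \1_D x * u x t).
  rewrite -lintZ; last exact: bs1.
  apply: le_lint => //; first by apply: bmsZ; exact: bs1.
  move=> x; have [Kx|/PhiK ->] := pselect (K x).
    rewrite indicE mem_set ?mul1r; last exact: KD.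
    by apply: ler_wpM2r; [apply: uD => //; exact: KD|have /andP[] := Phi01 x].
  rewrite mul0r mulr_ge0//; rewrite indicE; case: (boolP (_ \in _)) => [/set_mem Dx|_]; last by rewrite mul0r.
  by rewrite mul1r uD.
split => //.
- apply: (@is_derive_lint_compact _ _ K (fun t x => Phi x * u x t) (fun t x => Phi x * derive1 (u x) t) t 0 T) => //.
  + by move=> s x _ /PhiK ->; rewrite mul0r.
  + move=> s x sT Kx; have dx : derivable (u x) s 1 by apply: du; split; [exact: KD|exact: It].
    apply: (is_derive_cong (is_deriveZ (Phi x) (derivableP dx))) => //.
    by rewrite derive1E.
  + by move=> s x /PhiK ->; rewrite mul0r.
  apply: contM_within; first exact: (within_fst cPhi).
  exact: (continuous_subspaceW subK cdu).
- have cU := C21_C2on oD c21 tT.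
  have hB := hPhi (u ^~ t) (k0 / 2 * F t - 1) cU (fun x Dx => uD x t Dx tT') (bs1 t tT').
  have {}hB := hB ltac:(by move=> x xz rx; apply: (hflux d) => //; [rewrite lt_min d00 d10 ge_min lexx orbT|rewrite t1t]).
  have bl : bms (fun x => Phi x * laplacian (u ^~ t) x).
    apply: (bms_compact cK) => [|x /PhiK ->]; last by rewrite mul0r.
    apply: contM_within => //; apply: within_for => x Kx; apply: cont_sum => i.
    by have [_ /(_ i)[]] := cU x (KD x Kx).
  have n1 : lint (fun x => \1_D x * u x t) <= k0 / (8 * (M + 1)) * F t + K1 * V.
    apply: lint_indic_le => //; [exact: bs1|exact: bsl|].
    by move=> x Dx; have := y1 _ (uD x t Dx tT'); rewrite powRr1 ?uD.
  have n2 : lint (fun x => \1_D x * u x t `^ p) <= k0 / (8 * (M * Mc + 1)) * F t + K2 * V.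
    apply: lint_indic_le => //; [exact: bsl|exact: bsl|].
    by move=> x Dx; exact: y2 (uD x t Dx tT').
  have dmge : lint (fun x => Phi x * laplacian (u ^~ t) x) - M * Mc * lint (fun x => \1_D x * u x t `^ p) <= dm t.
    rewrite -lintZ; last exact: bsl.
    rewrite -lintB//; last by apply: bmsZ; exact: bsl.
    apply: le_lint => //; first by apply: bmsB => //; apply: bmsZ; exact: bsl.
    move=> x; have [Kx|/PhiK ->] := pselect (K x); last first.
      by rewrite !mul0r sub0r oppr_le0 !mulr_ge0 ?powR_ge0// indicE.
    have Dx := KD x Kx; have /andP[eq1 _] := eqn x t Dx tT.
    have /andP[ph0 phM] := Phi01 x.
    rewrite indicE mem_set// mul1r.
    have := ler_wpM2l ph0 eq1; rewrite mulrBr.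
    have : Phi x * (Mc * u x t `^ p) <= M * Mc * u x t `^ p.
      by rewrite mulrA; apply: ler_wpM2r; [exact: powR_ge0|exact: ler_wpM2r].
    clear; lra.
  have q1 : M * (k0 / (8 * (M + 1)) * F t) <= k0 / 8 * F t.
    rewrite mulrA; apply: ler_wpM2r => //.
    have -> : M * (k0 / (8 * (M + 1))) = (k0 / 8) * (M / (M + 1)) by field; rewrite gt_eqF.
    by rewrite ler_piMr ?divr_ge0 ?(ltW k00)// ler_pdivrMr// mul1r lerDl.
  have q2 : M * Mc * (k0 / (8 * (M * Mc + 1)) * F t) <= k0 / 8 * F t.
    have MM : 0 <= M * Mc by exact: mulr_ge0.
    rewrite mulrA; apply: ler_wpM2r => //.
    have M1 : 0 < M * Mc + 1 by rewrite ltr_wpDl.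
    have -> : M * Mc * (k0 / (8 * (M * Mc + 1))) = (k0 / 8) * (M * Mc / (M * Mc + 1)) by field; rewrite gt_eqF.
    by rewrite ler_piMr ?divr_ge0 ?(ltW k00)// ler_pdivrMr// mul1r lerDl.
  have r1 := ler_wpM2l M0 n1; have r2 := ler_wpM2l (mulr_ge0 M0 Mc0) n2.
  have r3 : Num.min (k0 / 4) C2^-1 * F t <= k0 / 4 * F t by apply: ler_wpM2r => //; rewrite ge_min lexx.
  rewrite [leRHS]mulrDr in r1; rewrite [leRHS]mulrDr in r2.
  rewrite /C1; clear - V0 hB dmge q1 q2 r1 r2 r3; lra.
have : m t `^ l <= C2 * F t.
  apply: powR_le_of_linear_bounds => // lam lam0; apply: (le_trans mN).
  apply: ler_pM => //; [|by rewrite /A lerDl|].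
    apply: lint_ge0 => x; rewrite indicE; case: (boolP (_ \in _)) => [/set_mem Dx|_]; last by rewrite mul0r.
    by rewrite mul1r uD.
  apply: (le_trans (mass lam t lam0 tT')); rewrite lerD2l; apply: ler_wpM2l; first exact: ltW.
  by rewrite /V1 lerDl.
move=> h; apply: (@le_trans _ _ (C2^-1 * m t `^ l)).
  by apply: ler_wpM2r; [exact: powR_ge0|rewrite ge_min lexx orbT].
by rewrite mulrC ler_pdivrMr// mulrC.
Qed.

(** * Interior growth and its improvement *)

Lemma bounded_before R n (D : set 'rV[R]_n) nu p l Mc k0 T u (b : R) :
  flux_solution D nu p l Mc k0 T u -> b < T ->
  exists2 M : R, 0 <= M & forall x t, closure D x -> 0 <= t <= b -> u x t <= M.
Proof.
move=> [[oD bD _ _] [_ [cu _]] _ _ _] bT.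
have cK : compact (closure D `*` [set` `[0, b]]).
  by apply: compact_setX; [exact: compact_closure_bounded|exact: segment_compact].
have [|M M0 hM] := compact_within_bounded cK (f := fun z => u z.1 z.2).
  apply: continuous_subspaceW cu => -[x t] [/= cx]; rewrite !in_itv/= => /andP[t0 tb].
  by split => //; rewrite t0 (le_lt_trans tb).
exists M => // x t cx tb; apply: (le_trans (ler_norm _)).
by apply: (hM (x, t)); split => //=; rewrite in_itv.
Qed.

(** The constant depends on the distance to the boundary alone. The summand 1 makes
    the notion meaningful for negative [q], where it amounts to boundedness. *)
Definition interior_growth R n (D : set 'rV[R]_n) (T : R)
    (u : 'rV[R]_n -> R -> R) (q : R) : Prop :=
  forall r : R, 0 < r -> exists2 C : R, 0 <= C & forall x t, ball x r `<=` D -> 0 <= t < T ->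
    u x t <= C * (1 + (T - t) `^ (- q)).

Lemma interior_growth_late R n (D : set 'rV[R]_n) nu p l Mc k0 T u (q b : R) :
  flux_solution D nu p l Mc k0 T u -> b < T ->
  (forall r : R, 0 < r -> exists2 C : R, 0 <= C & forall x t, ball x r `<=` D -> b <= t < T ->
    u x t <= C * (1 + (T - t) `^ (- q))) -> interior_growth D T u q.
Proof.
move=> fs bT late r r0; have [M M0 hM] := bounded_before fs bT.
have [C C0 hC] := late r r0; exists (M + C); first exact: addr_ge0.
move=> x t xr /andP[t0 tT]; have hq := powR_ge0 (T - t) (- q).
have h1 : 0 <= M * (T - t) `^ (- q) by exact: mulr_ge0.
have h2 : 0 <= C * (T - t) `^ (- q) by exact: mulr_ge0.
have [tb|bt] := ltP t b.
  have Dx : closure D x by apply: subset_closure; apply: xr; exact: ballxx.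
  by have := hM x t Dx; rewrite t0 ltW// => /(_ isT); lra.
by have := hC x t xr; rewrite bt tT => /(_ isT); lra.
Qed.

Lemma le_lint_indic R n (D W K : set 'rV[R]_n) (f g : 'rV[R]_n -> R) :
  bms (fun x => \1_K x * f x) -> bms (fun x => \1_D x * g x) -> K `<=` D ->
  (forall x, D x -> 0 <= g x) -> (forall x, K x -> f x <= g x) ->
  lint (fun x => \1_K x * f x) <= lint (fun x => \1_D x * g x).
Proof.
move=> bf bg KD g0 fg; apply: le_lint => // x.
rewrite indicE; case: (boolP (_ \in K)) => [/set_mem Kx|_].
  by rewrite indicE mem_set ?mul1r ?fg//; exact: KD.
rewrite mul0r indicE; case: (boolP (_ \in D)) => [/set_mem Dx|_]; last by rewrite mul0r.
by rewrite mul1r g0.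
Qed.

Lemma bms_sqball_slice R n (D : set 'rV[R]_n) nu p l Mc k0 T u (x0 : 'rV[R]_n) (r t : R) :
  flux_solution D nu p l Mc k0 T u -> 0 < r -> ball x0 r `<=` D -> 0 <= t < T ->
  let K := [set x | sqdist x0 x <= (r / 2) ^+ 2] in
  bms (fun x => \1_K x * u x t) /\ forall x, K x -> ball x (r / 2) `<=` D.
Proof.
move=> [[oD bD _ _] [_ c10] _ _ _] r0 xr tT K.
have KD x : K x -> ball x (r / 2) `<=` D.
  move=> Kx y xy; apply: xr; have r2 : 0 <= r / 2 by rewrite divr_ge0// ltW.
  have := norm_le_sqdist r2 Kx => h.
  move: xy; rewrite -!ball_normE/= => xy; rewrite -(subrKA x).
  apply: (le_lt_trans (ler_normD _ _)); rewrite distrC; lra.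
split => //; apply: bms_indicM; first by apply: compact_sqball; exact: sqr_ge0.
apply: continuous_subspaceW (C10_slice c10 tT) => x Kx.
by apply: subset_closure; apply: (KD x Kx); apply: ballxx; rewrite divr_gt0.
Qed.

(** The derivative of the boundary functional dominates the mass of [u], so it can
    drive the mean value inequality; its own size is that of solutions of
    y' = y^l that blow up at time [T]. *)
Lemma interior_growth_start R n (D : set 'rV[R]_n.+1) nu p l Mc k0 T u :
  flux_solution D nu p l Mc k0 T u -> D !=set0 -> 0 < p -> p < l -> 1 < l -> 0 <= Mc -> 0 < k0 ->
  0 < T -> interior_growth D T u (l - 1)^-1.
Proof.
move=> fs D0 p0 pl l1 Mc0 k00 T0.
have [c1 [C1 [c10 C10 mass fun_]]] := boundary_functional fs D0 p0 pl l1 Mc0 k00.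
have [[oD bD _ _] [_ c10'] u0 _ _] := fs.
have T2 : T / 2 < T by lra.
have T4 : 0 < T / 4 by lra.
apply: (@interior_growth_late _ _ D nu p l Mc k0 T u _ (3 * (T / 4)) fs); first by lra.
move=> r r0; have [C C0 hC] := @mean_value R n.+1 r T (T / 4) r0 T0 T4.
have [M M0 hM] := bounded_before fs T2.
have [A A0 hA] := superlinear_bound l1 (mulr_gt0 c10 c10) C10 T0.
set ga := - (l - 1)^-1.
pose B := M + (C1 / c1 + C1) * T + A * (2^-1) `^ ga / c1.
have ic1 : 0 <= c1^-1 by rewrite invr_ge0 ltW.
have h1 : 0 <= (C1 / c1 + C1) * T.
  by apply: mulr_ge0; [apply: addr_ge0 => //; exact: mulr_ge0|exact: ltW].
have h2 : 0 <= A * (2^-1) `^ ga / c1 by rewrite !mulr_ge0// powR_ge0.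
exists (C * B); first by rewrite mulr_ge0// /B !addr_ge0.
move=> x0 t xr /andP[tb tT].
pose t2 := (t + T) / 2.
have t2T : t2 < T by rewrite /t2; lra.
have tt2 : t < t2 by rewrite /t2; lra.
have T20 : 0 < T / 2 by lra.
have [m [dm hm]] := fun_ (T / 2) t2 T20 t2T.
pose G s := c1^-1 * m s + (C1 / c1 + C1) * s.
pose dG s := c1^-1 * dm s + (C1 / c1 + C1).
have dGd s : T / 2 <= s <= t -> is_derive s (1 : R) G (dG s).
  move=> /andP[s1 s2]; have [|_ hd _ _] := hm s; first by rewrite s1 (le_trans s2 (ltW tt2)).
  have h := is_deriveD (is_deriveZ c1^-1 hd) (is_deriveZ (C1 / c1 + C1) (is_derive_id s (1 : R))).
  by apply: (is_derive_cong h) => //; rewrite /dG /GRing.scale/= mulr1.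
have hdG s : T / 2 <= s <= t -> lint (fun x => \1_[set x | sqdist x0 x <= (r / 2) ^+ 2] x * u x s) <= dG s.
  move=> /andP[s1 s2]; have [|_ _ hd _] := hm s; first by rewrite s1 (le_trans s2 (ltW tt2)).
  have sT : 0 <= s < T by rewrite (le_trans (ltW T20) s1) (le_lt_trans s2 tT).
  have [bK KD] := bms_sqball_slice fs r0 xr sT.
  apply: (@le_trans _ _ (lint (fun x => \1_D x * u x s))).
    apply: le_lint_indic => //.
    - exact: bms_closure oD bD (C10_slice c10' sT).
    - by move=> x /KD; apply; apply: ballxx; rewrite divr_gt0.
    - by move=> x Dx; apply: u0 => //; exact: subset_closure.
  apply: (le_trans (mass s sT)).
  have := ler_wpM2l ic1 hd; rewrite mulrBr mulrA mulVf ?gt_eqF// mul1r /dG; clear; lra.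
have oB : open (ball x0 r : set 'rV[R]_n.+1) by exact: ball_open.
have sub := flux_subcaloric fs oB xr.
have := hC u x0 0 (T / 2) t T M G dG (lexx 0) (lexx T) T20 _ tT sub dGd hdG.
move=> /(_ ltac:(lra)) /(_ _) hu.
have {}hu := hu ltac:(by move=> x /xr Dx; apply: hM; [exact: subset_closure|lra]).
apply: (le_trans hu); rewrite -mulrA; apply: ler_wpM2l => //.
have mt : m t <= A * ((t2 - t) `^ ga).
  apply: (hA t t2 m dm tt2); first by rewrite /t2; lra.
  move=> s /andP[s1 s2]; have [|m0 hd hdm hml] := hm s; first by rewrite s2; lra.
  split => //; have := ler_wpM2l (ltW c10) hml; rewrite mulrA; clear - hdm; lra.
have [m0 _ _ _] := hm (T / 2) ltac:(rewrite lexx/=; lra).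
have t2E : (t2 - t) `^ ga = (2^-1) `^ ga * (T - t) `^ ga.
  by rewrite -powRM ?invr_ge0//; [congr (_ `^ _); rewrite /t2; lra|lra].
rewrite t2E in mt.
have mt' : c1^-1 * m t <= A * (2^-1) `^ ga / c1 * (T - t) `^ ga.
  have := ler_wpM2l ic1 mt; clear; lra.
have m0' : 0 <= c1^-1 * m (T / 2) by exact: mulr_ge0.
have w0 := powR_ge0 (T - t) ga.
have g1 : (C1 / c1 + C1) * t - (C1 / c1 + C1) * (T / 2) <= (C1 / c1 + C1) * T.
  rewrite -mulrBr; apply: ler_wpM2l; first by apply: addr_ge0 => //; exact: mulr_ge0.
  lra.
have g2 : 0 <= M * (T - t) `^ ga by exact: mulr_ge0.
have g3 : 0 <= (C1 / c1 + C1) * T * (T - t) `^ ga by exact: mulr_ge0.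
rewrite /G /B; clear - mt' m0' w0 g1 g2 g3 h1 h2; lra.
Qed.

(** On a ball of half the radius the local mass grows like (T - t)^(-q), whose
    primitive in time has one power less; [q != 1] excludes a logarithm. *)
Lemma interior_growth_step R n (D : set 'rV[R]_n) nu p l Mc k0 T u (q : R) :
  flux_solution D nu p l Mc k0 T u -> 0 < T -> q != 1 ->
  interior_growth D T u q -> interior_growth D T u (q - 1).
Proof.
move=> fs T0 q1 gr.
have [[oD bD _ _] [_ c10] u0 _ _] := fs.
have T2 : T / 2 < T by lra.
have T4 : 0 < T / 4 by lra.
have T20 : 0 < T / 2 by lra.
apply: (@interior_growth_late _ _ D nu p l Mc k0 T u _ (3 * (T / 4)) fs); first by lra.
move=> r r0; have [C C0 hC] := @mean_value R n r T (T / 4) r0 T0 T4.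
have [M M0 hM] := bounded_before fs T2.
have r20 : 0 < r / 2 by lra.
have [E E0 hE] := gr (r / 2) r20.
have bI : bms (\1_D : 'rV[R]_n -> R) by apply: bms_indic => //; exact: open_row_measurable.
pose V := lint (\1_D : 'rV[R]_n -> R).
have V0 : 0 <= V by apply: lint_ge0 => x; rewrite indicE.
have EV : 0 <= E * V by exact: mulr_ge0.
have q10 : q - 1 != 0 by rewrite subr_eq0.
pose iq := `|(q - 1)^-1|.
have iq0 : 0 <= iq by exact: normr_ge0.
pose B := M + E * V * T + E * V * iq * ((T / 2) `^ (1 - q)) + E * V * iq.
have b2 : 0 <= E * V * iq by exact: mulr_ge0.
have b1 : 0 <= E * V * iq * ((T / 2) `^ (1 - q)) by rewrite mulr_ge0// powR_ge0.
have b3 : 0 <= E * V * T by rewrite mulr_ge0// ltW.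
exists (C * B); first by rewrite mulr_ge0// /B !addr_ge0.
move=> x0 t xr /andP[tb tT].
pose G s := E * V * (s + (T - s) `^ (1 - q) / (q - 1)).
pose dG s := E * V * (1 + (T - s) `^ (- q)).
have dGd s : T / 2 <= s <= t -> is_derive s (1 : R) G (dG s).
  move=> /andP[s1 s2]; have Ts : 0 < T - s by lra.
  have h1 : is_derive s (1 : R) (fun s : R => T - s) (0 - 1) by apply: is_deriveB.
  have h2 := is_derive_chain h1 (is_derive1_powR (1 - q) Ts).
  have h3 := is_deriveD (is_derive_id s (1 : R)) (is_deriveZ (q - 1)^-1 h2).
  apply: (is_derive_cong (is_deriveZ (E * V) h3)).
    move=> s'; change (E * V * (s' + (q - 1)^-1 * (T - s') `^ (1 - q)) = G s').
    by rewrite /G [(q - 1)^-1 * _]mulrC.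
  rewrite /dG /GRing.scale/=; congr (_ * (_ + _)).
  have -> : 1 - q - 1 = - q by rewrite addrAC subrr add0r.
  by field.
have hdG s : T / 2 <= s <= t -> lint (fun x => \1_[set x | sqdist x0 x <= (r / 2) ^+ 2] x * u x s) <= dG s.
  move=> /andP[s1 s2].
  have sT : 0 <= s < T by rewrite (le_trans (ltW T20) s1) (le_lt_trans s2 tT).
  have [bK KD] := bms_sqball_slice fs r0 xr sT.
  have e0 : 0 <= E * (1 + (T - s) `^ (- q)) by rewrite mulr_ge0// addr_ge0// powR_ge0.
  have -> : dG s = lint (fun x => \1_D x * (E * (1 + (T - s) `^ (- q)))).
    rewrite (@eq_lint _ _ _ (fun x => (E * (1 + (T - s) `^ (- q))) * \1_D x)); last by move=> x; rewrite mulrC.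
    by rewrite lintZ// /dG /V; ring.
  apply: le_lint_indic => //.
  - rewrite (_ : (fun x => _) = (fun x => (E * (1 + (T - s) `^ (- q))) * \1_D x)); first exact: bmsZ.
    by apply/funext => x; rewrite mulrC.
  - by move=> x /KD; apply; apply: ballxx; rewrite divr_gt0.
  - by move=> x /KD h; exact: hE.
have oB : open (ball x0 r : set 'rV[R]_n) by exact: ball_open.
have sub := flux_subcaloric fs oB xr.
have := hC u x0 0 (T / 2) t T M G dG (lexx 0) (lexx T) T20 _ tT sub dGd hdG.
move=> /(_ ltac:(lra)) /(_ _) hu.
have {}hu := hu ltac:(by move=> x /xr Dx; apply: hM; [exact: subset_closure|lra]).
apply: (le_trans hu); rewrite -mulrA; apply: ler_wpM2l => //.
have -> : - (q - 1) = 1 - q by rewrite opprB.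
set w := (T - t) `^ (1 - q).
have w0 : 0 <= w by exact: powR_ge0.
set w2 := (T / 2) `^ (1 - q) in B b1 *.
have w20 : 0 <= w2 by exact: powR_ge0.
have gE : G t - G (T / 2) = E * V * (t - T / 2) + E * V * ((w - w2) / (q - 1)).
  rewrite /G -/w; have -> : T - T / 2 = T / 2 by field.
  by rewrite -/w2; field.
have g1 : E * V * (t - T / 2) <= E * V * T by apply: ler_wpM2l => //; clear - tT T0; lra.
have g2 : E * V * ((w - w2) / (q - 1)) <= E * V * ((w + w2) * iq).
  apply: ler_wpM2l => //; apply: (le_trans (ler_norm _)); rewrite normrM -/iq.
  apply: ler_wpM2r => //; apply: (le_trans (ler_normB _ _)).
  by rewrite !ger0_norm.
have g3 : 0 <= (M + E * V * T + E * V * iq * w2) * w by rewrite mulr_ge0// !addr_ge0.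
rewrite gE /B; clear - g1 g2 g3 w0 b2; lra.
Qed.

Lemma interior_bounded R n (D : set 'rV[R]_n.+1) nu p l Mc k0 T u (r : R) :
  flux_solution D nu p l Mc k0 T u -> D !=set0 -> 0 < p -> p < l -> 1 < l -> 0 <= Mc -> 0 < k0 ->
  0 < T -> 0 < r ->
  exists M : R, forall x t, ball x r `<=` D -> 0 <= t < T -> u x t <= M.
Proof.
move=> fs D0 p0 pl l1 Mc0 k00 T0 r0.
have gr := interior_growth_start fs D0 p0 pl l1 Mc0 k00 T0.
(* the steps start from a half-integer above the first exponent, hence never meet
   the exponent 1 *)
pose N := Num.trunc (l - 1)^-1.
have step (j : nat) : interior_growth D T u (j.+1%:R - 2^-1) -> interior_growth D T u (j%:R - 2^-1).
  move=> h; have -> : j%:R - 2^-1 = j.+1%:R - 2^-1 - 1 :> R by rewrite -natr1; lra.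
  apply: interior_growth_step fs T0 _ h.
  apply/eqP => e; have : (j.*2.+1)%:R = 2%:R :> R by rewrite -natr1 -muln2 natrM; rewrite -natr1 in e; lra.
  by move/eqP; rewrite eqr_nat => /eqP/(congr1 odd); rewrite /= odd_double.
have all0 (j : nat) : interior_growth D T u (j%:R - 2^-1) -> interior_growth D T u (0%:R - 2^-1).
  by elim: j => // j IH /step.
have start : interior_growth D T u (N.+2%:R - 2^-1).
  move=> r' r'0; have [C C0 hC] := gr r' r'0; exists (C * 2); first exact: mulr_ge0.
  move=> x t xr tT; apply: (le_trans (hC x t xr tT)); rewrite -mulrA; apply: ler_wpM2l => //.
  have Tt : 0 < T - t by move: tT => /andP[_ h]; lra.
  have NE : (l - 1)^-1 <= N.+2%:R - 2^-1.
    have : (l - 1)^-1 < N.+1%:R by apply: Num.Theory.truncnS_gt.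
    by rewrite -[N.+2%:R]natr1; lra.
  have w0 := powR_ge0 (T - t) (- (N.+2%:R - 2^-1)).
  have [h|h] := leP (T - t) 1.
    suff : (T - t) `^ (- (l - 1)^-1) <= (T - t) `^ (- (N.+2%:R - 2^-1)) by lra.
    by apply: ger_powR; rewrite ?Tt ?lerN2.
  suff : (T - t) `^ (- (l - 1)^-1) <= 1 by lra.
  apply: (@le_trans _ _ ((T - t) `^ 0)); last by rewrite powRr0.
  apply: ler_powR; first exact: ltW.
  by rewrite oppr_le0 invr_ge0 subr_ge0 ltW.
have [C C0 hC] := all0 _ start r r0.
exists (C * (1 + T `^ 2^-1)) => x t xr tT; apply: (le_trans (hC x t xr tT)).
apply: ler_wpM2l => //; rewrite lerD2l sub0r opprK.
move: tT => /andP[t0 tT]; apply: ge0_ler_powR; rewrite ?nnegrE; lra.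
Qed.

Lemma compact_room R n (K D : set 'rV[R]_n) :
  compact K -> open D -> K `<=` D ->
  exists2 r : R, 0 < r & forall x, K x -> ball x r `<=` D.
Proof.
move=> /compact_near_coveringP cK oD KD.
have : \forall r \near 0^'+, K `<=` (fun x => ball x r `<=` D).
  apply: (cK _ (0^'+) (fun (r : R) x => ball x r `<=` D)) => x Kx.
  have [e e0 he] := open_norm_ball oD (KD x Kx).
  exists (ball x (e / 2), [set r | r < e / 2]).
    split; first by apply: nbhsx_ballx; rewrite divr_gt0.
    by apply: nbhs_right_lt; rewrite divr_gt0.
  move=> [x' r] [/= xx' re] y xy; apply: he; move: xx' xy; rewrite -!ball_normE/= => xx' xy.
  rewrite distrC -(subrKA x'); apply: (le_lt_trans (ler_normD _ _)); lra.
move=> h; have [r [r0 hr]] := filter_ex (filterI (nbhs_right_gt (0 : R)) h).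
by exists r.
Qed.

(** * Solutions of the boundary value problem *)

Lemma space_integralE R n (D : set 'rV[R]_n) (f : 'rV[R]_n -> R) :
  space_integral D f = lint (fun x => \1_D x * f x).
Proof.
rewrite /space_integral Rintegral_mkcond; apply: eq_Rintegral => t _.
rewrite patchE /= indicE.
have [h|h] := pselect (D (row_of_tuple t)).
  have ht : (@row_of_tuple R n @^-1` D) t by [].
  by rewrite (mem_set ht) (mem_set h) mul1r.
have ht : ~ (@row_of_tuple R n @^-1` D) t by [].
by rewrite (memNset ht) (memNset h) mul0r.
Qed.

Lemma holder_bounded R n (D : set 'rV[R]_n) (alpha T : R)
    (c : 'rV[R]_n -> R -> R) :
  bounded_set D -> 0 <= alpha -> locally_holder alpha (closure D `*` [set` `[0, +oo[]) c ->
  exists2 M : R, 0 <= M & forall x t, closure D x -> 0 <= t <= T -> `|c x t| <= M.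
Proof.
move=> bD a0 hc; pose K := closure D `*` [set` `[0, T]] : set ('rV[R]_n * R).
have cK : compact K.
  by apply: compact_setX; [exact: compact_closure_bounded|exact: segment_compact].
have [|C hC] := hc K cK.
  by move=> [x t] [/= cx]; rewrite !in_itv/= andbT => /andP[].
have [[[x0 s0] K0]|nK] := pselect (K !=set0); last first.
  exists 0 => // x t cx tT; exfalso; apply: nK; exists (x, t); split => //=.
have [M [_ hM]] := compact_bounded cK.
pose N := `|M| + 1.
have KN z : K z -> `|z| <= N by apply: hM; rewrite /N ltr_pwDr// ler_norm.
exists (`|c x0 s0| + `|C| * (2 * N) `^ alpha).
  by rewrite addr_ge0// mulr_ge0// powR_ge0.
move=> x t cx tT; have Kx : K (x, t) by split => //=; rewrite in_itv.
have h1 : `|(x, t) - (x0, s0)| <= 2 * N.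
  by apply: (le_trans (ler_normB _ _)); have := KN _ Kx; have := KN _ K0; lra.
have := hC (x, t) (x0, s0) Kx K0 => /= h2.
have h3 : C * `|(x, t) - (x0, s0)| `^ alpha <= `|C| * (2 * N) `^ alpha.
  apply: (@le_trans _ _ (`|C| * `|(x, t) - (x0, s0)| `^ alpha)).
    by apply: ler_wpM2r; [exact: powR_ge0|exact: ler_norm].
  apply: ler_wpM2l => //; apply: ge0_ler_powR; rewrite ?nnegrE//.
  exact: le_trans h1.
rewrite -[c x t](subrK (c x0 s0)); apply: (le_trans (ler_normD _ _)).
lra.
Qed.

Lemma solution_flux R n (D : set 'rV[R]_n)
    (nu : 'rV[R]_n -> 'rV[R]_n) (p l alpha T : R) (c : 'rV[R]_n -> R -> R)
    (k : 'rV[R]_n -> 'rV[R]_n -> R -> R) (u0 : 'rV[R]_n -> R)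
    (u : 'rV[R]_n -> R -> R) :
  open D -> bounded_set D -> smooth_boundary D -> outward_unit_normal D nu ->
  0 < l -> 0 <= alpha -> locally_holder alpha (closure D `*` [set` `[0, +oo[]) c ->
  (forall x t, closure D x -> 0 <= t -> 0 <= c x t) ->
  {within boundary D `*` closure D `*` [set` `[0, +oo[],
    continuous (fun z => k z.1.1 z.1.2 z.2)} ->
  (forall x y t, boundary D x -> closure D y -> 0 <= t -> 0 <= k x y t) ->
  solution D nu p l c k u0 T u ->
  exists2 Mc : R, 0 <= Mc & flux_solution D nu p l Mc
    (inf [set k z.1.1 z.1.2 z.2 | z in boundary D `*` D `*` [set` `]0, T[]]) T u.
Proof.
move=> oD bD sb hnu l0 a0 hc c0 ck kge0 [[c21 c10] u_ge0 eqn flx _].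
set S := [set _ | _ in _]; set k0 := inf S.
have [Mc Mc0 hMc] := @holder_bounded R n D alpha T c bD a0 hc.
exists Mc => //; split => //.
- move=> x t Dx /andP[t0 tT].
  have cx : closure D x by exact: subset_closure.
  have up : 0 <= u x t `^ p by exact: powR_ge0.
  have cge : 0 <= c x t by apply: c0 => //; exact: ltW.
  have cle : c x t <= Mc by apply: (le_trans (ler_norm _)); apply: hMc => //; rewrite !ltW.
  rewrite eqn ?t0//; have := ler_wpM2r up cle; have := mulr_ge0 cge up => h1 h2.
  by apply/andP; split; lra.
move=> x t bx /andP[t0 tT].
have tT' : 0 <= t < T by rewrite ltW.
exists (space_integral D (fun y => k x y t * u y t `^ l)); first exact: flx.
have ckx : {within closure D, continuous (fun y => k x y t)}.
  apply/within_epsP => y cy e e0.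
  have [|d d0 hd] := (within_epsP _ _).1 ck ((x, y), t) _ e e0.
    by split => //=; rewrite in_itv/= andbT ltW.
  exists d => // y' cy' yy'; apply: (hd ((x, y'), t)).
    by split => //=; rewrite in_itv/= andbT ltW.
  by rewrite !prod_normE/= !subrr !normr0 !gt_max d0 yy'.
have cut : {within closure D, continuous (u ^~ t)} := C10_slice c10 tT'.
have b1 := bms_closure oD bD ckx.
have b2 := bms_closure oD bD cut.
have up x' : 0 <= \1_D x' * u x' t.
  rewrite indicE; case: (boolP (_ \in _)) => [/set_mem Dx|_]; last by rewrite mul0r.
  by rewrite mul1r u_ge0//; exact: subset_closure.
have pE : (fun x => \1_D x * u x t `^ l) = (fun x => (\1_D x * u x t) `^ l).
  apply/funext => y; rewrite indicE; case: (_ \in _); first by rewrite !mul1r.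
  by rewrite !mul0r powR0// gt_eqF.
have b3 : bms (fun x => \1_D x * u x t `^ l) by rewrite pE; exact: bms_powR.
rewrite space_integralE -lintZ//; apply: le_lint; first exact: bmsZ.
  rewrite (_ : (fun y => _) = (fun y => (\1_D y * k x y t) * (\1_D y * u y t `^ l))).
    exact: bmsM.
  apply/funext => y; rewrite indicE; case: (_ \in _); first by rewrite !mul1r.
  by rewrite !mul0r.
move=> y; rewrite indicE; case: (boolP (_ \in _)) => [/set_mem Dy|_]; last by rewrite !mul0r mulr0.
rewrite !mul1r; apply: ler_wpM2r; first exact: powR_ge0.
apply: ge_inf.
  exists 0 => ? [[[x' y'] s] [[/= bx' Dy'] hs] <-]; move: hs; rewrite in_itv/= => /andP[s0 _].
  by apply: kge0 => //; [exact: subset_closure|exact: ltW].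
exists ((x, y), t) => //; split => //=; by rewrite in_itv/= t0.
Qed.

Theorem theorem4p2 (R : realType) (n : nat) (Omega : set 'rV[R]_n)
    (nu : 'rV[R]_n -> 'rV[R]_n) (p l alpha T : R) (c : 'rV[R]_n -> R -> R)
    (k : 'rV[R]_n -> 'rV[R]_n -> R -> R) (u0 : 'rV[R]_n -> R)
    (u : 'rV[R]_n -> R -> R) :
  (1 <= n)%N ->
  domain Omega -> bounded_set Omega -> smooth_boundary Omega ->
  outward_unit_normal Omega nu ->
  0 < p -> 0 < l ->
  0 < alpha < 1 ->
  locally_holder alpha (closure Omega `*` [set` `[0, +oo[]) c ->
  (forall x t, closure Omega x -> 0 <= t -> 0 <= c x t) ->
  {within boundary Omega `*` closure Omega `*` [set` `[0, +oo[],
    continuous (fun z => k z.1.1 z.1.2 z.2)} ->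
  (forall x y t, boundary Omega x -> closure Omega y -> 0 <= t ->
    0 <= k x y t) ->
  admissible Omega nu l k u0 ->
  Num.max p 1 < l ->
  0 < T ->
  0 < inf [set k z.1.1 z.1.2 z.2 |
           z in boundary Omega `*` Omega `*` [set` `]0, T[]] ->
  solution Omega nu p l c k u0 T u ->
  blows_up_at Omega T u ->
  blow_up_only_on_boundary Omega T u.
Proof.
case: n Omega nu c k u0 u => [//|n] Omega nu c k u0 u _.
move=> [D0 oD _] bD sb hnu p0 l0 /andP[a0 _] hc c0 ck k0 _.
rewrite gt_max => /andP[pl l1] T0 inf0 sol _ D' _ cD' D'D.
have [Mc Mc0 fs] := solution_flux oD bD sb hnu l0 (ltW a0) hc c0 ck k0 sol.
have [r r0 hr] := compact_room cD' oD D'D.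
have [M hM] := interior_bounded fs D0 p0 pl l1 Mc0 inf0 T0 r0.
have [_ u_ge0 _ _ _] := sol.
exists M => x t D'x tT.
have cx : closure D' x by exact: subset_closure.
rewrite ger0_norm; first exact: hM (hr x cx) tT.
by apply: u_ge0 => //; apply: subset_closure; exact: D'D.
Qed.
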